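(* For every integer $r\geq 4$ and every integer $\ell\geq 2$ there exist $K_0\in\mathbb{N}$ and a constant $c=c(\ell,r)>0$ such that for all sufficiently large $n\in\mathbb{N}$ and every $K\geq K_0(\log n)^{2r^2}$ there exists a collection $\mathcal{G}_{\ell,r}(n,K)$ of at most $$\exp\left(n^{1+\frac{1}{2\ell-1}}(\log n)^{c}\right)$$ $r$-graphs on vertex set $[n]$ such that $e(G)\leq Kn^{r-1}$ for each $G\in\mathcal{G}_{\ell,r}(n,K)$, and every $C_{2\ell}^{(r)}$-free $r$-graph on $[n]$ is a subgraph of some $G\in\mathcal{G}_{\ell,r}(n,K)$.
   Context: An $r$-graph is an $r$-uniform hypergraph; $e(G)$ denotes its number of edges and $[n]=\{1,\dots,n\}$. The linear cycle $C_k^{(r)}$ is the $r$-graph obtained from the graph cycle $C_k$ by adding, to each of its $k$ edges, $r-2$ new vertices of degree one. A hypergraph is $H$-free if it contains no (not necessarily induced) subgraph isomorphic to $H$. (In the paper the factor $(\log n)^c$ is written ${\rm plog}_{\ell,r}(n)$, denoting a function of order $\Theta((\log n)^{f(\ell,r)})$ with $f(\ell,r)>0$ depending only on $\ell,r$.) *)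

(* Defs.v *)
From mathcomp Require Import all_boot.

Set Implicit Arguments.
Unset Strict Implicit.
Unset Printing Implicit Defensive.

(* A hypergraph on the vertex set T is identified with its edge set. *)
Notation hypergraph T := {set {set T}}.

Definition is_uniform (T : finType) (r : nat) (G : hypergraph T) : bool :=
  [forall e in G, #|e| == r].

(* The injection f exhibits the image of H as the copy of H inside G; the copy
   need not be induced. *)
Definition contains_copy (S T : finType) (H : hypergraph S) (G : hypergraph T) : Prop :=
  exists2 f : S -> T, injective f & [set f @: e | e : {set S} in H] \subset G.

Definition copy_free (S T : finType) (H : hypergraph S) (G : hypergraph T) : Prop :=
  ~ contains_copy H G.

(* inl i is the i-th vertex of the graph cycle C_k, and inr (i, j) is the j-th of
   the r - 2 new vertices added to the edge {i, i + 1} of C_k.  This is the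
   intended hypergraph for k >= 3 and r >= 2. *)
Definition linear_cycle_vertex (k r : nat) : finType :=
  ('I_k + 'I_k * 'I_(r - 2))%type.

Definition linear_cycle_edge (k r : nat) (i : 'I_k) :
    {set linear_cycle_vertex k r} :=
  [set inl i; inl (ordS i)] :|: [set inr (i, j) | j : 'I_(r - 2)].

Definition linear_cycle (k r : nat) : hypergraph (linear_cycle_vertex k r) :=
  [set linear_cycle_edge r i | i : 'I_k].

(* Main.v *)
(* A container lemma for weighted uniform hypergraphs, proved by induction on the
   uniformity, reduces the theorem to supersaturation: an r-graph G with many more
   than n^(r-1) edges contains a balanced family of copies of C_2l, one in which no
   small set of edges of G lies in too many copies.  O(log n) rounds of containers
   then bring the number of edges down to K n^(r-1).

   The balanced family is built greedily.  The next copy must avoid the sets of edges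
   that are already saturated, so it suffices to find a single copy of C_2l that
   avoids a sparse family of forbidden sets.  Sorting the vertices turns each edge
   into an r-tuple.  At the cost of powers of log n one passes to a subfamily whose
   degrees and codegrees in pairs of coordinates are dyadically constant and in which
   changing a single coordinate of an edge can always be done in many ways.  As
   r >= 4, there are two coordinates of which the codegree is at most n^(-2/3) times
   the degree, up to constants.  Consider closed walks of length 2l in the weighted
   bipartite graph W of these two coordinates: because of the freedom in the other
   coordinates, most of them are linear cycles.  Their number is a trace, which is
   bounded from below through the log-convexity of the even moments of W.  After
   discarding edges on too few walks, log-convexity also bounds the number of walks
   that pass through a prescribed block of consecutive edges, whereas each gap in a
   non-contiguous pattern of prescribed edges gains a factor from the codegree. *)
Require Import Defs.
From mathcomp Require Import all_boot all_order all_algebra.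
From mathcomp Require Import ring lra zify.
Set Implicit Arguments.
Unset Strict Implicit.
Unset Printing Implicit Defensive.
Import Order.TTheory GRing.Theory Num.Theory.
Local Open Scope ring_scope.

(** Forbidden sets are controlled only through single edges: an edge lies in at most [H ^+ j.-1] of
    those of size [j]. The bound on walks through prescribed edges is therefore made proportional to
    the weight [mu] of the walks through one of these edges; summed over all forbidden sets, it
    becomes a multiple of the total weight [T]. Discarding light edges makes such a local bound
    possible: at a heavy edge, [mu] controls the return moments of both end nodes. The exponent
    comes from one balance. Each further prescribed edge may cost a factor [rho], and prescribing
    all [2l] edges requires [n <= zeta * rho ^ (2l - 1)]; so [rho] is [nu = n ^ (1 / (2l - 1))] up
    to logarithms. Supersaturation then holds with [h] about [#|G| / (n * nu)], and containers are
    encoded by about [#|G| / h] edges, which gives [n ^ (1 + 1 / (2l - 1))]. The codegree gain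
    [n ^ (-2/3)] suffices for the interpolation because [3 (l - 1) >= 2l - 1]. The exponent
    [2 r ^ 2] comes from the [(t + 1) ^ (r ^ 2)] dyadic types of edges, where
    [t + 1 <= (ln n) ^ 2]. *)

Lemma card_bigcup_le (I U : finType) (P : pred I) (F : I -> {set U}) :
  (#|\bigcup_(i | P i) F i| <= \sum_(i | P i) #|F i|)%N.
Proof.
elim/big_rec2: _ => [|i k A _ le]; first by rewrite cards0.
by apply: leq_trans (leq_card_setU _ _) _; rewrite leq_add2l.
Qed.

(** * Containers for weighted uniform hypergraphs *)

Section Containers.
Variable R : realFieldType.

Definition wdeg (V : finType) (w : {set V} -> R) (T : {set V}) : R :=
  \sum_(E : {set V} | T \subset E) w E.

Lemma wdeg_ge0 (V : finType) (w : {set V} -> R) (T : {set V}) :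
  (forall E, 0 <= w E) -> 0 <= wdeg w T.
Proof. by move=> w0; apply: sumr_ge0. Qed.

Lemma sum_link_le (V : finType) (w : {set V} -> R) (u : V) (T : {set V})
    (P : pred {set V}) :
  (forall E, 0 <= w E) -> u \notin T ->
  \sum_(F : {set V} | (T \subset F) && (u \notin F) && P F) w (u |: F)
    <= wdeg w (u |: T).
Proof.
move=> w0 uT; rewrite /wdeg.
have inj : {in [pred F : {set V} | (T \subset F) && (u \notin F) && P F] &,
    injective (fun F => u |: F)}.
  move=> F F' /andP[/andP[_ uF] _] /andP[/andP[_ uF'] _] e.
  by rewrite -(setU1K uF) -(setU1K uF') e.
rewrite -(big_imset (fun E => w E) inj) /=.
rewrite [leRHS](bigID (mem [set u |: F | F in
  [pred F : {set V} | (T \subset F) && (u \notin F) && P F]])) /=.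
apply: ler_wpDr; first by apply: sumr_ge0.
rewrite le_eqVlt; apply/orP; left; apply/eqP; apply: eq_bigl => E.
apply/idP/andP => [EI|[]//]; split=> //.
by have /imsetP[F /andP[/andP[TF _] _] ->] := EI; apply: setUS.
Qed.

Lemma sum_wdeg (V : finType) (w : {set V} -> R) (k : nat) :
  (forall E, 0 <= w E) -> (forall E, w E != 0 -> #|E| = k) ->
  \sum_(T : {set V}) wdeg w T <= 2 ^+ k * \sum_E w E.
Proof.
move=> w0 wk; rewrite /wdeg.
under eq_bigr do rewrite big_mkcond /=.
rewrite exchange_big /= mulr_sumr; apply: ler_sum => E _.
rewrite -big_mkcond /= sumr_const.
have [->|/wk Ek] := eqVneq (w E) 0; first by rewrite mul0rn mulr0.
rewrite -[#|_|]/#|[pred T : {set V} | T \subset E]|.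
have -> : #|[pred T : {set V} | T \subset E]| = (2 ^ k)%N.
  by rewrite -Ek -card_powerset; apply: eq_card => T; rewrite inE powersetE.
by rewrite -natrX mulrC mulr_natr.
Qed.

Lemma le_sum_const (I : finType) (P : pred I) (i : I) (x : R) :
  0 <= x -> P i -> x <= \sum_(i | P i) x.
Proof. by move=> x0 Pi; rewrite (bigD1 i) //= lerDl sumr_ge0. Qed.

(** The threshold is half of the degree bound that [w'] has to satisfy in the step below ([2 * B]),
    so that one more link cannot push an unsaturated set beyond that bound. *)
Definition saturated (V : finType) (w : {set V} -> R) (B tau D : R) (T : {set V}) :=
  (T != set0) && (B * tau ^+ #|T|.-1 * D <= wdeg w T).

Definition unsaturated (V : finType) (w : {set V} -> R) (B tau D : R) (F : {set V}) :=
  [forall T : {set V}, (T \subset F) ==> ~~ saturated w B tau D T].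

Definition gain (V : finType) (w w' : {set V} -> R) (B tau D : R) (u : V) : R :=
  \sum_(F : {set V} | (u \notin F) && unsaturated w' B tau D F) w (u |: F).

(** Link edges that contain a saturated set are left out, which freezes the degrees of saturated
    sets. *)
Definition add_link (V : finType) (w w' : {set V} -> R) (B tau D : R) (u : V)
    (F : {set V}) : R :=
  w' F + (if (u \notin F) && unsaturated w' B tau D F then w (u |: F) else 0).

(** [indep] is a further condition on [I]: during the recursion on links, [I] must be independent
    both for the accumulated link weight and for the original weight. *)
Definition covering_family (V : finType) (A : {set V}) (delta : R) (N : nat)
    (w : {set V} -> R) (indep : {set V} -> Prop) :=
  exists CC : {set {set V}},
    [/\ (#|CC| <= N)%N,
        forall C, C \in CC -> C \subset A /\ delta * #|A|%:R <= #|A :\: C|%:R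
      & forall I : {set V}, I \subset A -> (forall E, w E != 0 -> ~~ (E \subset I)) ->
          indep I -> exists2 C, C \in CC & I \subset C].

(** Besides the decay of degrees, [tau] measures the fingerprints: about [tau * #|A|] vertices are
    chosen at each uniformity. *)
Definition bounded_weight (V : finType) (A : {set V}) (k : nat) (B tau D : R)
    (w : {set V} -> R) :=
  [/\ forall E, 0 <= w E,
      forall E, w E != 0 -> E \subset A /\ #|E| = k
    & forall T : {set V}, T != set0 -> (#|T| <= k)%N ->
        wdeg w T <= B * tau ^+ #|T|.-1 * D].

Section Step.
Variables (V : finType) (A : {set V}) (k m : nat) (B beta tau D delta' : R).
Hypotheses (B0 : 0 < B) (beta0 : 0 < beta) (tau0 : 0 < tau) (D0 : 0 < D).
Hypothesis mA : tau * #|A|%:R <= m%:R.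
Variable w : {set V} -> R.
Hypothesis wB : bounded_weight A k.+2 B tau D w.
Hypothesis wtot : beta * #|A|%:R * D <= \sum_E w E.
Let D' := tau * D.
(** With this value the weight lost to saturated sets in [few_low_gain] is at most a quarter of the
    guaranteed total: [2 ^+ k.+1] counts the subsets of an edge, and a factor 4 remains. *)
Let gamma := beta / 2 ^+ k.+3.
Let delta := Num.min delta' (beta / (2 * B)).
Variable N : nat.
Hypothesis N0 : (0 < N)%N.
Hypothesis IH : forall w' : {set V} -> R, bounded_weight A k.+1 (2 * B) tau D' w' ->
  gamma * #|A|%:R * D' <= \sum_E w' E ->
  covering_family A delta' N w' (fun _ => True).

Let D'0 : 0 < D'. Proof. exact: mulr_gt0. Qed.
Let gamma0 : 0 < gamma. Proof. by rewrite divr_gt0 // exprn_gt0. Qed.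

(** A saturated set receives nothing. An unsaturated one is below the bound with [B] and gains at
    most the degree of [u |: T] in [w], which is again at most [B * tau ^+ #|T|.-1 * D'] because
    [D' = tau * D]. *)
Lemma bounded_add_link (w' : {set V} -> R) (u : V) :
  bounded_weight A k.+1 (2 * B) tau D' w' ->
  bounded_weight A k.+1 (2 * B) tau D' (add_link w w' B tau D' u).
Proof.
case: wB => w0 wA wd [w'0 w'A w'd]; split=> [E|E|T T0 Tk].
- by rewrite /add_link addr_ge0 //; case: ifP.
- rewrite /add_link; have [e|/w'A//] := eqVneq (w' E) 0.
  rewrite e add0r; case: ifP => [/andP[uE _]|]; last by rewrite eqxx.
  by case/wA; rewrite subUset => /andP[_ EA]; rewrite cardsU1 uE => -[].
have -> : wdeg (add_link w w' B tau D' u) T = wdeg w' T +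
    \sum_(F : {set V} | (T \subset F) && (u \notin F) && unsaturated w' B tau D' F)
      w (u |: F).
  rewrite /wdeg /add_link big_split /=; congr (_ + _).
  by rewrite -big_mkcondr /=; apply: eq_bigl => F; rewrite andbA.
have [satT|unsT] := boolP (saturated w' B tau D' T).
  rewrite big1 ?addr0 ?w'd // => F /andP[/andP[TF _] /forallP/(_ T)].
  by rewrite TF satT.
have lo : wdeg w' T <= B * tau ^+ #|T|.-1 * D'.
  by move: unsT; rewrite /saturated T0 /= -ltNge => /ltW.
have -> : 2 * B * tau ^+ #|T|.-1 * D' =
   B * tau ^+ #|T|.-1 * D' + B * tau ^+ #|T|.-1 * D' by ring.
apply: lerD => //.
have [uT|uT] := boolP (u \in T).
  rewrite big1 ?mulr_ge0 ?exprn_ge0 ?(ltW _) // => F /andP[/andP[TF uF] _].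
  by rewrite (subsetP TF _ uT) in uF.
apply: le_trans (sum_link_le _ w0 uT) _.
have := wd (u |: T); rewrite cardsU1 uT /= add1n => h.
apply: le_trans (h _ _) _.
- by apply/set0Pn; exists u; rewrite setU11.
- by [].
rewrite -(prednK (_ : 0 < #|T|)%N) ?card_gt0 // exprS /D' /=.
by rewrite le_eqVlt; apply/orP; left; apply/eqP; ring.
Qed.

Lemma sum_add_link (w' : {set V} -> R) (u : V) :
  \sum_E add_link w w' B tau D' u E = \sum_E w' E + gain w w' B tau D' u.
Proof. by rewrite /add_link big_split /= -big_mkcond. Qed.

Lemma gain_le (w' : {set V} -> R) (u : V) : gain w w' B tau D' u <= B * D.
Proof.
case: wB => w0 wA wd.
have uT : u \notin (set0 : {set V}) by rewrite inE.
have := sum_link_le (unsaturated w' B tau D') w0 uT.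
under eq_bigl do rewrite sub0set andTb.
move/le_trans; apply.
by rewrite setU0; apply: le_trans (wd _ _ _) _; rewrite ?cards1 ?expr0 ?mulr1 //;
  apply/set0Pn; exists u; rewrite set11.
Qed.

(* Few sets are saturated because the total weight of w' is small, so that most of
   the mass of w survives in the gains. *)
Lemma few_low_gain (w' : {set V} -> R) :
  bounded_weight A k.+1 (2 * B) tau D' w' ->
  \sum_E w' E <= gamma * #|A|%:R * D' ->
  beta / (2 * B) * #|A|%:R <=
    #|A :\: [set x in A | gain w w' B tau D' x < gamma * D]|%:R.
Proof.
move=> w'B w'tot; case: (wB) => w0 wA wd; case: w'B => w'0 w'A w'd.
set C := [set x in A | _].
(* A saturated [T] satisfies [tau * wdeg w T <= wdeg w' T], so the lost weight is bounded through
   the sum of all degrees of [w'], whose total is small. *)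
have lost : \sum_(E | ~~ unsaturated w' B tau D' E) w E <= beta * #|A|%:R * D / 4.
  have -> : beta * #|A|%:R * D / 4 =
      tau^-1 * (2 ^+ k.+1 * (gamma * #|A|%:R * D')).
    rewrite /gamma /D' !exprS; field.
    by rewrite lt0r_neq0 ?exprn_gt0 // lt0r_neq0.
  apply: (@le_trans _ _ (\sum_(T | saturated w' B tau D' T && (#|T| <= k.+1)%N) wdeg w T)).
    apply: (@le_trans _ _ (\sum_(T | saturated w' B tau D' T && (#|T| <= k.+1)%N)
       \sum_(E : {set V} | (T \subset E) && ~~ unsaturated w' B tau D' E) w E)).
      rewrite (exchange_big_dep (fun E => ~~ unsaturated w' B tau D' E)) /=; last first.
        by move=> T E _ /andP[].
      apply: ler_sum => E Eun.
      move: (Eun); rewrite negb_forall => /existsP[T]; rewrite negb_imply negbK.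
      case/andP=> TE satT.
      apply: (le_sum_const (i := T)); rewrite ?w0 //.
      rewrite satT TE Eun /= andbT leqNgt; apply/negP => kT.
      case/andP: satT => _; rewrite leNgt => /negP; apply.
      rewrite /wdeg big1 ?mulr_gt0 ?exprn_gt0 // => F TF; apply/eqP.
      apply: contraTT kT => /w'A[_ <-]; rewrite -leqNgt; exact: subset_leq_card.
    apply: ler_sum => T _; rewrite /wdeg [leRHS](bigID (unsaturated w' B tau D')) /=.
    by apply: ler_wpDl => //; apply: sumr_ge0.
  apply: (@le_trans _ _ (tau^-1 * \sum_(T | saturated w' B tau D' T && (#|T| <= k.+1)%N) wdeg w' T)).
    rewrite mulr_sumr; apply: ler_sum => T /andP[/andP[T0 satT] Tk].
    apply: le_trans (wd _ T0 (leqW Tk)) _.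
    by rewrite ler_pdivlMl //; apply: le_trans satT; rewrite /D' mulrCA.
  rewrite ler_pM2l ?invr_gt0 //.
  apply: le_trans (_ : \sum_T wdeg w' T <= _).
    rewrite big_mkcond; apply: ler_sum => T _; case: ifP => // _; exact: wdeg_ge0.
  apply: le_trans (sum_wdeg (k := k.+1) w'0 _) _; first by move=> E /w'A[].
  by rewrite ler_pM2l ?exprn_gt0.
have kept : \sum_(E | unsaturated w' B tau D' E) w E <= \sum_(x in A) gain w w' B tau D' x.
  apply: (@le_trans _ _ (\sum_(x in A) \sum_(E : {set V} | (x \in E) && unsaturated w' B tau D' E) w E)).
    rewrite (exchange_big_dep (fun F => unsaturated w' B tau D' F)) /=; last first.
      by move=> x E _ /andP[].
    apply: ler_sum => E Eun.
    have [->|/wA[EA Ek]] := eqVneq (w E) 0; first by rewrite big1.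
    have [x xE] : exists x, x \in E by apply/set0Pn; rewrite -card_gt0 Ek.
    by apply: (le_sum_const (i := x)); rewrite ?w0 // xE Eun (subsetP EA).
  apply: ler_sum => x _; rewrite /gain.
  have inj : {in [pred E : {set V} | (x \in E) && unsaturated w' B tau D' E] &,
      injective (fun E => E :\ x)}.
    by move=> E E' /andP[xE _] /andP[xE' _] e; rewrite -(setD1K xE) -(setD1K xE') e.
  have -> : \sum_(E : {set V} | (x \in E) && unsaturated w' B tau D' E) w E =
     \sum_(E : {set V} | (x \in E) && unsaturated w' B tau D' E) w (x |: (E :\ x)).
    by apply: eq_bigr => E /andP[xE _]; rewrite setD1K.
  rewrite -(big_imset (fun E => w (x |: E)) inj) /=.
  rewrite [leRHS](bigID (mem [set E :\ x | E in
    [pred E : {set V} | (x \in E) && unsaturated w' B tau D' E]])) /=.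
  apply: ler_wpDr; first by apply: sumr_ge0.
  rewrite le_eqVlt; apply/orP; left; apply/eqP; apply: eq_bigl => F.
  apply/idP/andP => [FI|[]//]; split=> //.
  have /imsetP[E /andP[xE /forallP Eun] ->] := FI; rewrite !inE eqxx /=.
  apply/forallP => T; apply/implyP => TE; move: (Eun T).
  by rewrite (subset_trans TE (subsetDl _ _)).
have upper : \sum_(x in A) gain w w' B tau D' x <=
    #|A :\: C|%:R * (B * D) + #|A|%:R * (gamma * D).
  rewrite (bigID (mem C)) /= addrC; apply: lerD.
    rewrite mulr_natl -sumr_const [leRHS](eq_bigl (fun x => (x \in A) && (x \notin C))).
      by apply: ler_sum => x _; exact: gain_le.
    by move=> x; rewrite [LHS]inE andbC.
  apply: (@le_trans _ _ (\sum_(x in C) gamma * D)).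
    rewrite (eq_bigl (fun x => x \in C)); last by move=> x; rewrite /= inE andbA andbb.
    by apply: ler_sum => x; rewrite inE => /andP[_ /ltW].
  rewrite sumr_const -[leLHS]mulr_natl ler_wpM2r //; first exact: ltW (mulr_gt0 gamma0 D0).
  by rewrite ler_nat; apply/subset_leq_card/subsetP => x; rewrite inE => /andP[].
have g8 : gamma <= beta / 8.
  rewrite /gamma ler_pM2l // lef_pV2 ?posrE ?exprn_gt0 //.
  by rewrite !exprS; have : 1 <= 2 ^+ k :> R by [rewrite exprn_ege1 // ler1n]; lra.
have wsplit : \sum_E w E = \sum_(E | unsaturated w' B tau D' E) w E +
    \sum_(E | ~~ unsaturated w' B tau D' E) w E by rewrite (bigID (unsaturated w' B tau D')).
have A0 : 0 <= #|A|%:R * D :> R by rewrite mulr_ge0 // ltW.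
have gA : gamma * (#|A|%:R * D) <= beta / 8 * (#|A|%:R * D) by rewrite ler_wpM2r.
have fin : beta / 2 * #|A|%:R * D <= #|A :\: C|%:R * B * D.
  have b0 : 0 <= beta * (#|A|%:R * D) by rewrite mulr_ge0 // ltW.
  move: lost kept upper wtot gA; rewrite wsplit; lra.
move: fin; rewrite ler_pM2r // => fin.
have -> : beta / (2 * B) * #|A|%:R = (beta / 2 * #|A|%:R) / B by field; rewrite lt0r_neq0.
by rewrite ler_pdivrMr.
Qed.

(** If [I] has a vertex of high gain, its link is added to [w'] and one unit of fuel is spent.
    Otherwise [I] lies in the set of low-gain vertices, which misses a fixed proportion of [A] by
    [few_low_gain]. Each link adds at least [gamma * D], so after at most [m] links [w'] is heavy
    enough for the induction hypothesis. *)
Lemma container_fuel (fuel : nat) (w' : {set V} -> R) :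
  bounded_weight A k.+1 (2 * B) tau D' w' ->
  m%:R * (gamma * D) <= \sum_E w' E + fuel%:R * (gamma * D) ->
  covering_family A delta (N * (#|A| + 2) ^ fuel) w'
    (fun I => forall E, w E != 0 -> ~~ (E \subset I)).
Proof.
elim: fuel w' => [|fuel IHf] w' w'B w'f.
all: have [big|small] := leP (gamma * #|A|%:R * D') (\sum_E w' E).
1,3: have [CC [CN CA CI]] := IH w'B big; exists CC; split=> [|C CC1|I IA Iw _].
1,4: by rewrite (leq_trans CN) // leq_pmulr // expn_gt0 addn2.
1,3: have [H1 H2] := CA C CC1; split=> //; apply: le_trans H2;
     by rewrite ler_wpM2r // ge_min lexx.
1,2: exact: CI.
(* Without fuel the total of [w'] is at least [m * gamma * D], hence at least [gamma * #|A| * D']: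
   the case of a light [w'] is impossible. *)
- move: w'f; rewrite mul0r addr0 leNgt => /negP[]; apply: lt_le_trans small _.
  have -> : gamma * #|A|%:R * D' = tau * #|A|%:R * (gamma * D) by rewrite /D'; ring.
  by rewrite ler_wpM2r // mulr_ge0 // ltW.
pose high u := gamma * D <= gain w w' B tau D' u.
have ex u : exists CC : {set {set V}}, high u ->
    [/\ (#|CC| <= N * (#|A| + 2) ^ fuel)%N,
        forall C, C \in CC -> C \subset A /\ delta * #|A|%:R <= #|A :\: C|%:R
      & forall I : {set V}, I \subset A ->
          (forall E, add_link w w' B tau D' u E != 0 -> ~~ (E \subset I)) ->
          (forall E, w E != 0 -> ~~ (E \subset I)) -> exists2 C, C \in CC & I \subset C].
  have [hu|] := boolP (high u); last by exists set0.
  have [|CC [H1 H2 H3]] := IHf (add_link w w' B tau D' u) (bounded_add_link u w'B).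
    rewrite sum_add_link; move: w'f hu; rewrite -natr1 /high.
    by rewrite mulrDl mul1r; lra.
  by exists CC.
have [f Hf] := fin_all_exists ex.
pose C0 := [set x in A | gain w w' B tau D' x < gamma * D].
exists (C0 |: \bigcup_(u in A | high u) f u); split=> [|C|I IA Iw' Iw].
- apply: leq_trans (_ : 1 + \sum_(u in A) N * (#|A| + 2) ^ fuel <= _)%N.
    rewrite cardsU1; apply: leq_add; first by case: (_ \notin _).
    apply: leq_trans (_ : \sum_(u in A | high u) #|f u| <= _)%N.
      exact: card_bigcup_le.
    rewrite big_mkcondr /=; apply: leq_sum => u _; case: ifP => // /(Hf u)[].
    by [].
  rewrite sum_nat_const expnS mulnCA.
  rewrite mulnDl mulnDr addnC leq_add2l.
  by rewrite !muln_gt0 N0 expn_gt0 addn2.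
- rewrite !inE => /orP[/eqP->|/bigcupP[u /andP[uA hu] Cu]].
    split; first by apply/subsetP => x; rewrite inE => /andP[].
    apply: le_trans (few_low_gain w'B (ltW small)).
    by rewrite ler_wpM2r // ge_min lexx orbT.
  by have [_ h _] := Hf u hu; exact: h.
have [/existsP[u /andP[uI hu]]|] := boolP [exists u, (u \in I) && high u].
  have [_ _ h] := Hf u hu.
  have [|//|C Cf IC] := h I IA.
    (* A link edge [F] of [u] cannot lie in [I], since [u |: F] would be an edge of [w] inside
       [I]. *)
    move=> E; rewrite /add_link; have [->|/Iw'//] := eqVneq (w' E) 0.
    rewrite add0r; case: ifP; last by rewrite eqxx.
    move=> _ /Iw; apply: contra => EI.
    by rewrite subUset EI sub1set uI.
  exists C => //; rewrite inE; apply/orP; right; apply/bigcupP; exists u => //.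
  by rewrite (subsetP IA).
rewrite negb_exists => /forallP low; exists C0; first by rewrite !inE eqxx.
apply/subsetP => x xI; rewrite inE (subsetP IA) //= ltNge.
by have := low x; rewrite xI.
Qed.

End Step.

(** Induction on the uniformity, where each level multiplies the number of containers by
    [(#|A| + 2) ^ m]. For edges of size one, the vertices of weight zero form the only container. *)
Theorem containers (k : nat) (B beta : R) : 0 < B -> 0 < beta ->
  exists2 delta : R, 0 < delta &
  forall (V : finType) (A : {set V}) (m : nat) (tau D : R) (w : {set V} -> R),
    0 < tau -> 0 < D -> tau * #|A|%:R <= m%:R ->
    bounded_weight A k.+1 B tau D w -> beta * #|A|%:R * D <= \sum_E w E ->
    covering_family A delta ((#|A| + 2) ^ (k * m)) w (fun _ => True).
Proof.
elim: k B beta => [|k IHk] B beta B0 beta0.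
  exists (beta / B); first exact: divr_gt0.
  move=> V A m tau D w tau0 D0 mA [w0 wA wd] wtot.
  pose C := [set x in A | w [set x] == 0].
  exists [set C]; split=> [|C'|I IA Iw _].
  - by rewrite cards1 mul0n expn0.
  - rewrite inE => /eqP->; split; first by apply/subsetP => x; rewrite inE => /andP[].
    rewrite mulrAC ler_pdivrMr // -(ler_pM2r D0).
    apply: le_trans wtot _.
    apply: (@le_trans _ _ (\sum_(x in A :\: C) w [set x])).
      rewrite -(big_imset w (h := fun x => [set x])) /=; last first.
        by move=> x y _ _ /set1_inj.
      rewrite [leLHS](bigID (mem [set [set x] | x in A :\: C])) /=.
      rewrite [X in _ + X]big1 ?addr0 // => E EN; apply/eqP; apply: contraNT EN => wE.
      have [EA /eqP/cards1P[x Ex]] := wA _ wE; apply/imsetP; exists x => //.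
      rewrite Ex sub1set in EA; rewrite !inE EA /=.
      by rewrite -Ex wE.
    rewrite -mulrA mulr_natl -sumr_const; apply: ler_sum => x _.
    apply: le_trans (_ : wdeg w [set x] <= _).
      by rewrite /wdeg (bigD1 [set x]) //= lerDl sumr_ge0.
    apply: le_trans (wd _ _ _) _; rewrite ?cards1 ?expr0 ?mulr1 //.
    by apply/set0Pn; exists x; rewrite set11.
  exists C; first by rewrite set11.
  apply/subsetP => x xI; rewrite inE (subsetP IA) //=.
  by apply: contraT => /Iw; rewrite sub1set xI.
have g0 : 0 < beta / 2 ^+ k.+3 by rewrite divr_gt0 // exprn_gt0.
have [delta' d'0 IH] := IHk (2 * B) _ (mulr_gt0 (ltr0n R 2) B0) g0.
exists (Num.min delta' (beta / (2 * B))).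
  by rewrite lt_min d'0 divr_gt0 // mulr_gt0.
move=> V A m tau D w tau0 D0 mA wB wtot.
have N0 : (0 < (#|A| + 2) ^ (k * m))%N by rewrite expn_gt0 addn2.
have tD : 0 < tau * D by exact: mulr_gt0.
have IH' := fun w' => IH V A m tau (tau * D) w' tau0 tD mA.
have [||CC [H1 H2 H3]] := container_fuel B0 beta0 tau0 D0 mA wB wtot N0 IH' (fuel := m) (w' := fun _ => 0).
- split=> // [E|T _ _]; first by rewrite eqxx.
  by rewrite /wdeg big1 // !mulr_ge0 ?exprn_ge0 // ltW.
- by rewrite big1 // add0r.
exists CC; split=> //.
  by rewrite mulSn [(m + _)%N]addnC expnD.
move=> I IA Iw _; apply: H3 => // E; by rewrite eqxx.
Qed.

End Containers.

(* lia slows down considerably in contexts with many hypotheses on real numbers. *)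
Ltac nat_lia :=
  repeat match goal with
  | H : ?P |- _ =>
      match type of P with Prop =>
        lazymatch P with
        | is_true (leq _ _) => fail
        | is_true (andb (leq _ _) (leq _ _)) => fail
        | is_true (negb (leq _ _)) => fail
        | @eq nat _ _ => fail
        | _ => clear H
        end
      end
  end; lia.

(** * Log-convex sequences *)

Section LogConvexity.
Variable R : realFieldType.

Lemma cauchy_schwarz_sum (I : finType) (a b : I -> R) :
  (\sum_i a i * b i) ^+ 2 <= (\sum_i a i ^+ 2) * (\sum_i b i ^+ 2).
Proof.
have : 0 <= \sum_i \sum_j (a i * b j - a j * b i) ^+ 2.
  by apply: sumr_ge0 => i _; apply: sumr_ge0 => j _; exact: sqr_ge0.
have -> : \sum_i \sum_j (a i * b j - a j * b i) ^+ 2 =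
    \sum_i \sum_j (a i ^+ 2 * b j ^+ 2) + \sum_i \sum_j (b i ^+ 2 * a j ^+ 2)
    - 2 * \sum_i \sum_j ((a i * b i) * (a j * b j)).
  rewrite mulr_sumr -big_split -sumrB /=; apply: eq_bigr => i _.
  rewrite mulr_sumr -big_split -sumrB /=; apply: eq_bigr => j _; ring.
have sumM (f g : I -> R) : \sum_i \sum_j (f i * g j) = (\sum_i f i) * (\sum_j g j).
  by rewrite mulr_suml; apply: eq_bigr => i _; rewrite mulr_sumr.
by rewrite !sumM expr2; lra.
Qed.

(** From the first term above 1 on, log-convexity would make the sequence increase strictly up to
    index [k], contradicting [a k <= 1]. Arguing with products instead of logarithms allows terms to
    vanish. *)
Lemma logconvex_le1 (a : nat -> R) (k : nat) :
  (forall i, (i <= k)%N -> 0 <= a i) ->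
  (forall i, (i.+2 <= k)%N -> a i.+1 ^+ 2 <= a i * a i.+2) ->
  a 0 <= 1 -> a k <= 1 -> forall i, (i <= k)%N -> a i <= 1.
Proof.
move=> a0 conv a01 ak1; elim=> // i IHi ik.
rewrite leNgt; apply/negP => gt1.
have grow d : (i + d.+1 <= k)%N -> a (i + d)%N < a (i + d.+1)%N.
  elim: d => [|d IHd] dk; first by rewrite addn0 addn1 (le_lt_trans (IHi (ltnW ik))).
  have lt1 : a (i + d)%N < a (i + d.+1)%N by apply: IHd; nat_lia.
  rewrite ltNge; apply/negP => le2.
  have := conv (i + d)%N; rewrite -!addnS => /(_ dk).
  have p : 0 < a (i + d.+1)%N by apply: le_lt_trans lt1; apply: a0; nat_lia.
  have q : 0 <= a (i + d)%N by apply: a0; nat_lia.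
  move=> h; suff : a (i + d.+1)%N ^+ 2 < a (i + d.+1)%N ^+ 2 by rewrite ltxx.
  apply: le_lt_trans h _; apply: (@le_lt_trans _ _ (a (i + d)%N * a (i + d.+1)%N)).
    by rewrite ler_wpM2l.
  by rewrite expr2 ltr_pM2r.
have large d : (i + d.+1 <= k)%N -> 1 < a (i + d.+1)%N.
  elim: d => [|d IHd] dk; first by rewrite addn1.
  by apply: lt_trans (IHd _) (grow d.+1 dk); nat_lia.
have := large (k - i.+1)%N; have -> : (i + (k - i.+1).+1 = k)%N by nat_lia.
by move=> /(_ (leqnn k)); rewrite ltNge ak1.
Qed.

Lemma logconvex_interp (c : nat -> R) (l : nat) (theta r : R) :
  0 < theta -> 0 < r -> (0 < l)%N ->
  (forall i, 0 <= c i) ->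
  (forall i, c i.+1 ^+ 2 <= c i * c i.+2) ->
  c 1%N <= theta * r ^+ l.-1 -> c l <= theta ->
  forall i, (0 < i <= l)%N -> c i <= theta * r ^+ (l - i).
Proof.
move=> th0 r0 l0 c0 conv c1 cl i /andP[i0 il].
pose a j := c j.+1 / (theta * r ^+ (l - j.+1)).
have den j : 0 < theta * r ^+ j by rewrite mulr_gt0 ?exprn_gt0.
have : a i.-1 <= 1.
  apply: (@logconvex_le1 a l.-1); last by nat_lia.
  - by move=> j _; rewrite divr_ge0 // ltW.
  - move=> j jl; rewrite /a.
    have e : (theta * r ^+ (l - j.+2)) ^+ 2 =
        (theta * r ^+ (l - j.+1)) * (theta * r ^+ (l - j.+3)).
      have -> : (l - j.+1 = (l - j.+3).+2)%N by nat_lia.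
      have -> : (l - j.+2 = (l - j.+3).+1)%N by nat_lia.
      by rewrite !exprS expr0; ring.
    by rewrite expr_div_n e mulf_div ler_pM2r ?conv // invr_gt0 mulr_gt0 ?den.
  - by rewrite /a ler_pdivrMr // mul1r subn1.
  - by rewrite /a ler_pdivrMr // mul1r (prednK l0) subnn expr0 mulr1.
by rewrite /a prednK // ler_pdivrMr // mul1r.
Qed.

(** The ratios of consecutive terms never decrease, so all of them are at least the first one;
    multiplied out, this also covers zero terms. *)
Lemma logconvex_power (c : nat -> R) :
  (forall i, 0 <= c i) -> (forall i, c i.+1 ^+ 2 <= c i * c i.+2) ->
  forall i, c 1%N ^+ i.+1 <= c i.+1 * c 0%N ^+ i.
Proof.
move=> c0 conv.
have ratio i : c 1%N * c i <= c 0%N * c i.+1.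
  elim: i => [|i IHi]; first by rewrite mulrC.
  have [ci|ci] := eqVneq (c i) 0.
    have : c i.+1 ^+ 2 <= 0 by rewrite -(mul0r (c i.+2)) -ci.
    rewrite exprn_even_le0 //= => /eqP->.
    by rewrite mulr0 mulr_ge0.
  have cip : 0 < c i by rewrite lt0r ci c0.
  rewrite -(ler_pM2r cip).
  apply: (@le_trans _ _ (c 0%N * c i.+1 * c i.+1)).
    by rewrite mulrAC ler_wpM2r.
  rewrite -!mulrA ler_wpM2l // -expr2; apply: le_trans (conv i) _.
  by rewrite mulrC.
elim=> [|i IHi]; first by rewrite expr1 expr0 mulr1.
rewrite exprS; apply: (@le_trans _ _ (c 1%N * (c i.+1 * c 0%N ^+ i))).
  by rewrite ler_wpM2l.
rewrite mulrA [c 0%N ^+ i.+1]exprS mulrA ler_wpM2r ?exprn_ge0 //.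
by apply: le_trans (ratio i.+1) _; rewrite mulrC.
Qed.

End LogConvexity.

Lemma balanced_split (s : nat) :
  exists p q, [/\ (p + q = s.+2)%N, (p <= q <= p.+1)%N & (0 < p)%N].
Proof.
elim: s => [|s [p [q [e /andP[pq qp] p0]]]]; first by exists 1%N, 1%N.
have [pq'|qp'] := ltnP p q.
  by exists p.+1, q; split; nat_lia.
by exists p, q.+1; split; nat_lia.
Qed.

(** * Alternating products of a matrix and its transpose *)

Section Alternating.
Variables (R : realFieldType) (n : nat) (W : 'M[R]_n).

Definition alt_mx (b : bool) : 'M[R]_n := if b then W^T else W.

(** The entries are the total weights of the walks with [s] steps in the bipartite graph weighted by
    [W]; [b] tells on which side they start, [false] standing for the rows. *)
Fixpoint alt_prod (b : bool) (s : nat) : 'M[R]_n :=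
  if s is s'.+1 then alt_mx b *m alt_prod (~~ b) s' else 1%:M.

Lemma alt_prod1 b : alt_prod b 1 = alt_mx b.
Proof. by rewrite /= mulmx1. Qed.

Lemma alt_prodD b s t : alt_prod b (s + t) = alt_prod b s *m alt_prod (odd s (+) b) t.
Proof.
elim: s b => [|s IHs] b; first by rewrite mul1mx.
by rewrite addSn /= IHs mulmxA; congr (_ *m alt_prod _ _); case: (odd s); case: b.
Qed.

Lemma alt_prod_tr b s : (alt_prod b s)^T = alt_prod (odd s (+) b) s.
Proof.
elim: s b => [|s IHs] b; first by rewrite trmx1.
have -> : odd s.+1 (+) b = odd s (+) ~~ b by rewrite /=; case: (odd s); case: b.
rewrite [alt_prod b _]/= trmx_mul IHs -[in RHS]addn1 alt_prodD alt_prod1 addbA addbb addFb; congr (_ *m _).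
by case: b => //=; rewrite trmxK.
Qed.

Definition alt_form (b : bool) (s : nat) (u v : 'rV[R]_n) : R :=
  (u *m alt_prod b s *m v^T) 0 0.

Lemma alt_form_delta b s x y :
  alt_form b s (delta_mx 0 x) (delta_mx 0 y) = alt_prod b s x y.
Proof. by rewrite /alt_form -rowE trmx_delta -colE !mxE. Qed.

(** Cauchy-Schwarz at the node reached after [s] steps; the second half of the walk, read backwards,
    starts at the other end. *)
Lemma alt_form_cs b s t (u v : 'rV[R]_n) :
  alt_form b (s + t) u v ^+ 2 <=
    alt_form b (s + s) u u * alt_form (odd (s + t) (+) b) (t + t) v v.
Proof.
have sq (y : 'rV[R]_n) : (y *m y^T) 0 0 = \sum_i y 0 i ^+ 2.
  by rewrite mxE; apply: eq_bigr => i _; rewrite mxE expr2.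
pose y := u *m alt_prod b s; pose z := v *m (alt_prod (odd s (+) b) t)^T.
have -> : alt_form b (s + t) u v = \sum_i y 0 i * z 0 i.
  rewrite /alt_form alt_prodD mulmxA -mulmxA -[X in y *m X]trmxK trmx_mul trmxK -/z.
  by rewrite mxE; apply: eq_bigr => i _; rewrite [z^T _ _]mxE.
have -> : alt_form b (s + s) u u = (y *m y^T) 0 0.
  by rewrite /alt_form alt_prodD -alt_prod_tr mulmxA -mulmxA -trmx_mul.
have -> : alt_form (odd (s + t) (+) b) (t + t) v v = (z *m z^T) 0 0.
  rewrite /alt_form /z trmx_mul trmxK alt_prod_tr !mulmxA -[in RHS](mulmxA v).
  rewrite alt_prodD oddD; congr ((_ *m (alt_prod _ _ *m alt_prod _ _) *m _) _ _).
  - by rewrite -addbA addbCA.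
  - by rewrite (addbC (odd s) (odd t)) -addbA addbA addbb.
by rewrite !sq; exact: cauchy_schwarz_sum.
Qed.

Lemma alt_form_ge0 b s u : 0 <= alt_form b (s + s) u u.
Proof.
rewrite /alt_form alt_prodD -alt_prod_tr mulmxA -mulmxA -trmx_mul mxE.
by apply: sumr_ge0 => i _; rewrite [_^T _ _]mxE -expr2 sqr_ge0.
Qed.

Lemma alt_form_logconvex b i u :
  alt_form b (i.+1 + i.+1) u u ^+ 2 <=
    alt_form b (i + i) u u * alt_form b (i.+2 + i.+2) u u.
Proof.
have := alt_form_cs b i i.+2 u u.
by rewrite addnS -addSn oddD addbb addFb.
Qed.

Lemma alt_prod_cs b s t x y :
  alt_prod b (s + t) x y ^+ 2 <=
    alt_prod b (s + s) x x * alt_prod (odd (s + t) (+) b) (t + t) y y.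
Proof. by rewrite -!alt_form_delta; exact: alt_form_cs. Qed.

Lemma alt_prod_diag_ge0 b s x : 0 <= alt_prod b (s + s) x x.
Proof. by rewrite -alt_form_delta alt_form_ge0. Qed.

Hypothesis W0 : forall x y, 0 <= W x y.

Lemma alt_mx_ge0 b x y : 0 <= alt_mx b x y.
Proof. by case: b; rewrite ?mxE. Qed.

Lemma alt_prod_ge0 b s x y : 0 <= alt_prod b s x y.
Proof.
elim: s b x => [|s IHs] b x /=; first by rewrite mxE ler0n.
by rewrite mxE; apply: sumr_ge0 => i _; rewrite mulr_ge0 ?alt_mx_ge0.
Qed.

(** For [v] the indicator of [SA], the even moments of [v] are log-convex, so the moment with [2l]
    steps is at least a power of the one with 2 steps, which Cauchy-Schwarz bounds below by the
    total weight. Conversely, an entry of the positive semidefinite matrix is at most the mean of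
    two diagonal entries, so the moment with [2l] steps is at most [#|SA|] times the trace. *)
Lemma alt_trace_ge (SA SB : {set 'I_n}) (l : nat) :
  (forall x y, W x y != 0 -> x \in SA /\ y \in SB) -> (0 < l)%N ->
  (\sum_x \sum_y W x y) ^+ (l + l) <=
    \tr (alt_prod false (l + l)) * (#|SA|%:R * #|SB|%:R) ^+ l.
Proof.
move=> supp; case: l => // l _.
pose v : 'rV[R]_n := \row_x (x \in SA)%:R.
pose c i := alt_form false (i + i) v v.
have c0 i : 0 <= c i by exact: alt_form_ge0.
have cc i : c i.+1 ^+ 2 <= c i * c i.+2 by exact: alt_form_logconvex.
have sumSA (f : 'I_n -> R) : \sum_x v 0 x * f x = \sum_(x in SA) f x.
  rewrite [RHS]big_mkcond; apply: eq_bigr => x _; rewrite mxE.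
  by case: (x \in SA); rewrite ?mul1r ?mul0r.
have formE s : alt_form false s v v = \sum_(x in SA) \sum_(y in SA) alt_prod false s x y.
  rewrite /alt_form mxE; under eq_bigr do rewrite !mxE mulr_suml.
  rewrite exchange_big /= -sumSA; apply: eq_bigr => x _; rewrite -sumSA mulr_sumr.
  by apply: eq_bigr => y _; rewrite -mulrA; congr (_ * _); rewrite mulrC mxE.
have C0 : c 0%N = #|SA|%:R.
  rewrite /c formE /=; rewrite -sumr_const; apply: eq_bigr => x xS.
  rewrite (bigD1 x) //= mxE eqxx big1 ?addr0 // => y /andP[_ yx].
  by rewrite mxE eq_sym (negbTE yx).
have C1 : (\sum_x \sum_y W x y) ^+ 2 <= c 1%N * #|SB|%:R.
  pose q y := \sum_x W x y.
  have -> : c 1%N = \sum_y q y ^+ 2.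
    rewrite /c /alt_form /= mulmx1 mulmxA -mulmxA -trmx_mul mxE.
    apply: eq_bigr => y _; rewrite [_^T _ _]mxE -expr2 mxE; congr (_ ^+ 2).
    apply: eq_bigr => x _; rewrite mxE.
    have [xS|xS] := boolP (x \in SA); first by rewrite mul1r.
    by rewrite mul0r; apply/esym/eqP; apply: contraNT xS => /supp[].
  have -> : \sum_x \sum_y W x y = \sum_y q y * (y \in SB)%:R.
    rewrite exchange_big; apply: eq_bigr => y _; rewrite /q.
    have [yS|yS] := boolP (y \in SB); first by rewrite mulr1.
    rewrite mulr0 big1 // => x _; apply/eqP; apply: contraNT yS => /supp[].
    by [].
  apply: le_trans (cauchy_schwarz_sum _ _) _.
  rewrite ler_wpM2l //; first by apply: sumr_ge0 => y _; exact: sqr_ge0.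
  rewrite -sumr_const [leRHS]big_mkcond; apply: ler_sum => y _.
  by case: (y \in SB); rewrite ?expr1n ?expr0n.
have Cl : c l.+1 <= #|SA|%:R * \tr (alt_prod false (l.+1 + l.+1)).
  rewrite /c formE; set P := alt_prod _ _.
  have d0 x : 0 <= P x x by exact: alt_prod_diag_ge0.
  have am x y : P x y <= (P x x + P y y) / 2.
    have := alt_prod_cs false l.+1 l.+1 x y.
    rewrite oddD addbb addFb -/P => h.
    rewrite ler_pdivlMr // -(@ler_pXn2r _ 2) ?nnegrE ?addr_ge0 //; last first.
      by rewrite mulr_ge0 // alt_prod_ge0.
    have := sqr_ge0 (P x x - P y y); rewrite !expr2 in h *; nra.
  apply: (@le_trans _ _ (\sum_(x in SA) \sum_(y in SA) (P x x + P y y) / 2)).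
    by apply: ler_sum => x _; apply: ler_sum => y _; exact: am.
  have -> : \sum_(x in SA) \sum_(y in SA) (P x x + P y y) / 2 =
      #|SA|%:R * \sum_(x in SA) P x x.
    have -> : \sum_(x in SA) \sum_(y in SA) (P x x + P y y) / 2 =
       (\sum_(x in SA) \sum_(y in SA) P x x + \sum_(x in SA) \sum_(y in SA) P y y) / 2.
      rewrite -big_split mulr_suml; apply: eq_bigr => x _ /=.
      by rewrite -big_split mulr_suml.
    rewrite [X in _ + X]sumr_const.
    under eq_bigr do rewrite sumr_const.
    rewrite sumrMnl; set S := \sum_(x in SA) P x x.
    by have -> : S *+ #|SA| = #|SA|%:R * S by [rewrite mulr_natl]; field.
  rewrite ler_wpM2l // /mxtrace [leRHS](bigID (mem SA)) /= lerDl.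
  by apply: sumr_ge0 => x _.
have key := logconvex_power c0 cc l.
rewrite addnn -mul2n exprM.
apply: (@le_trans _ _ ((c 1%N * #|SB|%:R) ^+ l.+1)).
  by rewrite lerXn2r ?nnegrE ?sqr_ge0 // mulr_ge0.
rewrite !exprMn mulrA mul2n -addnn ler_wpM2r ?exprn_ge0 //.
apply: le_trans key _; rewrite C0 exprS mulrA ler_wpM2r ?exprn_ge0 //.
by apply: le_trans Cl _; rewrite mulrC.
Qed.

Variables (kappa varpi : R).
Hypotheses (kappa1 : 1 <= kappa) (varpi0 : 0 <= varpi).
Hypothesis row_le : forall x, \sum_y W x y <= kappa.
Hypothesis col_le : forall y, \sum_x W x y <= kappa^-1.
Hypothesis entry_le : forall x y, W x y <= varpi / kappa.

Let kappa0 : 0 < kappa. Proof. exact: lt_le_trans kappa1. Qed.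

(** Weights of the two sides for which each step of a walk is contracting ([alt_mx_row]), although
    the row sums of [W] may exceed 1. *)
Definition side_wt (b : bool) : R := if b then kappa^-1 else 1.

Lemma side_wt_le1 b : side_wt b <= 1.
Proof. by case: b; rewrite /side_wt ?invf_le1. Qed.

Lemma alt_mx_entry b x y : alt_mx b x y <= varpi * side_wt b.
Proof.
case: b; rewrite /= ?mxE ?mulr1; first exact: entry_le.
apply: le_trans (entry_le _ _) _; rewrite ler_pdivrMr // ler_peMr //.
Qed.

Lemma alt_mx_row b x : (\sum_y alt_mx b x y) * side_wt (~~ b) <= side_wt b.
Proof.
case: b => /=; rewrite /side_wt /=.
  by rewrite mulr1; under eq_bigr do rewrite mxE; exact: col_le.
by rewrite ler_pdivrMr // mul1r.
Qed.

(** The last step costs at most the largest entry, and all steps before it are contracting with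
    respect to [side_wt]. *)
Lemma alt_prod_le b s x y : alt_prod b s.+1 x y <= varpi * side_wt b.
Proof.
elim: s b x => [|s IHs] b x; first by rewrite alt_prod1 alt_mx_entry.
rewrite [alt_prod _ _]/= mxE.
apply: (@le_trans _ _ (\sum_j alt_mx b x j * (varpi * side_wt (~~ b)))).
  by apply: ler_sum => j _; rewrite ler_wpM2l ?alt_mx_ge0 //; exact: IHs.
by rewrite -mulr_suml mulrCA ler_wpM2l // alt_mx_row.
Qed.

(* Bounds walks with s steps by interpolating between walks with 2 and with 2l
   steps, via log-convexity of the even moments at the two end points. *)
Lemma alt_prod_interp (l s : nat) (b : bool) (x y : 'I_n) (theta r : R) :
  (1 < l)%N -> (s.+1 < l + l)%N -> 0 < theta -> 1 <= r ->
  varpi <= theta * r ^+ l.-1 -> 1 <= theta * r ^+ (l + l).-1 ->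
  alt_prod b (l + l) x x <= theta ->
  alt_prod (odd s (+) b) (l + l) y y <= theta ->
  alt_prod b s x y <= theta * r ^+ (l + l - s).-1.
Proof.
move=> l1 sl th0 r1 vr full xx yy; have r0 := lt_le_trans ltr01 r1.
(* Walks with zero or one step cannot be split into two nonempty halves and are bounded directly. *)
case: s sl yy => [|[|s]] sl yy.
- rewrite /= mxE subn0; apply: le_trans full; exact: ler_b1 || (by case: (x == y)).
- apply: le_trans (alt_prod_le _ _ _ _) _.
  apply: (@le_trans _ _ varpi); first by rewrite ler_piMr // side_wt_le1.
  apply: le_trans vr _; rewrite ler_wpM2l ?(ltW th0) // ler_weXn2l //.
  by move: l1; clear; nat_lia.
have inter (b' : bool) (z : 'I_n) : alt_prod b' (l + l) z z <= theta ->
    forall i, (0 < i <= l)%N -> alt_prod b' (i + i) z z <= theta * r ^+ (l - i).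
  move=> zz; apply: (@logconvex_interp _ (fun i => alt_prod b' (i + i) z z)) => //.
  - exact: ltnW.
  - by move=> i; exact: alt_prod_diag_ge0.
  - by move=> i; rewrite -!alt_form_delta; exact: alt_form_logconvex.
  apply: le_trans vr; apply: le_trans (alt_prod_le _ _ _ _) _.
  by rewrite ler_piMr // side_wt_le1.
have [p [q [epq pq p0]]] := balanced_split s.
have [pl ql] : (0 < p <= l)%N /\ (0 < q <= l)%N.
  by move: epq pq p0 sl; clear; nat_lia.
have := alt_prod_cs b p q x y; rewrite epq => cs.
have hp : alt_prod b (p + p) x x <= theta * r ^+ (l - p).
  exact: inter.
have hq : alt_prod (odd s.+2 (+) b) (q + q) y y <= theta * r ^+ (l - q).
  exact: inter.
have nn : 0 <= theta * r ^+ (l + l - s.+2).-1 by rewrite mulr_ge0 ?exprn_ge0 // ltW.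
rewrite -(@ler_pXn2r _ 2) ?nnegrE ?alt_prod_ge0 //.
apply: le_trans cs _.
apply: (@le_trans _ _ ((theta * r ^+ (l - p)) * (theta * r ^+ (l - q)))).
  by apply: ler_pM => //; exact: alt_prod_diag_ge0.
(* The exponent [(l - p) + (l - q)] is [2l] minus the number of steps. It is at most twice itself
   minus 2 because a walk here has at most [2l - 2] steps. *)
rewrite mulrACA -exprD exprMn -expr2 ler_wpM2l ?sqr_ge0 // -exprM ler_weXn2l //.
by move: epq pq sl; clear; nat_lia.
Qed.

End Alternating.

(** * Products of matrix units and cyclic invariance of the trace *)

Section DeltaProducts.
Variables (R : comNzRingType) (n' : nat).
Local Notation n := n'.+1.

Lemma prod_delta_mx (u v : nat -> 'I_n) (m : nat) :
  \prod_(i < m.+1) (delta_mx (u i) (v i) : 'M[R]_n) =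
  delta_mx (u 0%N) (v m) *+ [forall i : 'I_m, v i == u i.+1].
Proof.
elim: m => [|m IHm].
  rewrite big_ord1 (_ : [forall i, _]) ?mulr1n //; by apply/forallP => -[].
rewrite big_ord_recr /= IHm.
rewrite mulrnAl -[_ * _]/(_ *m _) mul_delta_mx_cond -mulrnA mulnb.
congr (_ *+ (nat_of_bool _)); apply/andP/forallP => [[h2 /forallP h1] i|h].
  case: (ltnP i m) => im; first exact: (h1 (Ordinal im)).
  by have -> : nat_of_ord i = m by apply/eqP; rewrite eqn_leq im andbT -ltnS.
split; first exact: (h ord_max).
by apply/forallP => i; exact: (h (widen_ord (leqnSn m) i)).
Qed.

Lemma mxtrace_delta (i j : 'I_n) : \tr (delta_mx i j : 'M[R]_n) = (i == j)%:R.
Proof.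
rewrite /mxtrace (bigD1 i) //= mxE eqxx /= big1 ?addr0 // => k /negbTE ki.
by rewrite mxE ki.
Qed.

Lemma mxtrace_rotate (M : nat -> 'M[R]_n) (L t : nat) :
  (forall i, M (i + L)%N = M i) ->
  \tr (\prod_(0 <= i < L) M i) = \tr (\prod_(t <= i < t + L) M i).
Proof.
move=> per; elim: t => [|t ->]; first by rewrite add0n.
have [->|L0] := posnP L; first by rewrite !addn0 !big_geq.
have tL : (t < t + L)%N by nat_lia.
rewrite (big_ltn tL) /= addSn big_nat_recr //= per.
by rewrite -[_ * _]/(_ *m _) mxtrace_mulC.
Qed.

Lemma mul_delta_mxE (i j : 'I_n) (M : 'M[R]_n) (x y : 'I_n) :
  (delta_mx i j * M) x y = (x == i)%:R * M j y.
Proof.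
rewrite -[_ * _]/(_ *m _) mxE (bigD1 j) //= mxE eqxx andbT big1 ?addr0 // => k kj.
by rewrite mxE (negbTE kj) andbF mul0r.
Qed.

End DeltaProducts.

Lemma sum_rotate (c : nat -> nat) (L t : nat) :
  (forall i, c (i + L)%N = c i) ->
  (\sum_(0 <= i < L) c i = \sum_(t <= i < t + L) c i)%N.
Proof.
move=> per; elim: t => [|t ->]; first by rewrite add0n.
have [->|L0] := posnP L; first by rewrite !addn0 !big_geq.
have tL : (t < t + L)%N by nat_lia.
by rewrite (big_ltn tL) /= addSn big_nat_recr //= per addnC.
Qed.

(** * Closed walks counted as traces *)

Section ClosedWalks.
Variables (R : realFieldType) (n' m : nat) (X : finType) (E : {set X}).
Local Notation n := n'.+1.
Local Notation L := m.+1.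
Variables na nb : X -> 'I_n.
Variable alpha : R.
Hypothesis m_odd : odd m.

(** The edge at position [i] leads from [walk_node i] to [walk_node i.+1], so parity decides its
    direction; since the length [L] is even, this makes sense for cyclic positions. *)
Definition walk_node (i : nat) (g : X) : 'I_n := if odd i then nb g else na g.

Lemma node_add (i : nat) (g : X) : walk_node (i + L) g = walk_node i g.
Proof. by rewrite /walk_node oddD /= m_odd addbF. Qed.

Definition consistent (f : {ffun 'I_L -> X}) :=
  [forall i : 'I_L, walk_node i.+1 (f i) == walk_node i.+1 (f (ordS i))].

Definition closed_walk (f : {ffun 'I_L -> X}) :=
  [forall i, f i \in E] && consistent f.

Definition weight_mx : 'M[R]_n :=
  \matrix_(x, y) (alpha * #|[set g in E | (na g == x) && (nb g == y)]|%:R).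

Local Notation alt := (alt_mx weight_mx).
Local Notation altp := (alt_prod weight_mx).

Definition letter (i : nat) (Q : {set X}) : 'M[R]_n :=
  \sum_(g in Q) alpha *: delta_mx (walk_node i g) (walk_node i.+1 g).

Lemma letterE (i : nat) : letter i E = alt (odd i).
Proof.
apply/matrixP => x y; rewrite summxE.
transitivity (alpha * #|[set g in E | (walk_node i g == x) && (walk_node i.+1 g == y)]|%:R).
  rewrite -sumr_const mulr_sumr big_mkcond [RHS]big_mkcond; apply: eq_bigr => g _.
  rewrite !mxE inE; case: (g \in E) => //=.
  by rewrite [_ == x]eq_sym [_ == y]eq_sym; case: (_ && _); rewrite ?mulr1 ?mulr0.
rewrite /walk_node /=; case: (odd i) => //=; rewrite ?mxE //; congr (_ * _%:R).
by apply: eq_card => g; rewrite !inE; congr (_ && _); rewrite andbC.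
Qed.

Lemma letter1 (i : nat) (g : X) :
  letter i [set g] = alpha *: delta_mx (walk_node i g) (walk_node i.+1 g).
Proof. by rewrite /letter big_set1. Qed.

Lemma consistent_trace (f : {ffun 'I_L -> X}) :
  \tr (\prod_(i < L) (delta_mx (walk_node i (f i)) (walk_node i.+1 (f i)) : 'M[R]_n)) =
  (consistent f)%:R.
Proof.
pose u i := walk_node i (f (inord i)); pose v i := walk_node i.+1 (f (inord i)).
rewrite (eq_bigr (fun i : 'I_L => delta_mx (u i) (v i))); last first.
  by move=> i _; rewrite /u /v inord_val.
rewrite prod_delta_mx.
have nodeL g : walk_node L g = walk_node 0 g by rewrite -(node_add 0).
have em : inord m = ord_max :> 'I_L by apply: val_inj; rewrite /= inordK.
have wrap : (u 0%N == v m) = (walk_node (ord_max : 'I_L).+1 (f ord_max) ==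
    walk_node (ord_max : 'I_L).+1 (f (ordS ord_max))).
  have -> : ordS ord_max = inord 0 :> 'I_L by apply: val_inj; rewrite /= modnn inordK.
  by rewrite /u /v em eq_sym -[walk_node 0 _]nodeL.
have step (i : 'I_L) (im : (i < m)%N) : (v i == u i.+1) =
    (walk_node i.+1 (f i) == walk_node i.+1 (f (ordS i))).
  rewrite /u /v inord_val; congr (_ == walk_node _ (f _)); apply: val_inj => /=.
  by rewrite inordK ?modn_small.
have -> : consistent f = [forall i : 'I_m, v i == u i.+1] && (u 0%N == v m).
  apply/forallP/andP => [h|[/forallP h1 h2] i].
    split; last by rewrite wrap; exact: h.
    by apply/forallP => i; have := h (widen_ord (leqnSn m) i); rewrite -(step (widen_ord (leqnSn m) i) (ltn_ord i)).
  have [im|im] := ltnP i m; first by rewrite -step //; exact: h1 (Ordinal im).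
  have -> : i = ord_max :> 'I_L by apply: val_inj; apply/eqP; rewrite eqn_leq /= im andbT -ltnS ltn_ord.
  by rewrite -wrap.
case: [forall i, _] => /=; first by rewrite mulr1n mxtrace_delta.
by rewrite mulr0n raddf0.
Qed.

Lemma trace_letters (Q : 'I_L -> {set X}) :
  \tr (\prod_(i < L) letter i (Q i)) =
  alpha ^+ L * #|[set f : {ffun 'I_L -> X} | [forall i, f i \in Q i] && consistent f]|%:R.
Proof.
rewrite /letter (bigA_distr_big_dep (fun i g => g \in Q i)) /= raddf_sum /=.
rewrite -sumr_const mulr_sumr big_mkcond [RHS]big_mkcond; apply: eq_bigr => f _.
rewrite inE; have -> : (f \in family (fun i => [pred g | g \in Q i])) = [forall i, f i \in Q i].
  by apply/familyP/forallP => h i; have := h i.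
case: [forall i, _] => //=.
have -> : \prod_(i < L) (alpha *: delta_mx (walk_node i (f i)) (walk_node i.+1 (f i)) : 'M[R]_n) =
    alpha ^+ L *: \prod_(i < L) (delta_mx (walk_node i (f i)) (walk_node i.+1 (f i)) : 'M[R]_n).
  by rewrite scaler_prod prodr_const card_ord.
rewrite mxtraceZ consistent_trace.
by case: (consistent f); rewrite ?mulr1 ?mulr0.
Qed.

Lemma alt_prod_nat i s : \prod_(i <= k < i + s) alt (odd k) = altp (odd i) s.
Proof.
elim: s i => [|s IHs] i; first by rewrite addn0 big_geq.
rewrite big_ltn; last by rewrite addnS ltnS leq_addr.
by rewrite addnS -addSn IHs.
Qed.

Definition closed_walks := [set f | closed_walk f].

Lemma card_closed_walks : alpha ^+ L * #|closed_walks|%:R = \tr (altp false L).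
Proof.
rewrite /closed_walks /closed_walk -(trace_letters (fun=> E)).
rewrite -(alt_prod_nat 0 L) add0n big_mkord; congr (\tr _).
by apply: eq_bigr => i _; rewrite letterE.
Qed.

Section Pattern.
Variables (J : {set 'I_L}) (g : 'I_L -> X).

(** The positions in [J] have prescribed edges [g]. Both are extended periodically to [nat], so that
    the product over one period may start anywhere. *)
Definition pat (k : nat) : bool := inord (k %% L) \in J.
Definition val_at (k : nat) : X := g (inord (k %% L)).
Definition pat_mx (k : nat) : 'M[R]_n :=
  if pat k then alpha *: delta_mx (walk_node k (val_at k)) (walk_node k.+1 (val_at k))
  else alt (odd k).

Definition fixed_walks :=
  [set f in closed_walks | [forall i in J, f i == g i]].

Lemma pat_add k : pat (k + L) = pat k.
Proof. by rewrite /pat modnDr. Qed.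

Lemma val_at_add k : val_at (k + L) = val_at k.
Proof. by rewrite /val_at modnDr. Qed.

Lemma pat_mx_add k : pat_mx (k + L) = pat_mx k.
Proof.
by rewrite /pat_mx pat_add val_at_add node_add -addSn node_add oddD /= m_odd addbF.
Qed.

Lemma card_fixed_walks t : (forall i, i \in J -> g i \in E) ->
  alpha ^+ L * #|fixed_walks|%:R = \tr (\prod_(t <= k < t + L) pat_mx k).
Proof.
move=> gE; rewrite -(mxtrace_rotate t pat_mx_add) big_mkord.
pose Q i := if i \in J then [set g i] else E.
have -> : fixed_walks =
    [set f : {ffun 'I_L -> X} | [forall i, f i \in Q i] && consistent f].
  apply/setP => f; rewrite !inE /closed_walk andbAC; congr (_ && _).
  apply/andP/forallP => [[/forallP fE /forall_inP fg] i|h].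
    by rewrite /Q; case: ifP => [/fg/eqP->|_]; rewrite ?set11.
  split; first by apply/forallP => i; have := h i; rewrite /Q; case: ifP => // /gE ?; rewrite inE => /eqP->.
  by apply/forall_inP => i iJ; have := h i; rewrite /Q iJ inE.
rewrite -trace_letters; congr (\tr _); apply: eq_bigr => i _.
rewrite /pat_mx /pat /val_at modn_small // inord_val /Q.
by case: ifP => _; rewrite ?letter1 ?letterE.
Qed.

Lemma sum_pat t : (\sum_(t <= k < t + L) pat k = #|J|)%N.
Proof.
rewrite -sum_rotate; last by move=> i; rewrite pat_add.
rewrite big_mkord -sum1_card [RHS]big_mkcond; apply: eq_bigr => i _.
by rewrite /pat modn_small // inord_val; case: (_ \in _).
Qed.

Lemma pat_mxE k (M : 'M[R]_n) u z : pat k ->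
  (pat_mx k * M) u z =
    alpha * ((u == walk_node k (val_at k))%:R * M (walk_node k.+1 (val_at k)) z).
Proof. by move=> pk; rewrite /pat_mx pk -scalerAl mxE mul_delta_mxE. Qed.

(* A run of free positions directly followed by a fixed one contributes varpi. *)
Definition run_end (k : nat) : bool := ~~ pat k && pat k.+1.

Section Bounds.
Variables kappa varpi : R.
Hypotheses (alpha0 : 0 < alpha) (kappa1 : 1 <= kappa) (varpi0 : 0 <= varpi).
Hypothesis row_le : forall x, \sum_y weight_mx x y <= kappa.
Hypothesis col_le : forall y, \sum_x weight_mx x y <= kappa^-1.
Hypothesis entry_le : forall x y, weight_mx x y <= varpi / kappa.
Hypothesis gE : forall i, i \in J -> g i \in E.

Lemma weight_mx_ge0 x y : 0 <= weight_mx x y.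
Proof. by rewrite mxE mulr_ge0 // ltW. Qed.

Local Notation wt := (side_wt kappa).

(** Induction from the end of the period backwards. A free step followed by a free position is
    absorbed by [side_wt]. Just before a prescribed position a single node survives, as the third
    clause records, and the step costs one matrix entry, hence a factor [varpi]. *)
Lemma pat_prod_le t i u : pat t -> (t < i <= t + L)%N ->
  [/\ 0 <= (\prod_(i <= k < t + L) pat_mx k) u (walk_node t (val_at t)),
     (\prod_(i <= k < t + L) pat_mx k) u (walk_node t (val_at t)) <=
      alpha ^+ (\sum_(i <= k < t + L) pat k) *
      varpi ^+ (\sum_(i <= k < t + L) run_end k) * (if pat i then 1 else wt (odd i))
    & pat i -> u != walk_node i (val_at i) ->
      (\prod_(i <= k < t + L) pat_mx k) u (walk_node t (val_at t)) = 0].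
Proof.
move=> pt /andP[ti]; have a0 := ltW alpha0.
move eqd : (t + L - i)%N => d; elim: d i u eqd ti => [|d IHd] i u eqd ti iL.
  have -> : i = (t + L)%N by nat_lia.
  rewrite !big_geq // pat_add pt val_at_add node_add !expr0 !mulr1.
  rewrite !mxE; split=> [||_ /negbTE->//].
    by case: (_ == _).
  by case: (_ == _).
have iL' : (i < t + L)%N by nat_lia.
have {}IHd v := IHd i.+1 v ltac:(nat_lia) ltac:(nat_lia) ltac:(nat_lia).
rewrite !(big_ltn iL').
set c := (\sum_(i.+1 <= k < _) pat k)%N in IHd *.
set e := (\sum_(i.+1 <= k < _) run_end k)%N in IHd *.
set P := \prod_(i.+1 <= k < _) _ in IHd *.
set z := walk_node t _ in IHd *.
have [pi|npi] := boolP (pat i).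
  have [h0 h1 _] := IHd (walk_node i.+1 (val_at i)).
  rewrite pat_mxE //; split.
  - by rewrite !mulr_ge0.
  - rewrite /run_end pi /= add0n mulr1 exprS -mulrA ler_wpM2l //.
    apply: (@le_trans _ _ (P (walk_node i.+1 (val_at i)) z)).
      by rewrite ler_piMl //; case: (_ == _).
    apply: le_trans h1 _; rewrite ler_piMr ?mulr_ge0 ?exprn_ge0 //.
    by case: ifP => // _; apply: side_wt_le1.
  - by move=> _ /negbTE->; rewrite mul0r mulr0.
have P0 v : 0 <= P v z by have [] := IHd v.
have alt0 v : 0 <= alt (odd i) u v by apply: alt_mx_ge0; exact: weight_mx_ge0.
have -> : (pat_mx i * P) u z = \sum_v alt (odd i) u v * P v z.
  by rewrite /pat_mx (negbTE npi) -[_ * _]/(_ *m _) mxE.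
split=> //; first by apply: sumr_ge0 => v _; rewrite mulr_ge0.
rewrite add0n /run_end npi /=.
have [pi1|npi1] := boolP (pat i.+1).
  rewrite (bigD1 (walk_node i.+1 (val_at i.+1))) //= big1 ?addr0; last first.
    by move=> v nv; have [_ _ ->] := IHd v; rewrite ?mulr0.
  have [_ h1 _] := IHd (walk_node i.+1 (val_at i.+1)); rewrite pi1 mulr1 in h1.
  rewrite add1n exprS.
  have -> : alpha ^+ c * (varpi * varpi ^+ e) * wt (odd i) =
    (varpi * wt (odd i)) * (alpha ^+ c * varpi ^+ e) by ring.
  by apply: ler_pM => //; exact: alt_mx_entry.
rewrite add0n.
apply: (@le_trans _ _ (\sum_v alt (odd i) u v * (alpha ^+ c * varpi ^+ e * wt (odd i.+1)))).
  apply: ler_sum => v _; rewrite ler_wpM2l //.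
  by have [_ h _] := IHd v; rewrite (negbTE npi1) in h.
rewrite -mulr_suml mulrCA ler_wpM2l ?mulr_ge0 ?exprn_ge0 //.
exact: alt_mx_row.
Qed.

Lemma fixed_walks_le t : pat t ->
  alpha ^+ L * #|fixed_walks|%:R <=
    alpha ^+ #|J| * varpi ^+ (\sum_(t <= k < t + L) run_end k).
Proof.
move=> pt; rewrite (card_fixed_walks t gE).
have tL : (t < t + L)%N by nat_lia.
rewrite -(sum_pat t) !(big_ltn tL).
set P := \prod_(t.+1 <= k < _) _.
have -> : \tr (pat_mx t * P) = alpha * P (walk_node t.+1 (val_at t)) (walk_node t (val_at t)).
  rewrite /mxtrace (bigD1 (walk_node t (val_at t))) //= pat_mxE // eqxx mul1r big1 ?addr0 //.
  by move=> u /negbTE nu; rewrite pat_mxE // nu mul0r mulr0.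
have [_ h _] := @pat_prod_le t t.+1 (walk_node t.+1 (val_at t)) pt ltac:(nat_lia).
rewrite {1 2}/run_end pt /= add0n exprS -mulrA ler_wpM2l ?(ltW alpha0) //.
apply: le_trans h _; rewrite ler_piMr ?mulr_ge0 ?exprn_ge0 ?(ltW alpha0) //.
by case: ifP => // _; apply: side_wt_le1.
Qed.

(** Each edge of the block contributes [alpha], or 0 if it does not fit its neighbour; what remains
    is the walk across the single gap, from the end of the block back to its beginning. *)
Lemma contiguous_walks_le t j : (0 < j <= L)%N ->
  (forall i, (i < j)%N -> pat (t + i)) ->
  (forall i, (j <= i < L)%N -> ~~ pat (t + i)) ->
  alpha ^+ L * #|fixed_walks|%:R <=
    alpha ^+ j * altp (odd (t + j)) (L - j)
      (walk_node (t + j) (val_at (t + j.-1))) (walk_node t (val_at t)).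
Proof.
move=> /andP[j0 jL] pJ pN; rewrite (card_fixed_walks t gE).
have a0 := ltW alpha0.
set z := walk_node t _.
have tail : \prod_(t + j <= k < t + L) pat_mx k = altp (odd (t + j)) (L - j).
  rewrite -alt_prod_nat; have -> : (t + j + (L - j) = t + L)%N by nat_lia.
  rewrite big_nat_cond [RHS]big_nat_cond; apply: eq_bigr => k /andP[/andP[k1 k2] _].
  rewrite /pat_mx; have -> : k = (t + (k - t))%N by nat_lia.
  by rewrite (negbTE (pN _ _)) //; nat_lia.
have chain d : (d < j)%N ->
    0 <= (\prod_(t + (j - d) <= k < t + L) pat_mx k)
      (walk_node (t + (j - d)) (val_at (t + (j - d).-1))) z <=
    alpha ^+ d * altp (odd (t + j)) (L - j) (walk_node (t + j) (val_at (t + j.-1))) z.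
  elim: d => [|d IHd] dj.
    rewrite subn0 tail expr0 mul1r lexx andbT.
    by apply: alt_prod_ge0; exact: weight_mx_ge0.
  have {IHd} := IHd (ltnW dj).
  have -> : (j - d = (j - d.+1).+1)%N by nat_lia.
  set i := (j - d.+1)%N; rewrite addnS /= => /andP[h0 h1].
  have iL : (t + i < t + L)%N by rewrite /i; nat_lia.
  rewrite (big_ltn iL) pat_mxE; last by apply: pJ; rewrite /i; nat_lia.
  rewrite exprS -mulrA; apply/andP; split; first by rewrite !mulr_ge0.
  rewrite ler_wpM2l //; apply: le_trans h1.
  by rewrite ler_piMl //; case: (_ == _).
have tL : (t < t + L)%N by nat_lia.
rewrite (big_ltn tL); set P := \prod_(t.+1 <= k < _) _.
have pt : pat t by rewrite -(addn0 t); apply: pJ.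
have -> : \tr (pat_mx t * P) = alpha * P (walk_node t.+1 (val_at t)) z.
  rewrite /mxtrace (bigD1 z) //= pat_mxE // eqxx mul1r big1 ?addr0 //.
  by move=> u /negbTE nu; rewrite pat_mxE // nu mul0r mulr0.
have := chain j.-1 ltac:(nat_lia); have -> : (j - j.-1 = 1)%N by nat_lia.
rewrite addn1 /= addn0 => /andP[_ h].
by rewrite -{1}(prednK j0) exprS -mulrA ler_wpM2l.
Qed.

End Bounds.
End Pattern.
End ClosedWalks.

(** Modulo the period [m.+1], [t + m] is the position before [t]; thus [t] begins a run. *)
Lemma periodic_boundary (p : nat -> bool) (m k0 k1 : nat) :
  (forall k, p (k + m.+1)%N = p k) -> p k0 -> ~~ p k1 ->
  exists2 t, p t & ~~ p (t + m)%N.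
Proof.
move=> per pk0 npk1.
have perM k c : p (k + c * m.+1)%N = p k.
  by elim: c => [|c IHc]; rewrite ?addn0 // mulSn addnCA addnC per.
have ex : exists i, p (k1 + i)%N.
  exists (k0 + k1 * m.+1 - k1)%N; rewrite subnKC ?perM //; nia.
case: (ex_minnP ex) => -[|i]; first by rewrite addn0 (negbTE npk1).
move=> pi imin; exists (k1 + i.+1)%N => //.
have -> : (k1 + i.+1 + m = k1 + i + m.+1)%N by nat_lia.
by rewrite per; apply/negP => /imin; rewrite ltnn.
Qed.

Lemma card_le_fibres (U S : finType) (A : {set U}) (B : {set S}) (phi : U -> S) (c : nat) :
  (forall g, g \in A -> phi g \in B) ->
  (forall s, s \in B -> #|[set g in A | phi g == s]| <= c)%N ->
  (#|A| <= #|B| * c)%N.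
Proof.
move=> AB fib; rewrite -sum1_card (partition_big phi (mem B)) //=.
rewrite -sum_nat_const; apply: leq_sum => s sB.
by apply: leq_trans (fib s sB); rewrite sum1_card; apply/eq_leq/eq_card => g; rewrite !inE.
Qed.

Lemma sum_ord_const (A : pzRingType) (k : nat) (c : A) : \sum_(i < k) c = k%:R * c.
Proof. by rewrite sumr_const card_ord mulr_natl. Qed.

(** * Existence of a closed walk without defects *)

Section Core.
Variables (R : realFieldType) (n' m l : nat) (X : finType) (E : {set X}).
Local Notation n := n'.+1.
Local Notation L := m.+1.
Variables na nb : X -> 'I_n.
Variables alpha kappa varpi zeta r H : R.
Hypothesis m_odd : odd m.
Hypothesis Ll : L = (l + l)%N.
Hypothesis l1 : (1 < l)%N.
Hypotheses (alpha0 : 0 < alpha) (kappa1 : 1 <= kappa) (varpi0 : 0 <= varpi)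
  (varpi1 : varpi <= 1).
Let W := weight_mx E na nb alpha.
Hypothesis row_le : forall x, \sum_y W x y <= kappa.
Hypothesis col_le : forall y, \sum_x W x y <= kappa^-1.
Hypothesis entry_le : forall x y, W x y <= varpi / kappa.

Local Notation altp := (alt_prod W).
Local Notation Z := (closed_walks m E na nb).
Local Notation node := (walk_node na nb).
Let T := \tr (altp false L).

Hypothesis zeta0 : 0 < zeta.
Hypothesis T_ge : zeta <= T.
Hypothesis r1 : 1 <= r.

Let kappa0 : 0 < kappa. Proof. exact: lt_le_trans kappa1. Qed.
Let W0 x y : 0 <= W x y. Proof. exact: weight_mx_ge0. Qed.
Let T0 : 0 < T. Proof. exact: lt_le_trans T_ge. Qed.
Let aL : 0 < alpha ^+ L. Proof. exact: exprn_gt0. Qed.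

Lemma card_Z : alpha ^+ L * #|Z|%:R = T.
Proof. exact: card_closed_walks. Qed.

(** For an edge of [E], the normalized number of closed walks that have it at a given position; it
    is the same for all positions ([card_fixed1]). *)
Definition mu (g : X) : R := alpha * altp true m (nb g) (na g).

(** The normalized number of closed walks that return to [x] on side [b]. *)
Definition mom (b : bool) (x : 'I_n) : R := altp b L x x.

Lemma mu_ge0 g : 0 <= mu g.
Proof. by rewrite mulr_ge0 ?alt_prod_ge0 // ltW. Qed.

Lemma mom_ge0 b x : 0 <= mom b x.
Proof. exact: alt_prod_ge0. Qed.

Lemma weight_mx_sum (x y : 'I_n) :
  W x y = \sum_(g in E | (na g == x) && (nb g == y)) alpha.
Proof. by rewrite mxE sumr_const mulr_natr; congr (_ *+ _); apply: eq_card => g; rewrite inE. Qed.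

Lemma sum_mu (i : nat) (x : 'I_n) :
  \sum_(g in E | node i g == x) mu g = mom (odd i) x.
Proof.
have sym y z : altp false m y z = altp true m z y.
  by rewrite -[altp true m]trmxK alt_prod_tr m_odd mxE.
rewrite /mom [altp _ _]/= mxE /walk_node.
case: (odd i) => /=.
  under [RHS]eq_bigr => y _ do rewrite mxE weight_mx_sum sym mulr_suml.
  rewrite (exchange_big_dep (fun g => (g \in E) && (nb g == x))) /=; last first.
    by move=> y g _ /and3P[-> _ ->].
  apply: eq_bigr => g /andP[gE /eqP gx].
  rewrite (bigD1 (na g)) /= ?gE ?gx ?eqxx // big1 ?addr0 ?/mu ?gx //.
  by move=> y /andP[/and3P[_ /eqP-> _]]; rewrite eqxx.
under [RHS]eq_bigr => y _ do rewrite weight_mx_sum mulr_suml.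
rewrite (exchange_big_dep (fun g => (g \in E) && (na g == x))) /=; last first.
  by move=> y g _ /and3P[-> -> _].
apply: eq_bigr => g /andP[gE /eqP gx].
rewrite (bigD1 (nb g)) /= ?gE ?gx ?eqxx // big1 ?addr0 ?/mu ?gx //.
by move=> y /andP[/and3P[_ _ /eqP->]]; rewrite eqxx.
Qed.

Lemma sum_mom b : \sum_x mom b x = T.
Proof.
have E1 b' : \sum_x mom b' x = \sum_(g in E) mu g.
  rewrite (partition_big (node b') xpredT) //=; apply: eq_bigr => x _.
  by rewrite sum_mu; case: b'.
by rewrite E1 -(E1 false).
Qed.

Lemma sum_mu_all : \sum_(g in E) mu g = T.
Proof.
rewrite -(sum_mom false) (partition_big (node 0) xpredT) //=; apply: eq_bigr => x _.
by rewrite sum_mu.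
Qed.

Lemma card_fixed1 (i : 'I_L) (h : X) : h \in E ->
  alpha ^+ L * #|[set f in Z | f i == h]|%:R = mu h.
Proof.
move=> hE.
have -> : [set f in Z | f i == h] = fixed_walks E na nb [set i] (fun=> h).
  apply/setP => f; rewrite !inE; congr (_ && _).
  apply/idP/forall_inP => [fi j|]; first by rewrite inE => /eqP->.
  by move/(_ i); rewrite set11; apply.
rewrite (@card_fixed_walks _ _ _ _ _ _ _ _ m_odd _ _ i) //.
have iL : (i < i + L)%N by nat_lia.
rewrite (big_ltn iL).
have -> : \prod_(i.+1 <= k < i + L) pat_mx E na nb alpha [set i] (fun=> h) k =
    altp (odd i.+1) m.
  rewrite -alt_prod_nat; have -> : (i.+1 + m = i + L)%N by nat_lia.
  rewrite big_nat_cond [RHS]big_nat_cond; apply: eq_bigr => k /andP[/andP[k1 k2] _].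
  rewrite /pat_mx /pat inE ifN //; apply/eqP => /(congr1 val) /=.
  rewrite inordK ?ltn_pmod // => e; have := divn_eq k L; rewrite e => dk.
  have : (i < L)%N by [].
  by move: k1 k2 dk; case: (k %/ L)%N => [|[|q]]; rewrite ?mulSn; nat_lia.
have pi : pat [set i] i by rewrite /pat inE modn_small // inord_val.
rewrite /mxtrace (bigD1 (node i h)) //= pat_mxE // eqxx mul1r big1 ?addr0; last first.
  by move=> u /negbTE nu; rewrite pat_mxE // nu mul0r mulr0.
rewrite /mu /walk_node /=; case: (odd i) => //=; congr (_ * _).
by rewrite -[altp true m]trmxK alt_prod_tr m_odd mxE.
Qed.

Section Light.
Variable delta : R.
Hypothesis delta0 : 0 < delta.

(** The first two clauses let [mu g] dominate the return moments of both end nodes, the third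
    excludes edges far below the average. *)
Definition heavy (g : X) :=
  [&& delta * alpha * mom false (na g) <= kappa * mu g,
      delta * alpha * mom true (nb g) <= kappa * mu g
    & delta * T <= #|E|%:R * mu g].

Lemma deg_le (i : nat) (x : 'I_n) :
  alpha * #|[set g in E | node i g == x]|%:R <= kappa.
Proof.
have -> : alpha * #|[set g in E | node i g == x]|%:R = \sum_y alt_mx W (odd i) x y.
  rewrite mulr_natr -sumr_const.
  rewrite (partition_big (node i.+1) xpredT) //=; apply: eq_bigr => y _.
  rewrite /walk_node /=; case: (odd i) => /=.
    rewrite [W^T _ _]mxE weight_mx_sum.
    by apply: eq_bigl => g; rewrite !inE -andbA; congr (_ && _); rewrite andbC.
  rewrite weight_mx_sum.
  by apply: eq_bigl => g; rewrite !inE -andbA.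
case: (odd i) => //=; under eq_bigr do rewrite mxE.
by apply: le_trans (col_le x) _; apply: le_trans kappa1; rewrite invf_le1.
Qed.

(** A node [x] has at most [kappa / alpha] edges, so those that are light with respect to [x] carry
    at most [delta] times the moment of [x]; the moments add up to [T]. *)
Lemma sum_light_side i :
  \sum_(g in E | kappa * mu g < delta * alpha * mom (odd i) (node i g)) mu g
    <= delta * T.
Proof.
rewrite -(ler_pM2l kappa0) mulr_sumr.
apply: (@le_trans _ _ (\sum_(g in E) delta * alpha * mom (odd i) (node i g))).
  rewrite big_mkcondr /=; apply: ler_sum => g _; case: ifP => [/ltW//|_].
  by rewrite !mulr_ge0 ?mom_ge0 // ltW.
rewrite (partition_big (node i) xpredT) //= -(sum_mom (odd i)) !mulr_sumr.
apply: ler_sum => x _.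
apply: (@le_trans _ _ (\sum_(g in E | node i g == x) delta * alpha * mom (odd i) x)).
  by rewrite le_eqVlt; apply/orP; left; apply/eqP; apply: eq_bigr => g /andP[_ /eqP->].
rewrite sumr_const.
have := deg_le i x; set c := #|[set _ in _ | _]|.
have -> : #|[pred g in E | node i g == x]| = c by apply: eq_card => g; rewrite !inE.
move=> h; rewrite -mulr_natr.
have -> : delta * alpha * mom (odd i) x * c%:R = alpha * c%:R * (delta * mom (odd i) x).
  by ring.
by rewrite ler_wpM2r // mulr_ge0 ?mom_ge0 // ltW.
Qed.

Lemma sum_light : \sum_(g in E | ~~ heavy g) mu g <= 3 * delta * T.
Proof.
have sub : \sum_(g in E | ~~ heavy g) mu g <=
   \sum_(g in E | kappa * mu g < delta * alpha * mom false (na g)) mu g +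
   \sum_(g in E | kappa * mu g < delta * alpha * mom true (nb g)) mu g +
   \sum_(g in E | #|E|%:R * mu g < delta * T) mu g.
  rewrite !big_mkcondr -!big_split /=; apply: ler_sum => g _.
  rewrite /heavy !negb_and -!ltNge; have := mu_ge0 g.
  by do 3 case: (_ < _) => /=; lra.
apply: le_trans sub _.
have := sum_light_side 0; have := sum_light_side 1; rewrite /walk_node /= => h1 h0.
suff h2 : \sum_(g in E | #|E|%:R * mu g < delta * T) mu g <= delta * T by lra.
have [E0|E0] := posnP #|E|.
  by rewrite big1 ?mulr_ge0 ?ltW // => g /andP[gE _]; move: E0 => /card0_eq/(_ g); rewrite gE.
have eE : 0 < #|E|%:R :> R by rewrite ltr0n.
rewrite -(ler_pM2l eE) mulr_sumr.
apply: (@le_trans _ _ (\sum_(g in E) delta * T)).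
  rewrite big_mkcondr /=; apply: ler_sum => g _; case: ifP => [/ltW//|_].
  by rewrite !mulr_ge0 // ltW.
by rewrite sumr_const mulr_natl.
Qed.

Lemma light_walks :
  alpha ^+ L * #|[set f in Z | [exists i, ~~ heavy (f i)]]|%:R <= L%:R * (3 * delta * T).
Proof.
apply: (@le_trans _ _ (alpha ^+ L * \sum_(i < L) \sum_(g in E | ~~ heavy g)
    #|[set f in Z | f i == g]|%:R)).
  rewrite ler_wpM2l ?(ltW aL) //.
  apply: (@le_trans _ _ (\sum_(f in Z) \sum_(i < L) (~~ heavy (f i))%:R)).
    rewrite -sumr_const big_mkcond [leRHS]big_mkcond; apply: ler_sum => f _.
    rewrite inE; case: (f \in Z) => //=; case: ifP => [/existsP[i hi]|_]; last first.
      by apply: sumr_ge0.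
    by rewrite (bigD1 i) //= hi lerDl; apply: sumr_ge0.
  rewrite exchange_big /=; apply: ler_sum => i _.
  rewrite (partition_big (fun f : {ffun 'I_L -> X} => f i) (mem E)) /=; last first.
    by move=> f; rewrite inE => /andP[/forallP].
  rewrite [leRHS]big_mkcondr; apply: ler_sum => g gE.
  rewrite (eq_bigr (fun=> (~~ heavy g)%:R)); last by move=> f /andP[_ /eqP->].
  case: (heavy g) => /=; first by rewrite big1.
  rewrite -sum1_card natr_sum le_eqVlt; apply/orP; left; apply/eqP.
  by apply: eq_bigl => f; rewrite [in RHS]inE.
rewrite mulr_sumr -sum_ord_const.
apply: ler_sum => i _; rewrite mulr_sumr.
apply: le_trans sum_light.
by apply: ler_sum => g /andP[gE _]; rewrite card_fixed1.
Qed.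

End Light.

Lemma letter_node (i : nat) (x : 'I_n) :
  letter na nb alpha i [set g in E | node i g == x] = delta_mx x x * alt_mx W (odd i).
Proof.
rewrite -(letterE E na nb alpha i); apply/matrixP => u v.
rewrite mul_delta_mxE !summxE mulr_sumr.
under [RHS]eq_bigr do rewrite !mxE.
rewrite big_mkcond [RHS]big_mkcond; apply: eq_bigr => g _; rewrite inE !mxE.
case: (g \in E) => //=; rewrite [x == _]eq_sym.
have [->|ne] := eqVneq (node i g) x; first by case: (u == x); rewrite ?mul1r ?mul0r ?mulr0.
by rewrite /= !mulr0.
Qed.

(** Fixing the common value [x] of the two nodes cuts the walk into two walks from [x] to [x], each
    of weight at most [varpi]. Both sides use the same vertex set, so nodes of opposite sides may
    collide too. *)
Lemma collision_walks (i i' : 'I_L) : (i < i')%N ->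
  alpha ^+ L * #|[set f in Z | node i (f i) == node i' (f i')]|%:R <= n%:R * varpi ^+ 2.
Proof.
move=> ii'.
pose Q x (k : 'I_L) := if (k == i) || (k == i') then [set g in E | node k g == x] else E.
have -> : #|[set f in Z | node i (f i) == node i' (f i')]|%:R =
    \sum_(x : 'I_n) #|[set f : {ffun 'I_L -> X} | [forall k, f k \in Q x k] &&
      consistent na nb f]|%:R :> R.
  rewrite -natr_sum; congr (_%:R).
  rewrite -sum1_card (partition_big (fun f : {ffun 'I_L -> X} => node i (f i)) xpredT) //=.
  apply: eq_bigr => x _; rewrite -sum1_card; apply: eq_bigl => f.
  rewrite !inE /closed_walk; apply/andP/andP => [[/andP[/andP[/forallP fE cf] /eqP e] /eqP ex]|].
    split=> //; apply/forallP => k; rewrite /Q; case: ifP => // /orP[]/eqP->.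
      by rewrite inE fE ex eqxx.
    by rewrite inE fE -e ex eqxx.
  move=> [/forallP h cf]; have := h i; have := h i'.
  rewrite /Q !eqxx orbT /= !inE => /andP[_ /eqP->] /andP[_ /eqP->]; rewrite !eqxx cf !andbT.
  split=> //; apply/forallP => k; have := h k; rewrite /Q; case: ifP => //.
  by rewrite inE => _ /andP[].
rewrite mulr_sumr -sum_ord_const.
apply: ler_sum => x _; rewrite -trace_letters //.
pose M k : 'M[R]_n := if (k %% L == i)%N || (k %% L == i')%N
  then delta_mx x x * alt_mx W (odd k) else alt_mx W (odd k).
have perM k : M (k + L)%N = M k by rewrite /M modnDr oddD /= m_odd addbF.
have -> : \prod_(k < L) letter na nb alpha k (Q x k) = \prod_(0 <= k < L) M k.
  rewrite big_mkord; apply: eq_bigr => k _.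
  rewrite /Q /M modn_small // -!(inj_eq val_inj) /=.
  by case: ifP => _; rewrite ?letter_node ?letterE.
have iL := ltn_ord i'.
rewrite (mxtrace_rotate i perM) (@big_cat_nat _ _ _ i') /=; [|nat_lia|nat_lia].
have seg a b : (a < b)%N -> (forall k, (a < k < b)%N -> (k %% L != i)%N && (k %% L != i')%N) ->
    ((a %% L == i)%N || (a %% L == i')%N) ->
    \prod_(a <= k < b) M k = delta_mx x x * altp (odd a) (b - a).
  move=> ab out ina; rewrite -alt_prod_nat subnKC ?(ltnW ab) // !(big_ltn ab) mulrA.
  congr (_ * _); first by rewrite /M ina.
  rewrite big_nat_cond [RHS]big_nat_cond; apply: eq_bigr => k /andP[kab _].
  by rewrite /M; have /andP[/negbTE-> /negbTE->] := out k kab.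
rewrite (seg i i') //; last first.
- by rewrite modn_small ?eqxx.
- move=> k /andP[k1 k2]; rewrite modn_small; last by nat_lia.
  by rewrite !neq_ltn k1 k2 /= orbT.
rewrite (seg i' (i + L)%N); last first.
- by rewrite (modn_small iL) eqxx orbT.
- move=> k /andP[k1 k2]; have [kL|kL] := ltnP k L.
    by rewrite modn_small // !neq_ltn (ltn_trans ii' k1) k1 !orbT.
  have -> : k = (k - L + L)%N by nat_lia.
  rewrite modnDr modn_small; last by nat_lia.
  by rewrite !neq_ltn; apply/andP; split; apply/orP; left; nat_lia.
- by nat_lia.
set P := altp _ _; set P' := altp _ _.
have -> : \tr (delta_mx x x * P * (delta_mx x x * P')) = P x x * P' x x.
  rewrite /mxtrace (bigD1 x) //= -mulrA mul_delta_mxE eqxx mul1r big1 ?addr0.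
    rewrite -[_ * _]/(_ *m _) mxE (bigD1 x) //= mul_delta_mxE eqxx mul1r big1 ?addr0 //.
    by move=> u /negbTE nu; rewrite mul_delta_mxE nu mul0r mulr0.
  by move=> u /negbTE nu; rewrite mul_delta_mxE nu mul0r.
have le b s y z : (0 < s)%N -> altp b s y z <= varpi.
  case: s => // s _; apply: le_trans (alt_prod_le W0 kappa1 varpi0 row_le col_le entry_le _ _ _ _) _.
  by rewrite ler_piMr // side_wt_le1.
by rewrite expr2; apply: ler_pM; rewrite ?alt_prod_ge0 ?le // subn_gt0 //; nat_lia.
Qed.

Lemma mass_le : alpha * #|E|%:R <= n%:R.
Proof.
have -> : alpha * #|E|%:R = \sum_y \sum_x W x y.
  rewrite mulr_natr -sumr_const (partition_big nb xpredT) //=.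
  apply: eq_bigr => y _; rewrite (partition_big na xpredT) //=.
  apply: eq_bigr => x _; rewrite weight_mx_sum.
  by apply: eq_bigl => g; rewrite -andbA [(nb g == y) && _]andbC.
rewrite -[leRHS]mulr1 -sum_ord_const; apply: ler_sum => y _.
by apply: le_trans (col_le y) _; rewrite invf_le1.
Qed.

Hypothesis varpi_interp : n%:R * varpi <= zeta * r ^+ l.-1.
Hypothesis varpi_full : n%:R <= zeta * r ^+ m.
Hypothesis varpi_sq : n%:R * varpi ^+ 2 <= zeta.

Section Key.
Variable delta : R.
Hypothesis delta0 : 0 < delta.

(** This plays the part of [theta] in [alt_prod_interp]: it bounds the return moments at both ends
    of a heavy edge and is linear in [mu g], hence can be summed over [g]. *)
Let thr (g : X) := kappa * mu g / (delta * alpha).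

Let da0 : 0 < delta * alpha. Proof. exact: mulr_gt0. Qed.

Lemma thr_ge g : g \in E -> heavy delta g -> zeta / n%:R <= thr g.
Proof.
move=> gE /and3P[_ _ h]; rewrite /thr ler_pdivlMr // mulrAC ler_pdivrMr ?ltr0n //.
have mu0 := mu_ge0 g.
apply: (@le_trans _ _ (mu g * n%:R)); last first.
  by rewrite ler_wpM2r // ler_peMl.
apply: (@le_trans _ _ (mu g * (alpha * #|E|%:R))); last by rewrite ler_wpM2l // mass_le.
have -> : zeta * (delta * alpha) = alpha * (delta * zeta) by ring.
rewrite [leRHS]mulrCA ler_wpM2l ?(ltW alpha0) // [leRHS]mulrC.
by apply: le_trans h; rewrite ler_wpM2l ?(ltW delta0).
Qed.

Lemma thr_mom b g : heavy delta g -> mom b (if b then nb g else na g) <= thr g.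
Proof.
move=> /and3P[ha hb _]; rewrite /thr ler_pdivlMr // mulrC.
by case: b.
Qed.

(** Three cases. If all positions are prescribed, the factor besides [alpha ^+ #|J|] is at most 1
    and [varpi_full] suffices. If there are at least two gaps, they give [varpi ^+ 2], which is at
    most [zeta / n]. If there is one gap, [alt_prod_interp] applies to it, with the larger of the
    thresholds of the first and the last prescribed edge. *)
Lemma key_bound (J : {set 'I_L}) (g : 'I_L -> X) :
  (1 < #|J|)%N -> (forall i, i \in J -> g i \in E) ->
  (forall i, i \in J -> heavy delta (g i)) ->
  exists2 t, t \in J &
    alpha ^+ L * #|fixed_walks E na nb J g|%:R <=
      alpha ^+ #|J| * (thr (g t) * r ^+ #|J|.-1).
Proof.
move=> J1 gE gH.
have r0 : 0 < r by exact: lt_le_trans r1.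
have n0 : 0 < n%:R :> R by rewrite ltr0n.
have th0 i : i \in J -> zeta / n%:R <= thr (g i) by move=> iJ; exact: thr_ge (gE i iJ) (gH i iJ).
have thp i : i \in J -> 0 < thr (g i).
  by move=> iJ; apply: lt_le_trans (th0 i iJ); rewrite divr_gt0.
have aJ : 0 <= alpha ^+ #|J| by rewrite exprn_ge0 // ltW.
have [j0 j0J] : exists j, j \in J by apply/set0Pn; rewrite -card_gt0; apply: ltn_trans J1.
have patj i : pat J i = (inord (i %% L) \in J) by [].
have gen := fun t (pt : pat J t) =>
  fixed_walks_le m_odd alpha0 kappa1 varpi0 row_le col_le entry_le gE pt.
have [/eqP JT|Jne] := boolP (J == [set: 'I_L]).
  exists j0 => //.
  have p0 : pat J 0 by rewrite patj JT inE.
  apply: le_trans (gen 0%N p0) _; rewrite ler_wpM2l //.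
  apply: (@le_trans _ _ 1); first by rewrite exprn_ile1.
  rewrite JT cardsT card_ord -ler_pdivrMr ?exprn_gt0 //=.
  apply: le_trans (th0 j0 j0J); rewrite ler_pdivrMr ?exprn_gt0 // mulrAC ler_pdivlMr //.
  by rewrite mul1r.
have [k1 k1J] : exists k, k \notin J.
  by move: Jne; rewrite -subTset => /subsetPn[k _ kJ]; exists k.
(* A run of prescribed positions begins at [t]; its length is the [j] obtained below. *)
have [t pt npt] : exists2 t, pat J t & ~~ pat J (t + m)%N.
  apply: (@periodic_boundary _ _ j0 k1); first exact: pat_add.
    by rewrite patj modn_small // inord_val.
  by rewrite patj modn_small // inord_val.
have ex : exists i, ~~ pat J (t + i) by exists m.
case: (ex_minnP ex) => j npj jmin.
have jm : (j <= m)%N := jmin _ npt.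
have j_gt0 : (0 < j)%N by case: j npj {jmin jm} => //; rewrite addn0 pt.
have [/existsP[i /andP[/andP[ji npi] pi]]|/existsPn none] :=
  boolP [exists i : 'I_m, (j <= i)%N && ~~ pat J (t + i) && pat J (t + i.+1)].
  exists j0 => //; apply: le_trans (gen t pt) _; rewrite ler_wpM2l //.
  (* Both [t + i] and [t + m], the position before [t], are free and directly followed by prescribed
     ones. *)
  have two : (2 <= \sum_(t <= k < t + L) run_end J k)%N.
    rewrite (@big_cat_nat _ _ _ (t + i.+1)) /=; [|nat_lia|by have := ltn_ord i; nat_lia].
    have i1 : (t <= t + i)%N by nat_lia.
    have i2 : (t + i.+1 <= t + m)%N by have := ltn_ord i; nat_lia.
    rewrite addnS big_nat_recr //= {2}/run_end npi -addnS pi.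
    rewrite [X in (_ + X)%N](_ : _ = \sum_(t + i.+1 <= k < (t + m).+1) run_end J k)%N; last by rewrite -addnS.
    rewrite big_nat_recr //= {3}/run_end npt.
    by rewrite -addnS pat_add pt /=; nat_lia.
  apply: (@le_trans _ _ (varpi ^+ 2)); first by rewrite ler_wiXn2l.
  apply: (@le_trans _ _ (zeta / n%:R)); first by rewrite ler_pdivlMr // mulrC.
  apply: le_trans (th0 j0 j0J) _; rewrite ler_peMr ?(ltW (thp _ j0J)) // exprn_ege1 //.
have gap i : (j <= i < L)%N -> ~~ pat J (t + i).
  elim: i => [|i IHi] /andP[ji iL]; first by move: ji; rewrite leqn0 => /eqP e; move: j_gt0; rewrite e.
  move: ji; rewrite leq_eqVlt => /orP[/eqP<- //|ji].
  have im : (i < m)%N by [].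
  have := none (Ordinal im); rewrite /= -ltnS ji IHi ?andTb //; nat_lia.
have run i : (i < j)%N -> pat J (t + i).
  by move=> ij; apply: contraT => /jmin; rewrite leqNgt ij.
have Jj : #|J| = j.
  rewrite -(sum_pat J t) (@big_cat_nat _ _ _ (t + j)) /=; [|nat_lia|nat_lia].
  rewrite [X in (_ + X)%N]big1_seq ?addn0; last first.
    move=> k; rewrite mem_index_iota => /andP[_ /andP[k1' k2]].
    have -> : k = (t + (k - t))%N by nat_lia.
    by rewrite (negbTE (gap _ _)) //; nat_lia.
  rewrite (eq_big_nat _ _ (F2 := fun=> 1%N)); last first.
    move=> k /andP[k1' k2].
    have -> : k = (t + (k - t))%N by nat_lia.
    by rewrite run //; nat_lia.
  by rewrite sum_nat_const_nat muln1; nat_lia.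
have jL : (0 < j <= L)%N by nat_lia.
have cont := contiguous_walks_le na nb m_odd alpha0 gE jL run gap.
pose t0 : 'I_L := inord (t %% L); pose t1 : 'I_L := inord ((t + j.-1) %% L).
have t0J : t0 \in J by exact: pt.
have t1J : t1 \in J by apply: run; nat_lia.
have val0 : val_at g t = g t0 by [].
have val1 : val_at g (t + j.-1) = g t1 by [].
have fin s : s \in J -> thr (g t0) <= thr (g s) -> thr (g t1) <= thr (g s) ->
    alpha ^+ L * #|fixed_walks E na nb J g|%:R <=
      alpha ^+ #|J| * (thr (g s) * r ^+ #|J|.-1).
  move=> sJ le0 le1; apply: le_trans cont _; have aj : 0 <= alpha ^+ j by rewrite -Jj.
  rewrite Jj (ler_wpM2l aj) //.
  (* The gap has [L - j] steps, which turns the exponent of [alt_prod_interp] into the number of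
     prescribed edges minus one. *)
  have je : j.-1 = (l + l - (L - j)).-1 by rewrite -Ll; nat_lia.
  rewrite [X in r ^+ X]je.
  have lower x k : (0 < k)%N -> x <= zeta * r ^+ k / n%:R -> x <= thr (g s) * r ^+ k.
    move=> _ h; apply: le_trans h _; rewrite mulrAC ler_wpM2r ?exprn_ge0 ?(ltW r0) //.
    exact: th0.
  apply: (alt_prod_interp W0 kappa1 varpi0 row_le col_le entry_le) => //.
  - by rewrite -Ll; move: J1 jm; rewrite Jj; nat_lia.
  - exact: thp.
  - by apply: lower; [nat_lia|rewrite ler_pdivlMr // mulrC].
  - by apply: lower; rewrite -Ll //=; [nat_lia|rewrite ler_pdivlMr // mul1r].
  - rewrite -Ll val1; apply: le_trans le1.
    exact: (thr_mom (odd (t + j)) (gH _ t1J)).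
  - rewrite -Ll val0; apply: le_trans le0.
    have -> : odd (L - j) (+) odd (t + j) = odd t.
      rewrite oddB; last by nat_lia.
      by rewrite oddD /= m_odd /=; case: (odd j); case: (odd t).
    exact: (thr_mom (odd t) (gH _ t0J)).
have [le|lt] := leP (thr (g t0)) (thr (g t1)); first by exists t1 => //; exact: fin.
by exists t0 => //; apply: fin => //; exact: ltW.
Qed.

Variables (SS : {set {set X}}).
Hypothesis H0 : 0 <= H.
Hypothesis SS_deg : forall h j, h \in E -> (1 < j)%N ->
  #|[set S in SS | (h \in S) && (#|S| == j)]|%:R <= H ^+ j.-1.
Hypothesis Har : H * alpha * r * kappa <= 1.

Definition bad_walks (J : {set 'I_L}) : {set {ffun 'I_L -> X}} :=
  [set f in Z | [forall i in J, heavy delta (f i)] &&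
     ((f @: J \in SS) && (#|f @: J| == #|J|))].

(** Bad walks are grouped by their restriction [g] to [J]. By [key_bound] a group is charged to some
    edge [h = g t] in proportion to [mu h]; at most [H ^+ #|J|.-1 * L ^ L] groups have the same [t]
    and [h], and [mu] sums to [T]. Since [#|J|] is at least 2 and [kappa] at least 1, a factor
    [H * alpha * r * kappa] can be kept and the others dropped. *)
Lemma bad_walks_le (J : {set 'I_L}) : (1 < #|J|)%N ->
  alpha ^+ L * #|bad_walks J|%:R <= (L ^ L.+1)%:R * (H * alpha * r * kappa) / delta * T.
Proof.
move=> J1.
have r0 : 0 < r by exact: lt_le_trans r1.
have har0 : 0 <= H * alpha * r * kappa by rewrite !mulr_ge0 // ltW.
have [->|] := set_0Vmem (bad_walks J).
  by rewrite cards0 mulr0 mulr_ge0 ?(ltW T0) // divr_ge0 ?(ltW delta0) // mulr_ge0.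
move=> [f0 _]; pose x0 := f0 ord0.
(* [x0] fills the positions outside [J], so that a restriction is again a function on all positions
   and can be counted among those with this default value. *)
pose restr (f : {ffun 'I_L -> X}) := [ffun i => if i \in J then f i else x0].
pose D := restr @: bad_walks J.
have restrE f : {in J, restr f =1 f} by move=> i iJ; rewrite ffunE iJ.
have DP g : g \in D -> [/\ forall i, i \in J -> g i \in E,
    forall i, i \in J -> heavy delta (g i), g @: J \in SS & #|g @: J| = #|J|]
    /\ forall i, i \notin J -> g i = x0.
  move=> /imsetP[f]; rewrite !inE => /and4P[/andP[/forallP fE _] /forall_inP fH fS /eqP fJ] ->.
  have -> : restr f @: J = f @: J by apply: eq_in_imset.
  split; first by split=> // i iJ; rewrite restrE //; exact: fH.
  by move=> i /negbTE iJ; rewrite ffunE iJ.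
have step1 : #|bad_walks J|%:R <= \sum_(g in D) #|fixed_walks E na nb J g|%:R :> R.
  rewrite -natr_sum ler_nat -sum1_card (partition_big restr (mem D)) /=; last first.
    by move=> f fB; apply: imset_f.
  apply: leq_sum => g gD; rewrite sum1_card; apply/subset_leq_card/subsetP => f.
  move=> fB; have /andP[{}fB /eqP<-] : (f \in bad_walks J) && (restr f == g) := fB.
  move: fB; rewrite inE => /andP[fZ _].
  by rewrite inE fZ; apply/forall_inP => i iJ; rewrite restrE.
have j1 : #|J| = #|J|.-1.+1 by rewrite prednK // ltnW.
pose c := alpha ^+ #|J| * (r ^+ #|J|.-1 * (kappa / (delta * alpha))).
have c0 : 0 <= c by rewrite !mulr_ge0 ?exprn_ge0 ?invr_ge0 // ltW.
have step2 : alpha ^+ L * #|bad_walks J|%:R <=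
    \sum_(t in J) \sum_(h in E) c * mu h * #|[set g in D | g t == h]|%:R.
  apply: (@le_trans _ _ (\sum_(g in D) \sum_(t in J) c * mu (g t))).
    apply: le_trans (ler_wpM2l (ltW aL) step1) _; rewrite mulr_sumr.
    apply: ler_sum => g gD; have [[gE gH gS gJ] _] := DP g gD.
    have [t tJ h] := key_bound J1 gE gH; apply: le_trans h _.
    rewrite (bigD1 t) //= -[leLHS]addr0; apply: lerD; last first.
      by apply: sumr_ge0 => i _; rewrite mulr_ge0 ?mu_ge0.
    by rewrite le_eqVlt /c /thr; apply/orP; left; apply/eqP; field; rewrite !lt0r_neq0.
  rewrite exchange_big; apply: ler_sum => t tJ.
  rewrite (partition_big (fun g : {ffun 'I_L -> X} => g t) (mem E)) /=; last first.
    by move=> g gD; have [[gE _ _ _] _] := DP g gD; exact: gE.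
  apply: ler_sum => h hE.
  rewrite (eq_bigr (fun=> c * mu h)); last by move=> g /andP[_ /eqP->].
  rewrite sumr_const mulr_natr le_eqVlt; apply/orP; left; apply/eqP; congr (_ *+ _).
  by apply: eq_card => g; rewrite !inE.
have step3 t h : t \in J -> h \in E ->
    #|[set g in D | g t == h]|%:R <= H ^+ #|J|.-1 * (L ^ L)%:R.
  move=> tJ hE.
  apply: le_trans (_ : (#|[set S in SS | (h \in S) && (#|S| == #|J|)]| * L ^ L)%:R <= _);
    last by rewrite natrM ler_wpM2r // SS_deg.
  rewrite ler_nat; apply: (card_le_fibres (phi := fun g : {ffun 'I_L -> X} => g @: J)).
    move=> g; rewrite inE => /andP[gD /eqP <-].
    have [[_ _ gS gJ] _] := DP g gD.
    by rewrite inE gS gJ eqxx andbT; exact: imset_f.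
  move=> S; rewrite inE => /and3P[_ _ /eqP SJ].
  apply: leq_trans (_ : #|pffun_on x0 (mem J) (mem S)| <= _)%N.
    apply/subset_leq_card/subsetP => g; rewrite !inE => /andP[/andP[gD _] /eqP gS].
    have [_ gN] := DP g gD.
    apply/pffun_onP; split.
      by apply/subsetP => i; rewrite !inE; apply: contraNT => /gN->.
    by move=> y /imageP[i iJ ->]; rewrite -gS; exact: imset_f.
  rewrite card_pffun_on SJ.
  have JL : (#|J| <= L)%N by rewrite -[leqRHS]card_ord max_card.
  apply: leq_trans (_ : L ^ #|J| <= _)%N; first by rewrite leq_exp2r // ltnW.
  by rewrite leq_exp2l //; move: Ll l1; nat_lia.
apply: le_trans step2 _.
apply: (@le_trans _ _ (\sum_(t in J) \sum_(h in E) c * mu h * (H ^+ #|J|.-1 * (L ^ L)%:R))).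
  apply: ler_sum => t tJ; apply: ler_sum => h hE.
  by rewrite ler_wpM2l ?step3 // mulr_ge0 ?mu_ge0.
under eq_bigr do rewrite -mulr_suml -mulr_sumr sum_mu_all.
rewrite sumr_const -[leLHS]mulr_natl.
have e : c * T * (H ^+ #|J|.-1 * (L ^ L)%:R) =
   (L ^ L)%:R * ((H * alpha * r) ^+ #|J|.-1 * kappa) / delta * T.
  by rewrite /c j1 /= !exprMn exprS; field; rewrite !lt0r_neq0.
rewrite e [(L ^ L.+1)%N]expnS natrM -!mulrA ler_pM //.
- by do ?[apply: mulr_ge0 | apply: exprn_ge0]; rewrite ?invr_ge0 //; apply: ltW.
- by rewrite ler_nat -[leqRHS]card_ord max_card.
rewrite ler_wpM2l // !mulrA ler_wpM2r ?(ltW T0) // ler_wpM2r ?invr_ge0 ?(ltW delta0) //.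
case e0: (#|J|.-1) => [|j]; first by move: J1; rewrite j1 e0.
rewrite exprS -!mulrA ler_wpM2l // ler_wpM2l ?(ltW alpha0) // ler_wpM2l ?(ltW r0) //.
rewrite ler_piMl ?(ltW kappa0) //.
rewrite exprn_ile1 //; first by rewrite !mulr_ge0 // ltW.
by apply: le_trans Har; rewrite !mulrA ler_peMr // !mulr_ge0 // ltW.
Qed.

End Key.

(** [Bext] is meant for the walks that fail for reasons not visible in the two chosen
    coordinates. *)
Theorem good_walk_exists (SS : {set {set X}}) (Bext : {set {ffun 'I_L -> X}}) :
  0 <= H ->
  (forall h j, h \in E -> (1 < j)%N ->
    #|[set S in SS | (h \in S) && (#|S| == j)]|%:R <= H ^+ j.-1) ->
  H * alpha * r * kappa * (192 * 2 ^ L * L ^ L.+2)%:R <= 1 ->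
  (8 * L ^ 2)%:R * (n%:R * varpi ^+ 2) <= zeta ->
  (4 * #|Bext| <= #|Z|)%N ->
  exists f, [/\ f \in Z, f \notin Bext,
    forall i i' : 'I_L, (i < i')%N -> node i (f i) != node i' (f i')
    & forall J : {set 'I_L}, (1 < #|J|)%N -> #|f @: J| = #|J| -> f @: J \notin SS].
Proof.
move=> H0 SS_deg Hsmall coll BZ.
(* The defects weigh at most [T / 8] (light edges), [T / 8] (collisions), [T / 4] ([Bext]) and
   [T / 8] (forbidden sets), less than [T] together. This [delta] achieves the first bound, and the
   constant 192 of the last one is [8 * 24]. *)
pose delta : R := (24 * L)%:R^-1.
have delta0 : 0 < delta by rewrite invr_gt0 ltr0n.
pose A1 := [set f in Z | [exists i, ~~ heavy delta (f i)]].
pose A2 (p : 'I_L * 'I_L) := [set f in Z | node p.1 (f p.1) == node p.2 (f p.2)].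
pose A4 := bad_walks delta SS.
pose U := A1 :|: (\bigcup_(p : 'I_L * 'I_L | (p.1 < p.2)%N) A2 p) :|: Bext :|:
  \bigcup_(J : {set 'I_L} | (1 < #|J|)%N) A4 J.
have [/subsetP ZU|/subsetPn[f fZ]] := boolP (Z \subset U); last first.
  rewrite !in_setU !negb_or -!andbA => /and4P[f1 f2 f3 f4]; exists f; split=> //.
    move=> i i' ii'; apply: contra f2 => e; apply/bigcupP; exists (i, i') => //=.
    by rewrite inE fZ.
  move=> J J1 fJ; apply: contra f4 => fS; apply/bigcupP; exists J => //.
  rewrite inE fZ fS fJ eqxx !andbT /=; apply/forall_inP => i _.
  by move: f1; rewrite inE fZ /= negb_exists => /forallP/(_ i); rewrite negbK.
exfalso.
have L0 : 0 < L%:R :> R by rewrite ltr0n.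
have cardU : (#|Z| <= #|A1| + \sum_(p : 'I_L * 'I_L | (p.1 < p.2)%N) #|A2 p| + #|Bext| +
    \sum_(J : {set 'I_L} | (1 < #|J|)%N) #|A4 J|)%N.
  apply: leq_trans (subset_leq_card (introT subsetP ZU)) _.
  apply: leq_trans (leq_card_setU _ _) _; apply: leq_add; last exact: card_bigcup_le.
  apply: leq_trans (leq_card_setU _ _) _; rewrite leq_add2r.
  apply: leq_trans (leq_card_setU _ _) _; rewrite leq_add2l; exact: card_bigcup_le.
have h1 : alpha ^+ L * #|A1|%:R <= T / 8.
  apply: le_trans (light_walks delta0) _.
  rewrite /delta natrM; move: L%:R L0 => x x0.
  by rewrite le_eqVlt; apply/orP; left; apply/eqP; field; rewrite lt0r_neq0.
have h2 : alpha ^+ L * (\sum_(p : 'I_L * 'I_L | (p.1 < p.2)%N) #|A2 p|)%:R <= T / 8.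
  rewrite natr_sum mulr_sumr.
  apply: (@le_trans _ _ (\sum_(p : 'I_L * 'I_L) n%:R * varpi ^+ 2)).
    rewrite big_mkcond; apply: ler_sum => -[i i'] _ /=; case: ifP => [ii'|_].
      exact: collision_walks.
    by rewrite mulr_ge0 ?exprn_ge0.
  rewrite sumr_const card_prod card_ord -[X in X <= _]mulr_natl ler_pdivlMr //.
  apply: le_trans T_ge; apply: le_trans coll.
  have -> : (8 * L ^ 2)%:R = (L * L)%:R * 8 :> R by rewrite -natrM mulnC mulnn.
  by rewrite mulrAC.
have h3 : alpha ^+ L * #|Bext|%:R <= T / 4.
  rewrite ler_pdivlMr // -card_Z -mulrA ler_pM2l // -natrM ler_nat mulnC.
  exact: BZ.
have kap : H * alpha * r * kappa <= 1.
  have big : 1 <= (192 * 2 ^ L * L ^ L.+2)%:R :> R.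
    by rewrite ler1n muln_gt0 muln_gt0 expn_gt0 expn_gt0.
  have nn : 0 <= H * alpha * r * kappa.
    by rewrite !mulr_ge0 ?(ltW alpha0) ?(ltW kappa0) //; apply: le_trans r1.
  by apply: le_trans Hsmall; apply: ler_peMr.
have h4 : alpha ^+ L * (\sum_(J : {set 'I_L} | (1 < #|J|)%N) #|A4 J|)%:R <= T / 8.
  rewrite natr_sum mulr_sumr.
  pose c := (L ^ L.+1)%:R * (H * alpha * r * kappa) / delta * T.
  have c0 : 0 <= c.
    rewrite /c !mulr_ge0 ?invr_ge0 ?(ltW alpha0) ?(ltW kappa0) ?(ltW T0) ?(ltW delta0) //.
    by apply: le_trans r1.
  apply: (@le_trans _ _ (\sum_(J : {set 'I_L}) c)).
    rewrite big_mkcond; apply: ler_sum => J _ /=; case: ifP => [J1|//].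
    exact: bad_walks_le.
  rewrite sumr_const; have -> : #|{: {set 'I_L}}| = (2 ^ L)%N.
    by rewrite -cardsT -powersetT card_powerset cardsT card_ord.
  rewrite -[X in X <= _]mulr_natl /c.
  rewrite ler_pdivlMr // -[leRHS]mul1r.
  have -> : (2 ^ L)%:R * ((L ^ L.+1)%:R * (H * alpha * r * kappa) / delta * T) * 8 =
    (H * alpha * r * kappa * (192 * 2 ^ L * L ^ L.+2)%:R) * T.
    have -> : (L ^ L.+2 = L * L ^ L.+1)%N by rewrite expnS.
    rewrite /delta; move: (L ^ L.+1)%N (2 ^ L)%N => y z; rewrite !natrM.
    by move: L%:R L0 => x x0; field; rewrite lt0r_neq0.
  by rewrite ler_wpM2r // ltW.
move: cardU; rewrite -(ler_nat R) -(ler_pM2l aL) !natrD !mulrDr card_Z => cU.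
have := T0; lra.
Qed.

End Core.

(** * Edges as tuples of vertices *)

Section Coordinates.
Local Open Scope nat_scope.
Variables (n' r : nat).
Local Notation n := n'.+1.

Definition coord (i : 'I_r) (e : {set 'I_n}) : 'I_n := nth ord0 (enum e) i.

Lemma coord_mem (e : {set 'I_n}) (i : 'I_r) : #|e| = r -> coord i e \in e.
Proof. by move=> er; rewrite -mem_enum mem_nth // -cardE er. Qed.

Lemma coord_inj (e : {set 'I_n}) : #|e| = r -> injective (fun i : 'I_r => coord i e).
Proof.
move=> er i j /eqP; rewrite /coord nth_uniq ?enum_uniq -?cardE ?er // => /eqP.
exact: val_inj.
Qed.

Lemma coord_image (e : {set 'I_n}) : #|e| = r -> [set coord i e | i : 'I_r] = e.
Proof.
move=> er; apply/eqP; rewrite eqEcard; apply/andP; split.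
  by apply/subsetP => x /imsetP[i _ ->]; exact: coord_mem.
by rewrite card_imset ?card_ord ?er //; exact: coord_inj.
Qed.

Lemma coord_det (e e' : {set 'I_n}) : #|e| = r -> #|e'| = r ->
  (forall i : 'I_r, coord i e = coord i e') -> e = e'.
Proof.
move=> er er' h; rewrite -(coord_image er) -(coord_image er').
by apply: eq_imset => i; exact: h.
Qed.

End Coordinates.

(** * Regularization of degrees and codegrees *)

Section Regularization.
Local Open Scope nat_scope.
Variables (n' r : nat) (X : finType) (co : 'I_r -> X -> 'I_n'.+1).
Local Notation n := n'.+1.

Definition proj (c : 'I_r) (f : X) : {ffun 'I_r -> 'I_n} :=
  [ffun i => if i == c then ord0 else co i f].

Lemma card_proj (c : 'I_r) (F : {set X}) : #|proj c @: F| <= n ^ r.-1.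
Proof.
apply: leq_trans (_ : #|pffun_on ord0 (predC1 c) (predT : pred 'I_n)| <= _).
  apply/subset_leq_card/subsetP => _ /imsetP[f _ ->]; apply/pffun_onP; split=> //.
  by apply/subsetP => i; rewrite !inE ffunE; case: (i == c) => //; rewrite eqxx.
by rewrite card_pffun_on cardC1 !card_ord.
Qed.

Definition full (q : nat) (F : {set X}) :=
  forall f c, f \in F -> q <= #|[set g in F | proj c g == proj c f]|.

(* Deleting a sparse class of a projection decreases the functional that the
   chosen subfamily minimizes. *)
Lemma full_subfamily (q : nat) (F0 : {set X}) :
  exists F : {set X}, [/\ F \subset F0, full q F & #|F0| <= #|F| + q * (r * n ^ r.-1)].
Proof.
pose Psi (F : {set X}) := q * \sum_(c < r) #|proj c @: F| + #|F0 :\: F|.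
have [F FF0 Fmin] := @arg_minnP _ F0 (fun F : {set X} => F \subset F0) Psi (subxx F0).
exists F; split=> //.
  move=> f c fF; rewrite leqNgt; apply/negP => small.
  set C := [set g in F | proj c g == proj c f] in small.
  have CF : C \subset F by apply/subsetP => g; rewrite inE => /andP[].
  have := Fmin _ (subset_trans (subsetDl F C) FF0); rewrite leqNgt => /negP; apply.
  have mono c' : #|proj c' @: (F :\: C)| <= #|proj c' @: F|.
    by apply/subset_leq_card/imsetS; exact: subsetDl.
  have drop : #|proj c @: (F :\: C)| < #|proj c @: F|.
    apply/proper_card/properP; split; first by apply/imsetS; exact: subsetDl.
    exists (proj c f); first exact: imset_f.
    by apply/imsetP => -[g]; rewrite !inE => /andP[gC gF] e; move: gC; rewrite gF /= e eqxx.
  have sum_lt : \sum_(c' < r) #|proj c' @: (F :\: C)| < \sum_(c' < r) #|proj c' @: F|.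
    rewrite (bigD1 c) //= [ltnRHS](bigD1 c) //=.
    by rewrite -addSn leq_add // leq_sum.
  have eD : #|F0 :\: (F :\: C)| <= #|F0 :\: F| + #|C|.
    apply: leq_trans (leq_card_setU _ _); apply/subset_leq_card/subsetP => g.
    by rewrite !inE; case: (g \in F); case: (g \in F0); case: (_ == _).
  rewrite /Psi; apply: leq_ltn_trans (leq_add (leqnn _) eD) _.
  have := leq_mul (leqnn q) sum_lt; rewrite mulnS; move: (q * _) (q * _) => x y h.
  by nat_lia.
(* Comparing the minimizer with [F0] itself bounds the number of deleted edges. *)
have := Fmin _ (subxx F0); rewrite /Psi setDv cards0 addn0 => h.
rewrite -(cardsID F F0) (setIidPr FF0) leq_add2l.
apply: leq_trans (leq_trans (leq_addl _ _) h) _; rewrite leq_mul2l; apply/orP; right.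
apply: leq_trans (_ : \sum_(c < r) n ^ r.-1 <= _); last by rewrite sum_nat_const card_ord.
by apply: leq_sum => c _; exact: card_proj.
Qed.

Variable E0 : {set X}.
Hypothesis det : forall f g, f \in E0 -> g \in E0 -> (forall i, co i f = co i g) -> f = g.

Definition codeg (i j : 'I_r) (x y : 'I_n) : nat :=
  #|[set f in E0 | (co i f == x) && (co j f == y)]|.

Lemma codeg_gt0 f i j : f \in E0 -> 0 < codeg i j (co i f) (co j f).
Proof. by move=> fE; rewrite card_gt0; apply/set0Pn; exists f; rewrite inE fE !eqxx. Qed.

Lemma sum_codeg i j x : \sum_y codeg i j x y = codeg i i x x.
Proof.
rewrite /codeg -sum1_card (partition_big (co j) xpredT) //=; apply: eq_bigr => y _.
rewrite -sum1_card; apply: eq_bigl => f; rewrite !inE.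
by case: (f \in E0); case: (co i f == x); case: (co j f == y).
Qed.

Lemma sum_codeg_diag i : \sum_x codeg i i x x = #|E0|.
Proof.
rewrite -[RHS]sum1_card (partition_big (co i) xpredT) //=; apply: eq_bigr => x _.
by rewrite /codeg -sum1_card; apply: eq_bigl => f; rewrite !inE andbb.
Qed.

(** Pigeonhole on the dyadic sizes of all [r * r] codegrees of an edge, where [codeg i i] is a
    degree. They are measured in [E0], so passing to subfamilies later preserves these sizes. *)
Lemma popular_type (t : nat) : #|E0| < 2 ^ t.+1 ->
  exists (E1 : {set X}) (w : 'I_r -> 'I_r -> nat),
    [/\ E1 \subset E0, #|E0| <= t.+1 ^ (r * r) * #|E1| &
      forall f i j, f \in E1 ->
        2 ^ w i j <= codeg i j (co i f) (co j f) < 2 ^ (w i j).+1].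
Proof.
move=> E0t.
pose ty f : {ffun 'I_r * 'I_r -> 'I_t.+1} :=
  [ffun p => inord (trunc_log 2 (codeg p.1 p.2 (co p.1 f) (co p.2 f)))].
pose fib s := #|[set f in E0 | ty f == s]|.
have [s _ smax] := @arg_maxnP _ [ffun=> ord0] xpredT fib isT.
exists [set f in E0 | ty f == s], (fun i j : 'I_r => nat_of_ord ((s : {ffun 'I_r * 'I_r -> 'I_t.+1}) (i, j))); split.
- by apply/subsetP => f; rewrite inE => /andP[].
- have := @card_le_fibres _ _ E0 [set: {ffun 'I_r * 'I_r -> 'I_t.+1}] ty (fib s).
  rewrite cardsT card_ffun card_prod !card_ord; apply; first by move=> *; rewrite inE.
  by move=> s' _; exact: smax.
move=> f i j; rewrite inE => /andP[fE /eqP<-]; rewrite ffunE /=.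
have cd := codeg_gt0 i j fE.
have cE : codeg i j (co i f) (co j f) <= #|E0|.
  by apply/subset_leq_card/subsetP => g; rewrite inE => /andP[].
rewrite inordK; last first.
  rewrite ltnS -ltnS -(ltn_exp2l _ _ (ltnSn 1)).
  by apply: leq_ltn_trans E0t; apply: leq_trans cE; exact: trunc_logP.
by rewrite trunc_logP // trunc_log_ltn.
Qed.

(** In a largest star at coordinate [b], let [a] be the other coordinate with the most values and
    [d] the number of these. The remaining coordinates determine an edge of the star, so it has at
    most [d ^ r.-1] edges. Each of the [d] values accounts for at least [2 ^ w a b] edges at the
    centre, so the degree exceeds the codegree by a factor [d], up to a constant. *)
Lemma star_bound (E1 : {set X}) (w : 'I_r -> 'I_r -> nat) (b : 'I_r) :
  1 < r -> E1 \subset E0 -> 0 < #|E1| ->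
  (forall f i j, f \in E1 ->
     2 ^ w i j <= codeg i j (co i f) (co j f) < 2 ^ (w i j).+1) ->
  exists2 a, a != b & exists d, [/\ #|E1| <= n * d ^ r.-1 &
    d * 2 ^ w a b <= 2 ^ (w b b).+1].
Proof.
move=> r1 E10 E1_gt0 wP.
pose star x := [set f in E1 | co b f == x].
have [x _ xmax] := @arg_maxnP _ ord0 xpredT (fun x => #|star x|) isT.
have E1x : #|E1| <= n * #|star x|.
  have := @card_le_fibres _ _ E1 [set: 'I_n] (co b) #|star x|.
  rewrite cardsT card_ord; apply; first by move=> *; rewrite inE.
  by move=> y _; exact: xmax.
pose N j := [set co j f | f in star x].
have [a0 a0b] : exists a0, a0 != b.
  pose i0 : 'I_r := Ordinal (ltnW r1); pose i1 : 'I_r := Ordinal r1.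
  exists (if b == i0 then i1 else i0).
  by case: ifP => [/eqP->|/negbT]; rewrite // eq_sym.
have [a ab amax] := @arg_maxnP _ a0 (fun a => a != b) (fun a => #|N a|) a0b.
exists a => //; exists #|N a|; split.
  apply: leq_trans E1x _; rewrite leq_mul2l; apply/orP; right.
  have inj : {in star x &, injective (fun f => [ffun j => co j f] : {ffun 'I_r -> 'I_n})}.
    move=> f g; rewrite !inE => /andP[fE _] /andP[gE _] /ffunP e.
    apply: det; rewrite ?(subsetP E10) // => i; by have := e i; rewrite !ffunE.
  rewrite -(card_in_imset inj).
  pose fam j := if j == b then [set x] else N j.
  apply: leq_trans (_ : #|family (fun j => mem (fam j))| <= _).
    apply/subset_leq_card/subsetP => _ /imsetP[f fS ->]; apply/familyP => j.
    rewrite ffunE; suff : co j f \in fam j by [].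
    rewrite /fam; case: eqP => [->|_]; last exact: imset_f.
    by move: fS; rewrite !inE => /andP[_].
  rewrite card_family foldrE big_image /= (bigD1 b) //= /fam eqxx cards1 mul1n.
  apply: leq_trans (_ : \prod_(j < r | j != b) #|N a| <= _).
    by apply: leq_prod => j jb; rewrite (negbTE jb); exact: amax.
  by rewrite prod_nat_const (eq_card (B := predC1 b)) ?cardC1 ?card_ord.
have [N0|[y0 y0N]] := set_0Vmem (N a); first by rewrite N0 cards0.
have [f0 f0S _] := imsetP y0N.
have f0E : f0 \in E1 by move: f0S; rewrite inE => /andP[].
have f0x : co b f0 = x by move: f0S; rewrite inE => /andP[_ /eqP].
apply: leq_trans (_ : codeg b b x x <= _).
  rewrite -(sum_codeg b a) -sum_nat_const.
  apply: leq_trans (_ : \sum_(y in N a) codeg b a x y <= _).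
    apply: leq_sum => y /imsetP[f fS ->].
    have fE : f \in E1 by move: fS; rewrite inE => /andP[].
    have fx : co b f = x by move: fS; rewrite inE => /andP[_ /eqP].
    have /andP[h _] := wP f a b fE; apply: leq_trans h _.
    rewrite -fx; apply/subset_leq_card/subsetP => g.
    by rewrite !inE => /and3P[-> -> ->].
  by rewrite big_mkcond; apply: leq_sum => y _; case: (y \in N a).
by have /andP[_ /ltnW] := wP f0 b b f0E; rewrite f0x.
Qed.

(** [b] is chosen with the smallest degree, so that codegrees are small even compared with the
    smaller bound [Lb]. In [E2] degrees are only bounded above, but every value that still occurs
    has degree at least [La / 2] or [Lb / 2] in [E0], which limits the number of values. *)
Theorem regularize (t q : nat) : 1 < r -> 0 < #|E0| -> #|E0| < 2 ^ t.+1 ->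
  exists (a b : 'I_r) (E2 : {set X}) (La Lb d : nat),
    [/\ a != b, E2 \subset E0, full q E2
      & #|E0| <= t.+1 ^ (r * r) * (#|E2| + q * (r * n ^ r.-1))] /\
    [/\ #|E0| <= t.+1 ^ (r * r) * (n * d ^ r.-1), 0 < Lb <= La,
        forall x, #|[set f in E2 | co a f == x]| <= La,
        forall y, #|[set f in E2 | co b f == y]| <= Lb
      & forall x y, #|[set f in E2 | (co a f == x) && (co b f == y)]| * d <= 2 * Lb] /\
    [/\ #|co a @: E2| * La <= 2 * #|E0| & #|co b @: E2| * Lb <= 2 * #|E0|].
Proof.
move=> r1 E0_gt0 E0t.
have [E1 [w [E10 E1P wP]]] := popular_type E0t.
have E1_gt0 : 0 < #|E1|.
  by rewrite lt0n; apply/eqP => e; move: E1P E0_gt0; rewrite e muln0 leqn0 => /eqP->.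
pose i0 : 'I_r := Ordinal (ltnW r1).
have [b _ bmin] := @arg_minnP _ i0 xpredT (fun i => w i i) isT.
have [a ab [d [E1d dw]]] := star_bound b r1 E10 E1_gt0 wP.
have [E2 [E21 E2f E2c]] := full_subfamily q E1.
have E20 := subset_trans E21 E10.
have deg_le i x : #|[set f in E2 | co i f == x]| <= 2 ^ (w i i).+1.
  have [->|[f]] := set_0Vmem [set f in E2 | co i f == x]; first by rewrite cards0.
  rewrite inE => /andP[fE /eqP fx]; have /andP[_ /ltnW h] := wP f i i (subsetP E21 _ fE).
  apply: leq_trans h; apply/subset_leq_card/subsetP => g; rewrite !inE fx.
  by move=> /andP[gE ->]; rewrite (subsetP E20).
have supp i : #|co i @: E2| * 2 ^ (w i i).+1 <= 2 * #|E0|.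
  rewrite expnS mulnCA leq_mul2l /= -(sum_codeg_diag i) -sum_nat_const.
  apply: leq_trans (_ : \sum_(x in co i @: E2) codeg i i x x <= _).
    apply: leq_sum => x /imsetP[f fE ->].
    by have /andP[] := wP f i i (subsetP E21 _ fE).
  by rewrite big_mkcond; apply: leq_sum => y _; case: (y \in _).
exists a, b, E2, (2 ^ (w a a).+1), (2 ^ (w b b).+1), d; split; split=> //.
- by apply: leq_trans E1P _; rewrite leq_mul2l E2c orbT.
- split=> //.
  + by apply: leq_trans E1P _; rewrite leq_mul2l E1d orbT.
  + by rewrite expn_gt0 /= leq_exp2l // ltnS; exact: bmin.
  + move=> x y; have [->|[f]] := set_0Vmem [set f in E2 | (co a f == x) && (co b f == y)].
      by rewrite cards0.
    rewrite inE => /and3P[fE /eqP fx /eqP fy].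
    have /andP[_ /ltnW h] := wP f a b (subsetP E21 _ fE).
    apply: leq_trans (_ : 2 ^ (w a b).+1 * d <= _).
      rewrite leq_mul2r; apply/orP; right; apply: leq_trans h.
      apply/subset_leq_card/subsetP => g; rewrite !inE fx fy.
      by move=> /and3P[gE -> ->]; rewrite (subsetP E20).
    by rewrite expnS -mulnA leq_mul2l /= mulnC.
Qed.

End Regularization.

(** * From closed walks to linear cycles *)

Section CycleCopy.
Local Open Scope nat_scope.
Variables (n' r m : nat) (X : finType) (co : 'I_r -> X -> 'I_n'.+1).
Local Notation n := n'.+1.
Local Notation L := m.+1.
Variables (E0 E : {set X}) (a b : 'I_r).
Hypothesis det : forall f g, f \in E0 -> g \in E0 -> (forall i, co i f = co i g) -> f = g.
Hypothesis EE0 : E \subset E0.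
Hypothesis m_odd : odd m.
Local Notation Z := (closed_walks m E (co a) (co b)).
Local Notation node := (walk_node (co a) (co b)).

Definition clash (i i' : 'I_L) (c c' : 'I_r) : {set {ffun 'I_L -> X}} :=
  [set f in Z | co c (f i) == co c' (f i')].

(* A clash leaves a single choice for the coordinate c of f i, whereas fullness
   provides q choices which all lead to closed walks. *)
Lemma clash_le (q : nat) (i i' : 'I_L) (c c' : 'I_r) :
  full co q E -> i != i' -> c != a -> c != b -> #|clash i i' c c'| * q <= #|Z|.
Proof.
move=> fullE ii' ca cb.
pose rep f := [set g in E | proj co c g == proj co c (f i)] : {set X}.
pose P := [set p : {ffun 'I_L -> X} * X | (p.1 \in clash i i' c c') && (p.2 \in rep p.1)].
have PE : #|clash i i' c c'| * q <= #|P|.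
  rewrite -sum_nat_const.
  apply: leq_trans (_ : \sum_(f in clash i i' c c') \sum_(g in rep f) 1 <= _).
    apply: leq_sum => f; rewrite !inE => /andP[/andP[/forallP fE _] _].
    by rewrite sum1_card; exact: fullE.
  rewrite pair_big_dep /= sum1_card; apply/eq_leq/eq_card => p.
  by rewrite [in RHS]inE.
apply: leq_trans PE _.
pose upd (p : {ffun 'I_L -> X} * X) : {ffun 'I_L -> X} :=
  [ffun k => if k == i then p.2 else p.1 k].
have coE p k : p \in P -> k != c -> co k p.2 = co k (p.1 i).
  rewrite !inE => /and3P[_ _ /eqP/ffunP/(_ k)] e kc; move: e.
  by rewrite !ffunE (negbTE kc).
have inj : {in P &, injective upd}.
  move=> [f g] [f1 g1] pP p1P /ffunP e.
  have eg : g = g1 by have := e i; rewrite !ffunE eqxx.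
  have ek k : k != i -> f k = f1 k by move=> /negbTE ki; have := e k; rewrite !ffunE ki.
  have fi : f i = f1 i.
    have fZ : f i \in E by move: pP; rewrite !inE => /and3P[/andP[/andP[/forallP h _] _] _ _].
    have f1Z : f1 i \in E by move: p1P; rewrite !inE => /and3P[/andP[/andP[/forallP h _] _] _ _].
    apply: det; rewrite ?(subsetP EE0) // => k.
    have [->|kc] := eqVneq k c; last by rewrite -(coE _ _ pP kc) -(coE _ _ p1P kc) /= eg.
    have c1 : co c (f i) = co c' (f i') by move: pP; rewrite !inE => /and3P[/andP[_ /eqP]].
    have c2 : co c (f1 i) = co c' (f1 i') by move: p1P; rewrite !inE => /and3P[/andP[_ /eqP]].
    by rewrite c1 c2 ek // eq_sym.
  congr (_, _) => //; apply/ffunP => k.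
  by have [->|ki] := eqVneq k i; [exact: fi | exact: ek].
rewrite -(card_in_imset inj); apply/subset_leq_card/subsetP => _ /imsetP[p pP ->].
have nodeE j k : node j (upd p k) = node j (p.1 k).
  rewrite ffunE; case: eqP => [->|//].
  by rewrite /walk_node; case: odd; rewrite (coE p) // eq_sym.
have pZ : p.1 \in Z by move: pP; rewrite !inE => /and3P[/andP[]].
move: pZ; rewrite !inE /closed_walk => /andP[/forallP fE /forallP cf].
apply/andP; split; apply/forallP => k; last by rewrite !nodeE.
rewrite ffunE; case: ifP => _ //.
by move: pP; rewrite !inE => /and3P[_ ->].
Qed.

Definition clashes : {set {ffun 'I_L -> X}} :=
  \bigcup_(p : ('I_L * 'I_L) * ('I_r * 'I_r) |
     [&& p.1.1 != p.1.2, p.2.1 != a & p.2.1 != b]) clash p.1.1 p.1.2 p.2.1 p.2.2.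

(** There are at most [(L * r) ^ 2] kinds of clashes, and fullness makes each of them rarer than all
    closed walks by a factor [4 * (L * r) ^ 2]. *)
Lemma clashes_le : full co (4 * (L * r) ^ 2) E -> 0 < r -> 4 * #|clashes| <= #|Z|.
Proof.
move=> fullE r0.
have N0 : 0 < (L * r) ^ 2 by rewrite expn_gt0 muln_gt0 r0.
rewrite -(leq_pmul2r N0).
apply: leq_trans (_ : \sum_(p : ('I_L * 'I_L) * ('I_r * 'I_r) |
   [&& p.1.1 != p.1.2, p.2.1 != a & p.2.1 != b])
   #|clash p.1.1 p.1.2 p.2.1 p.2.2| * (4 * (L * r) ^ 2) <= _).
  rewrite -big_distrl /= [4 * #|_|]mulnC -mulnA leq_mul2r.
  by rewrite card_bigcup_le orbT.
apply: leq_trans (_ : \sum_(p : ('I_L * 'I_L) * ('I_r * 'I_r)) #|Z| <= _).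
  rewrite big_mkcond; apply: leq_sum => p _; case: ifP => // /and3P[h1 h2 h3].
  exact: clash_le.
rewrite sum_nat_const !card_prod !card_ord mulnC leq_mul2l.
by apply/orP; right; rewrite expnS expn1 mulnACA.
Qed.

Section Embed.
Hypothesis ab : a != b.
Hypothesis co_inj : forall f, f \in E -> injective (fun i => co i f).
Variable f : {ffun 'I_L -> X}.
Hypothesis fZ : f \in Z.
Hypothesis fclash : f \notin clashes.
Hypothesis fnode : forall i i' : 'I_L, i < i' -> node i (f i) != node i' (f i').

Let fE i : f i \in E.
Proof. by move: fZ; rewrite inE => /andP[/forallP]. Qed.

Let no_clash i i' c c' : i != i' -> c != a -> c != b -> co c (f i) != co c' (f i').
Proof.
move=> ii' ca cb; apply: contra fclash => e.
by apply/bigcupP; exists ((i, i'), (c, c')); rewrite /= ?ii' ?ca ?cb // inE fZ.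
Qed.

Let side (j : nat) : 'I_r := if odd j then b else a.

Let nodeE j g : node j g = co (side j) g.
Proof. by rewrite /walk_node /side; case: odd. Qed.

Lemma card_others : #|~: [set a; b]| = r - 2.
Proof. by rewrite cardsCs setCK cards2 ab card_ord. Qed.

Definition other (j : 'I_(r - 2)) : 'I_r := enum_val (cast_ord (esym card_others) j).

Lemma other_inj : injective other.
Proof. by move=> i j /enum_val_inj/cast_ord_inj. Qed.

Lemma otherP j : other j != a /\ other j != b.
Proof.
have := enum_valP (cast_ord (esym card_others) j); rewrite !inE negb_or => /andP.
by [].
Qed.

Lemma other_surj c : c != a -> c != b -> exists j, c = other j.
Proof.
move=> ca cb; have cI : c \in ~: [set a; b] by rewrite !inE negb_or ca cb.
exists (cast_ord card_others (enum_rank_in cI c)).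
by rewrite /other cast_ord_comp cast_ord_id enum_rankK_in.
Qed.

Definition cycle_embedding (x : linear_cycle_vertex L r) : 'I_n :=
  match x with
  | inl i => node i (f i)
  | inr p => co (other p.2) (f p.1)
  end.

Lemma cycle_embedding_inj : injective cycle_embedding.
Proof.
have sideo j k : other k != side j by rewrite /side; case: odd; case: (otherP k).
move=> [i|[i j]] [i'|[i' j']] /= e.
- congr inl; apply/eqP; apply: contraTT isT => ne.
  by move: ne; rewrite neq_ltn => /orP[/fnode|/fnode]; rewrite e eqxx.
- exfalso; move: e; rewrite nodeE => /esym/eqP.
  have [->|ne] := eqVneq i i'; first by rewrite (inj_eq (co_inj (fE i'))) (negbTE (sideo _ _)).
  by apply/negP; have [h1 h2] := otherP j'; apply: no_clash; rewrite // eq_sym.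
- exfalso; move: e; rewrite nodeE => /eqP.
  have [->|ne] := eqVneq i i'; first by rewrite (inj_eq (co_inj (fE i'))) (negbTE (sideo _ _)).
  by apply/negP; have [h1 h2] := otherP j; exact: no_clash.
have [ei|ne] := eqVneq i i'.
  by move: e; rewrite ei => /(co_inj (fE i'))/other_inj->.
by have [h1 h2] := otherP j; have := no_clash (other j') ne h1 h2; rewrite e eqxx.
Qed.

(** A repeated edge would clash with itself in a coordinate other than [a] and [b], and such a
    coordinate exists when [r > 2]. *)
Lemma walk_injective : 2 < r -> injective f.
Proof.
move=> r2 i i' e; apply/eqP; apply: contraTT isT => ne.
have j : 'I_(r - 2) by exists 0; rewrite subn_gt0.
by have [h1 h2] := otherP j; have := no_clash (other j) ne h1 h2; rewrite e eqxx.
Qed.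

Lemma cycle_embedding_edge (i : 'I_L) :
  cycle_embedding @: linear_cycle_edge r i = [set co k (f i) | k : 'I_r].
Proof.
(* Consistency makes the first node of the next edge a vertex of [f i]; at the last position this
   relies on even length, which puts node [L] on the side of node 0. *)
have next : cycle_embedding (inl (ordS i)) = co (side i.+1) (f i).
  rewrite /= -nodeE.
  have -> : node (i.+1 %% L) (f (ordS i)) = node i.+1 (f (ordS i)).
    have [iL|Li] := ltnP i.+1 L; first by rewrite modn_small.
    have -> : i.+1 = L by apply/eqP; rewrite eqn_leq Li ltn_ord.
    by rewrite modnn -(node_add (m := m)) // add0n.
  by move: fZ; rewrite inE => /andP[_ /forallP/(_ i)/eqP].
have two k : k = a \/ k = b -> k = side i \/ k = side i.+1.
  by rewrite /side /=; case: odd => /=; tauto.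
apply/setP => x; apply/imsetP/imsetP.
  move=> [y]; rewrite !inE -orbA => /or3P[/eqP->|/eqP->|/imsetP[j _ ->]] ->.
  - by exists (side i); rewrite // /cycle_embedding nodeE.
  - by exists (side i.+1).
  - by exists (other j).
move=> [k _ ->].
have [kab|] := boolP ((k == a) || (k == b)).
  have : k = side i \/ k = side i.+1.
    by apply: two; move/orP: kab => [/eqP->|/eqP->]; [left|right].
  move=> [->|->].
    by exists (inl i); rewrite ?inE ?eqxx // /cycle_embedding nodeE.
  by exists (inl (ordS i)); rewrite ?inE ?eqxx ?orbT.
rewrite negb_or => /andP[ka kb]; have [j ->] := other_surj ka kb.
exists (inr (i, j)) => //; rewrite !inE; apply/orP; right; exact: imset_f.
Qed.

End Embed.
End CycleCopy.


(** * A linear cycle that avoids a sparse family of forbidden sets *)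

Section Unsaturated.
Variables (R : rcfType) (n' r m l : nat).
Local Notation n := n'.+1.
Local Notation L := m.+1.
Hypotheses (r4 : (4 <= r)%N) (l1 : (1 < l)%N) (Ll : L = (l + l)%N) (n3 : (3 <= n)%N).

Let m_odd : odd m.
Proof. by have : odd L = false by [rewrite Ll oddD addbb]; rewrite /= => /negbFE. Qed.

Variables (G : {set {set 'I_n}}) (t : nat).
Hypothesis Gr : forall e, e \in G -> #|e| = r.
Hypothesis Gt : (#|G| < 2 ^ t.+1)%N.
Let P := (t.+1 ^ (r * r))%N.
Let q := (4 * (L * r) ^ 2)%N.
Hypothesis Gbig : (2 * P * (q * (r * n ^ r.-1)) <= #|G|)%N.

(** The size of [G] forces [n ^ (r - 2) <= d ^ (r - 1)], and [2 (r - 1) <= 3 (r - 2)] because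
    [r >= 4]. Cubes keep the conclusion free of roots. *)
Lemma cube_bound (d : nat) : (#|G| <= P * (n * d ^ r.-1))%N -> (n ^ 2 <= d ^ 3)%N.
Proof.
move=> Gd.
have P0 : (0 < P)%N by rewrite expn_gt0.
have q0 : (0 < q)%N by rewrite muln_gt0 expn_gt0 muln_gt0 /= (leq_trans _ r4).
have h : (n ^ r.-2 <= d ^ r.-1)%N.
  have h1 : (P * n ^ r.-1 <= P * (n * d ^ r.-1))%N.
    apply: leq_trans Gd; apply: leq_trans Gbig.
    rewrite [(2 * P)%N]mulnC -mulnA leq_mul2l; apply/orP; right.
    apply: leq_trans (leq_pmull _ (leq_trans _ r4 : 0 < r)%N) _ => //.
    by apply: leq_trans (leq_pmull _ q0) _; exact: leq_pmull.
  move: h1; rewrite leq_mul2l (gtn_eqF P0) /=.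
  have -> : r.-1 = r.-2.+1 by move: r4; nat_lia.
  by rewrite [X in (X <= _)%N]expnS leq_mul2l.
rewrite leqNgt; apply/negP => d3.
have : ((n ^ r.-2) ^ 3 <= (d ^ 3) ^ r.-1)%N.
  by rewrite -[X in (_ <= X)%N]expnM mulnC expnM leq_exp2r.
rewrite leqNgt => /negP; apply.
apply: (@leq_trans ((n ^ 2) ^ r.-1)).
  by rewrite ltn_exp2r //; move: r4; nat_lia.
rewrite -!expnM leq_exp2l //; move: r4; nat_lia.
Qed.

Variables (SS : {set {set {set 'I_n}}}) (H rho : R).
Hypothesis H0 : 0 <= H.
Hypothesis SS_deg : forall h j, h \in G -> (1 < j)%N ->
  #|[set S in SS | (h \in S) && (#|S| == j)]|%:R <= H ^+ j.-1.
Let zeta : R := ((4 * P)%:R ^+ L)^-1.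
Hypothesis rho1 : 1 <= rho.
(** [cond_interp] and [cond_sq] are the cubes of the conditions on [n * varpi] and [n * varpi ^+ 2]
    needed for the walks, with [varpi] replaced by its upper bound [2 n ^ (-2/3)]. *)
Hypothesis cond_interp : 8 * n%:R <= (zeta * rho ^+ l.-1) ^+ 3.
Hypothesis cond_full : n%:R <= zeta * rho ^+ m.
Hypothesis cond_sq : (8 * L ^ 2)%:R ^+ 3 * 64 <= zeta ^+ 3 * n%:R.
Hypothesis cond_H : H * rho * (192 * 2 ^ L * L ^ L.+2)%:R * n%:R * (2 * P)%:R <= #|G|%:R.

Lemma cube_le (x y : R) : 0 <= y -> x ^+ 3 <= y ^+ 3 -> x <= y.
Proof.
move=> y0; apply: contraTT; rewrite -!ltNge => yx.
by rewrite ltrXn2r // nnegrE ?y0 // (le_trans y0 (ltW yx)).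
Qed.

Theorem unsaturated_cycle :
  exists S : {set {set 'I_n}}, [/\ S \subset G, #|S| = L,
    contains_copy (linear_cycle L r) S &
    forall S' : {set {set 'I_n}}, S' \subset S -> (1 < #|S'|)%N -> S' \notin SS].
Proof.
have r1 : (1 < r)%N by exact: leq_trans r4.
have P0 : (0 < P)%N by rewrite expn_gt0.
have q0 : (0 < q)%N by rewrite muln_gt0 expn_gt0 muln_gt0 /= (leq_trans _ r4).
have G0 : (0 < #|G|)%N.
  by apply: leq_trans Gbig; rewrite muln_gt0 muln_gt0 P0 /= muln_gt0 q0 /= muln_gt0 expn_gt0 (ltnW r1).
have det f g : f \in G -> g \in G -> (forall i : 'I_r, coord i f = coord i g) -> f = g.
  by move=> /Gr fr /Gr gr; exact: coord_det.
have [a [b [E [La [Lb [d [[ab EG fullE Ebig] [[Gd /andP[Lb0 Lba] rowE colE entE] [SA SB]]]]]]]]] :=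
  regularize det q r1 G0 Gt.
rewrite -/P in Ebig Gd.
have d3 := cube_bound Gd.
pose na : {set 'I_n} -> 'I_n := coord a; pose nb : {set 'I_n} -> 'I_n := coord b.
have EG2 : (#|G| <= 2 * P * #|E|)%N.
  move: Ebig Gbig; rewrite mulnDr -!mulnA => e1 e2; move: e1 e2.
  by move: (P * #|E|)%N (P * _)%N => x y; nat_lia.
have E_gt0 : (0 < #|E|)%N.
  by rewrite lt0n; apply/eqP => e; move: EG2 G0; rewrite e muln0 leqn0 => /eqP->.
have d0 : (0 < d)%N.
  by rewrite lt0n; apply/eqP => e; move: d3; rewrite e.
have d2 : (2 <= d)%N.
  by move: d0 d3; rewrite leq_eqVlt => /orP[/eqP<-|//]; rewrite exp1n; move: n3; nia.
have dR : 0 < d%:R :> R by rewrite ltr0n.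
have LbR : 0 < Lb%:R :> R by rewrite ltr0n.
have LaR : 0 < La%:R :> R by rewrite ltr0n (leq_trans Lb0).
have nR : 0 < n%:R :> R by rewrite ltr0n.
have PR : 0 < P%:R :> R by rewrite ltr0n.
have eR : 0 < #|E|%:R :> R by rewrite ltr0n.
have GR : 0 < #|G|%:R :> R by rewrite ltr0n.
(* Normalizing by [alpha = (La * Lb) ^ (-1/2)] bounds the row sums by [kappa] and the column sums by
   [kappa^-1], where [kappa ^ 2 = La / Lb]. *)
pose sa : R := Num.sqrt La%:R; pose sb : R := Num.sqrt Lb%:R.
have sa0 : 0 < sa by rewrite sqrtr_gt0.
have sb0 : 0 < sb by rewrite sqrtr_gt0.
have sa2 : sa * sa = La%:R by rewrite -expr2 sqr_sqrtr // ltW.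
have sb2 : sb * sb = Lb%:R by rewrite -expr2 sqr_sqrtr // ltW.
pose alpha := (sa * sb)^-1; pose kappa := sa / sb; pose varpi : R := 2 / d%:R.
have alpha0 : 0 < alpha by rewrite invr_gt0 mulr_gt0.
have kappa1 : 1 <= kappa by rewrite ler_pdivlMr // mul1r ler_sqrt // ler_nat.
have kappa0 : 0 < kappa by exact: lt_le_trans kappa1.
have varpi0 : 0 <= varpi by rewrite divr_ge0 // ltW.
have varpi1 : varpi <= 1 by rewrite ler_pdivrMr // mul1r ler_nat.
have aLa : alpha * La%:R = kappa by rewrite -sa2 /alpha /kappa; field; rewrite !lt0r_neq0.
have aLb : alpha * Lb%:R = kappa^-1 by rewrite -sb2 /alpha /kappa; field; rewrite !lt0r_neq0.
have rowsum x : \sum_y weight_mx E na nb alpha x y = alpha * #|[set f in E | na f == x]|%:R.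
  under eq_bigr do rewrite mxE; rewrite -mulr_sumr -natr_sum; congr (_ * _%:R).
  rewrite -[RHS]sum1_card (partition_big nb xpredT) //=; apply: eq_bigr => y _.
  by rewrite -sum1_card; apply: eq_bigl => f; rewrite !inE andbA.
have colsum y : \sum_x weight_mx E na nb alpha x y = alpha * #|[set f in E | nb f == y]|%:R.
  under eq_bigr do rewrite mxE; rewrite -mulr_sumr -natr_sum; congr (_ * _%:R).
  rewrite -[RHS]sum1_card (partition_big na xpredT) //=; apply: eq_bigr => x _.
  by rewrite -sum1_card; apply: eq_bigl => f; rewrite !inE -andbA; congr (_ && _); rewrite andbC.
have row_le x : \sum_y weight_mx E na nb alpha x y <= kappa.
  by rewrite rowsum -aLa ler_pM2l // ler_nat.
have col_le y : \sum_x weight_mx E na nb alpha x y <= kappa^-1.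
  by rewrite colsum -aLb ler_pM2l // ler_nat.
have entry_le x y : weight_mx E na nb alpha x y <= varpi / kappa.
  rewrite mxE -aLb mulrCA ler_pM2l // /varpi mulrAC ler_pdivlMr // -!natrM ler_nat.
  exact: entE.
have zeta0 : 0 < zeta by rewrite invr_gt0 exprn_gt0 // ltr0n muln_gt0.
have total : \sum_x \sum_y weight_mx E na nb alpha x y = alpha * #|E|%:R.
  under eq_bigr do rewrite rowsum.
  rewrite -mulr_sumr -natr_sum; congr (_ * _%:R).
  rewrite -[RHS]sum1_card (partition_big na xpredT) //=; apply: eq_bigr => x _.
  by rewrite -sum1_card; apply: eq_bigl => f; rewrite !inE.
(* The supports have at most [2 * #|G| / La] and [2 * #|G| / Lb] nodes, and [#|G| <= 2 * P * #|E|].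
   So the product of their sizes is at most [(4 * P * alpha * #|E|) ^ 2], and the total weight
   [alpha * #|E|] cancels in [alt_trace_ge]. *)
have T_ge : zeta <= \tr (alt_prod (weight_mx E na nb alpha) false L).
  have W0 := weight_mx_ge0 E na nb alpha0.
  have supp x y : weight_mx E na nb alpha x y != 0 ->
      x \in [set coord a f | f in E] /\ y \in [set coord b f | f in E].
    rewrite mxE => h; have [e|[f]] := set_0Vmem [set g in E | (na g == x) && (nb g == y)].
      by move: h; rewrite e cards0 mulr0 eqxx.
    by rewrite inE => /and3P[fE /eqP<- /eqP<-]; split; exact: imset_f.
  have := alt_trace_ge W0 supp (ltnW l1); rewrite -Ll total.
  pose SAn := #|[set coord a f | f in E]|; pose SBn := #|[set coord b f | f in E]|.
  rewrite -/SAn -/SBn; set T := \tr _ => tr.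
  have prodle : SAn%:R * SBn%:R * (La%:R * Lb%:R) <= 4 * #|G|%:R ^+ 2 :> R.
    have -> : SAn%:R * SBn%:R * (La%:R * Lb%:R) = (SAn%:R * La%:R) * (SBn%:R * Lb%:R) :> R by ring.
    have -> : 4 * #|G|%:R ^+ 2 = (2 * #|G|%:R) * (2 * #|G|%:R) :> R by ring.
    by apply: ler_pM; rewrite ?mulr_ge0 // -!natrM ler_nat.
  have Ple : #|G|%:R <= 2 * P%:R * #|E|%:R :> R by rewrite -!natrM ler_nat.
  have base : SAn%:R * SBn%:R <= (alpha * #|E|%:R) ^+ 2 * (4 * P%:R) ^+ 2.
    have ea : alpha ^+ 2 = (La%:R * Lb%:R)^-1.
      by rewrite -sa2 -sb2 /alpha; field; rewrite !lt0r_neq0.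
    have -> : (alpha * #|E|%:R) ^+ 2 * (4 * P%:R) ^+ 2 =
      (#|E|%:R * (4 * P%:R)) ^+ 2 * alpha ^+ 2 by ring.
    rewrite ea ler_pdivlMr ?mulr_gt0 //.
    apply: le_trans prodle _.
    have -> : (#|E|%:R * (4 * P%:R)) ^+ 2 = 4 * (2 * P%:R * #|E|%:R) ^+ 2 :> R by ring.
    by rewrite ler_pM2l // lerXn2r // nnegrE // !mulr_ge0.
  have aE : 0 < alpha * #|E|%:R by rewrite mulr_gt0.
  have pow (x y : R) : (x ^+ 2 * y ^+ 2) ^+ l = x ^+ L * y ^+ L.
    by rewrite exprMn -!exprM mul2n -addnn -Ll.
  have P4 : 0 < (4 * P%:R) ^+ L :> R by rewrite exprn_gt0 // mulr_gt0.
  rewrite /zeta natrM -[_^-1]mul1r ler_pdivrMr // -(ler_pM2l (exprn_gt0 L aE)) mulr1.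
  apply: le_trans tr _.
  have T0 : 0 <= T.
    by apply: sumr_ge0 => x _; rewrite Ll; exact: alt_prod_diag_ge0.
  have h : (SAn%:R * SBn%:R) ^+ l <= ((alpha * #|E|%:R) ^+ 2 * (4 * P%:R) ^+ 2) ^+ l.
    by rewrite lerXn2r ?nnegrE ?mulr_ge0 ?exprn_ge0 ?mulr_ge0 // ltW.
  apply: le_trans (ler_wpM2l T0 h) _.
  by rewrite pow mulrCA.
have d3R : n%:R ^+ 2 <= d%:R ^+ 3 :> R by rewrite -!natrX ler_nat.
have c1 : n%:R * varpi <= zeta * rho ^+ l.-1.
  apply: cube_le; first by rewrite mulr_ge0 ?exprn_ge0 ?(ltW zeta0) // (le_trans _ rho1).
  apply: le_trans cond_interp; rewrite /varpi exprMn expr_div_n mulrA ler_pdivrMr ?exprn_gt0 //.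
  have -> : n%:R ^+ 3 * 2 ^+ 3 = 8 * n%:R * n%:R ^+ 2 :> R by ring.
  by rewrite ler_pM2l // mulr_gt0.
have c2 : (8 * L ^ 2)%:R * (n%:R * varpi ^+ 2) <= zeta.
  apply: cube_le; first exact: ltW.
  have v3 : varpi ^+ 3 * n%:R ^+ 2 <= 8.
    rewrite /varpi expr_div_n mulrAC ler_pdivrMr ?exprn_gt0 //.
    have -> : 2 ^+ 3 = 8 :> R by ring.
    by rewrite ler_pM2l.
  have v6 : (varpi ^+ 2) ^+ 3 * n%:R ^+ 4 <= 64.
    have -> : (varpi ^+ 2) ^+ 3 * n%:R ^+ 4 = (varpi ^+ 3 * n%:R ^+ 2) ^+ 2 by ring.
    have -> : 64 = 8 ^+ 2 :> R by ring.
    by rewrite lerXn2r ?nnegrE // mulr_ge0 ?exprn_ge0 // ltW.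
  rewrite -(ler_pM2r nR); apply: le_trans cond_sq.
  have e (x : R) : (x * (n%:R * varpi ^+ 2)) ^+ 3 * n%:R =
    x ^+ 3 * ((varpi ^+ 2) ^+ 3 * n%:R ^+ 4) by ring.
  by rewrite e ler_wpM2l ?exprn_ge0.
have c3 : n%:R * varpi ^+ 2 <= zeta.
  apply: le_trans c2; apply: ler_peMl; first by rewrite mulr_ge0 ?exprn_ge0 // ltW.
  by rewrite ler1n muln_gt0 expn_gt0.
have eLb : #|E|%:R <= n%:R * Lb%:R :> R.
  rewrite -natrM ler_nat -sum1_card (partition_big nb xpredT) //=.
  apply: leq_trans (_ : \sum_(y : 'I_n) Lb <= _)%N; last by rewrite sum_nat_const card_ord.
  apply: leq_sum => y _; apply: leq_trans (colE y); rewrite -sum1_card.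
  by apply/eq_leq/eq_bigl => f; rewrite inE.
(* Since [alpha * kappa = 1 / Lb], the claim is [H * rho * C <= Lb], and [Lb] is at least
   [#|E| / n]. *)
have c4 : H * alpha * rho * kappa * (192 * 2 ^ L * L ^ L.+2)%:R <= 1.
  have ak : alpha * kappa = Lb%:R^-1.
    by rewrite -sb2 /alpha /kappa; field; rewrite !lt0r_neq0.
  move: cond_H; set C : R := (192 * 2 ^ L * L ^ L.+2)%:R => cH.
  have -> : H * alpha * rho * kappa * C = H * rho * C / Lb%:R by rewrite -ak; ring.
  rewrite ler_pdivrMr // mul1r.
  have hP : H * rho * C * n%:R * (2 * P)%:R <= #|E|%:R * (2 * P)%:R.
    by apply: le_trans cH _; rewrite -natrM ler_nat mulnC.
  move: hP; rewrite ler_pM2r ?ltr0n ?muln_gt0 // => hP.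
  by rewrite -(ler_pM2r nR); apply: le_trans hP _; rewrite mulrC.
have SSE h j : h \in E -> (1 < j)%N ->
    #|[set S in SS | (h \in S) && (#|S| == j)]|%:R <= H ^+ j.-1.
  by move=> hE; apply: SS_deg; exact: (subsetP EG).
have cl := @clashes_le _ _ m _ (@coord n' r) G E a b det EG fullE (ltnW r1).
have [f [fZ fc fn fS]] := good_walk_exists m_odd Ll l1 alpha0 kappa1 varpi0 varpi1
  row_le col_le entry_le zeta0 T_ge rho1 c1 cond_full c3 H0 SSE c4 c2 cl.
have ci g : g \in E -> injective (fun i : 'I_r => coord i g).
  by move=> gE; apply: coord_inj; exact: Gr (subsetP EG _ gE).
have r3 : (2 < r)%N by exact: leq_trans r4.
have finj := walk_injective ab fZ fc r3.
have fE i : f i \in E by move: fZ; rewrite inE => /andP[/forallP].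
exists [set f i | i : 'I_L]; split.
- by apply/subsetP => _ /imsetP[i _ ->]; exact: (subsetP EG).
- by rewrite card_imset ?card_ord //; exact: finj.
- exists (cycle_embedding (@coord n' r) ab f).
    exact: (cycle_embedding_inj ci fZ fc fn).
  apply/subsetP => _ /imsetP[e /imsetP[i _ ->] ->].
  rewrite (cycle_embedding_edge m_odd ab fZ) coord_image ?imset_f //.
  exact: Gr (subsetP EG _ (fE i)).
move=> S' S'S S'1.
have e : S' = f @: [set i | f i \in S'].
  apply/setP => x; apply/idP/imsetP => [xS|[i iS ->]]; last by move: iS; rewrite inE.
  by have /imsetP[i _ xi] := subsetP S'S _ xS; exists i; rewrite // inE -xi.
have ce : #|[set i | f i \in S']| = #|S'| by rewrite [in RHS]e card_imset //; exact: finj.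
by rewrite e; apply: fS; rewrite ?ce -?e.
Qed.

End Unsaturated.

(** * Balanced families of copies *)

Section Balanced.
Variables (R : realFieldType) (X : finType) (G : {set X}) (L : nat) (cyc : pred {set X}).
Variable h : R.
Hypotheses (L1 : (1 < L)%N) (h1 : 1 <= h).

Definition cover_deg (HH : {set {set X}}) (T : {set X}) : nat :=
  #|[set S in HH | T \subset S]|.

(** The value [2 ^+ L * h] comes from double counting: through an edge of degree below [h ^+ L.-1]
    there are at most [2 ^+ L * h ^+ j.-1] sets of size [j] and degree at least [h ^+ (L - j)]. *)
Definition avoidable_family :=
  forall (G' : {set X}) (SS : {set {set X}}), G' \subset G -> (#|G| <= 2 * #|G'|)%N ->
    (forall f j, f \in G' -> (1 < j)%N ->
       #|[set S in SS | (f \in S) && (#|S| == j)]|%:R <= (2 ^+ L * h) ^+ j.-1) ->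
    exists S : {set X}, [/\ S \subset G', #|S| = L, cyc S &
      forall S' : {set X}, S' \subset S -> (1 < #|S'|)%N -> S' \notin SS].

Let h0 : 0 < h. Proof. exact: lt_le_trans h1. Qed.

Lemma sum_cover_deg1 (HH : {set {set X}}) :
  (forall S, S \in HH -> #|S| = L) ->
  (\sum_f cover_deg HH [set f] = L * #|HH|)%N.
Proof.
move=> HL; rewrite /cover_deg; under eq_bigr do rewrite -sum1_card.
rewrite (exchange_big_dep (mem HH)) /=; last by move=> f S _; rewrite inE => /andP[].
rewrite mulnC -sum_nat_const; apply: eq_bigr => S SH.
by rewrite -(HL S SH) -sum1_card; apply: eq_bigl => f; rewrite inE SH sub1set.
Qed.

(* Double counting of the pairs (S, E) with f in S and S contained in E in HH. *)
Lemma sum_cover_deg_through (HH : {set {set X}}) (f : X) (P : pred {set X}) :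
  (forall S, S \in HH -> #|S| = L) ->
  (\sum_(S : {set X} | (f \in S) && P S) cover_deg HH S <= 2 ^ L * cover_deg HH [set f])%N.
Proof.
move=> HL; rewrite /cover_deg; under eq_bigr do rewrite -sum1_card.
rewrite (exchange_big_dep (fun E => (E \in HH) && (f \in E))) /=; last first.
  by move=> S E /andP[fS _]; rewrite inE => /andP[-> /subsetP->].
rewrite mulnC -sum_nat_const [leqRHS](eq_bigl (fun E => (E \in HH) && (f \in E))); last first.
  by move=> E; rewrite inE sub1set.
apply: leq_sum => E /andP[EH _].
rewrite sum1_card -(HL E EH) -card_powerset; apply/subset_leq_card/subsetP => S.
by rewrite powersetE => /andP[_]; rewrite inE => /andP[].
Qed.

(* A maximal family with bounded degrees is large, since otherwise few edges are
   saturated and avoidable_family provides one more member. *)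
Lemma balanced_family : avoidable_family ->
  exists HH : {set {set X}}, [/\
    forall S, S \in HH -> [/\ S \subset G, #|S| = L & cyc S],
    forall T : {set X}, (0 < #|T| <= L)%N -> (cover_deg HH T)%:R <= 2 * h ^+ (L - #|T|)
    & #|G|%:R * h ^+ L.-1 <= (2 * L)%:R * #|HH|%:R].
Proof.
move=> avoid.
(* The additional 1 leaves room for one more copy as long as the degree is below
   [h ^+ (L - #|T|)]. *)
pose ok (HH : {set {set X}}) :=
  [forall S in HH, [&& S \subset G, #|S| == L & cyc S]] &&
  [forall T : {set X}, (0 < #|T| <= L)%N ==> ((cover_deg HH T)%:R <= h ^+ (L - #|T|) + 1)].
have ok0 : ok set0.
  apply/andP; split; first by apply/forall_inP => S; rewrite inE.
  apply/forallP => T; apply/implyP => _; rewrite /cover_deg.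
  rewrite (_ : [set _ in _ | _] = set0) ?cards0 ?addr_ge0 ?exprn_ge0 ?(ltW h0) //.
  by apply/setP => S; rewrite !inE.
have [HH /andP[/forall_inP HHc /forallP HHd] HHmax] :=
  @arg_maxnP _ set0 ok (fun HH : {set {set X}} => #|HH|) ok0.
have HL S : S \in HH -> #|S| = L by move=> /HHc/and3P[_ /eqP].
exists HH; split.
- by move=> S /HHc/and3P[-> /eqP-> ->].
- move=> T /(implyP (HHd T)) h2; apply: le_trans h2 _.
  by have := exprn_ege1 (L - #|T|) h1; lra.
rewrite leNgt; apply/negP => small.
pose hL := h ^+ L.-1.
have hL0 : 0 < hL by exact: exprn_gt0.
pose sat := [set f in G | hL <= (cover_deg HH [set f])%:R].
have satG : sat \subset G by apply/subsetP => f; rewrite inE => /andP[].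
have satc : #|sat|%:R * hL <= L%:R * #|HH|%:R.
  rewrite -natrM -(sum_cover_deg1 HL) natr_sum mulr_natl -sumr_const big_mkcond.
  apply: ler_sum => f _; case: ifP => //; rewrite inE => /andP[_ //].
have half : (#|G| <= 2 * #|G :\: sat|)%N.
  have : (2 * #|sat| <= #|G|)%N.
    rewrite -(ler_nat R) -(ler_pM2r hL0); apply: le_trans (ltW small).
    by rewrite !natrM -!mulrA ler_wpM2l.
  rewrite cardsD (setIidPr satG); have := subset_leq_card satG; nat_lia.
(* For sets of size [L] the threshold is 1, so [SS] contains all members of [HH], and a copy
   avoiding [SS] is new. *)
pose SS := [set S : {set X} | (1 < #|S| <= L)%N && (h ^+ (L - #|S|) <= (cover_deg HH S)%:R)].
have [|S [SG' SL Sc SSS]] := avoid (G :\: sat) SS (subsetDl _ _) half.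
  move=> f j; rewrite in_setD inE => /andP[nsat fG] j1.
  rewrite fG /= -ltNge in nsat.
  have [jL|jL] := leqP j L; last first.
    rewrite (_ : [set _ in _ | _] = set0) ?cards0 ?exprn_ge0 ?mulr_ge0 ?exprn_ge0 ?(ltW h0) //.
    apply/setP => S; rewrite !inE; apply/negP => /andP[/andP[/andP[_ SL] _] /andP[_ /eqP Sj]].
    by move: jL; rewrite ltnNge -Sj SL.
  have hj0 : 0 < h ^+ (L - j) by exact: exprn_gt0.
  rewrite -(ler_pM2r hj0).
  apply: (@le_trans _ _ (2 ^+ L * hL)); last first.
    have -> : hL = h ^+ j.-1 * h ^+ (L - j) by rewrite /hL -exprD; congr (_ ^+ _); nat_lia.
    rewrite mulrA ler_wpM2r ?(ltW hj0) // exprMn ler_wpM2r ?exprn_ge0 ?(ltW h0) //.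
    have : 1 <= 2 ^+ L :> R by rewrite exprn_ege1 // ler1n.
    move=> g; rewrite -{1}[2 ^+ L]expr1 ler_weXn2l //; nat_lia.
  apply: (@le_trans _ _ ((2 ^ L * cover_deg HH [set f])%:R)); last first.
    by rewrite natrM natrX ler_wpM2l ?exprn_ge0 // ltW.
  apply: le_trans (_ : (\sum_(S : {set X} | (f \in S) && (S \in SS) && (#|S| == j)) cover_deg HH S)%:R <= _).
    rewrite natr_sum mulr_natl -sumr_const.
    rewrite (eq_bigl (fun S : {set X} => (f \in S) && (S \in SS) && (#|S| == j))); last first.
      by move=> S; rewrite inE; case: (f \in S); case: (S \in SS).
    apply: ler_sum => S /andP[/andP[_]]; rewrite inE => /andP[_ h2] /eqP Sj.
    by rewrite -Sj.
  rewrite ler_nat; apply: leq_trans (sum_cover_deg_through f (fun S => (S \in SS) && (#|S| == j)) HL).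
  by apply/eq_leq/eq_bigl => S; rewrite andbA.
have SHH : S \notin HH.
  apply/negP => SH; have := SSS S (subxx S); rewrite SL => /(_ L1) /negP; apply.
  rewrite inE SL L1 leqnn subnn expr0 ler1n card_gt0; apply/set0Pn; exists S.
  by rewrite inE SH subxx.
have okS : ok (S |: HH).
  apply/andP; split.
    apply/forall_inP => S'; rewrite !inE => /orP[/eqP->|/HHc//].
    by rewrite SL eqxx Sc !andbT; apply: subset_trans SG' (subsetDl _ _).
  apply/forallP => T; apply/implyP => TL.
  have [TS|nTS] := boolP (T \subset S); last first.
    apply: le_trans (implyP (HHd T) TL); rewrite ler_nat.
    apply/subset_leq_card/subsetP => S'; rewrite !inE => /andP[/orP[/eqP->|-> //]].
    by rewrite (negbTE nTS).
  have lt : (cover_deg HH T)%:R < h ^+ (L - #|T|).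
    have [T1|T1] := leqP #|T| 1.
      have /cards1P[f Tf] : #|T| == 1%N by rewrite eqn_leq T1; case/andP: TL.
      rewrite Tf cards1; have fS : f \in S by rewrite -sub1set -Tf.
      have := subsetP SG' f fS; rewrite in_setD inE => /andP[nsat fG].
      by rewrite fG /= -ltNge /hL in nsat; rewrite subn1.
    have := SSS T TS T1; rewrite inE T1 /=; case/andP: TL => _ ->.
    by rewrite /= -ltNge.
  rewrite /cover_deg; have -> : [set S' in S |: HH | T \subset S'] = S |: [set S' in HH | T \subset S'].
    by apply/setP => S'; rewrite !inE; have [->|] := eqVneq S' S; rewrite /= ?TS.
  rewrite cardsU1 inE (negbTE SHH) /= addnC natrD; exact: lerD (ltW lt) (lexx _).
by have := HHmax _ okS; rewrite /geq /= cardsU1 SHH /= add1n ltnn.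
Qed.

End Balanced.

(** * One round of containers *)

Section ContainerStep.
Variables (R : rcfType) (r m l : nat).
Local Notation L := m.+1.
Hypotheses (r4 : (4 <= r)%N) (l1 : (1 < l)%N) (Ll : L = (l + l)%N).

Theorem container_step : exists2 delta : R, 0 < delta &
  forall (n' t M : nat) (G : {set {set 'I_n'.+1}}) (h rho : R),
  let n := n'.+1 in let P := (t.+1 ^ (r * r))%N in let zeta := ((4 * P)%:R ^+ L)^-1 in
  (3 <= n)%N -> (forall e, e \in G -> #|e| = r) -> (#|G| < 2 ^ t.+1)%N ->
  (4 * P * (4 * (L * r) ^ 2 * (r * n ^ r.-1)) <= #|G|)%N ->
  1 <= h -> 1 <= rho -> #|G|%:R <= M%:R * h ->
  8 * n%:R <= (zeta * rho ^+ l.-1) ^+ 3 -> n%:R <= zeta * rho ^+ m ->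
  (8 * L ^ 2)%:R ^+ 3 * 64 <= zeta ^+ 3 * n%:R ->
  2 ^+ L * h * rho * (192 * 2 ^ L * L ^ L.+2)%:R * n%:R * (4 * P)%:R <= #|G|%:R ->
  exists CC : {set {set {set 'I_n}}}, [/\
    (#|CC| <= (#|G| + 2) ^ (m * M))%N,
    forall C, C \in CC -> C \subset G /\ #|C|%:R <= (1 - delta) * #|G|%:R
  & forall I : {set {set 'I_n}}, I \subset G -> copy_free (linear_cycle L r) I ->
      exists2 C, C \in CC & I \subset C].
Proof.
have L0 : 0 < (2 * L)%:R^-1 :> R by rewrite invr_gt0 ltr0n.
have [delta delta0 cont] := @containers R m 2 (2 * L)%:R^-1 ltac:(by []) L0.
exists delta => // n' t M G h rho n P zeta n3 Gr Gt Gbig h1 rho1 GM c1 c2 c3 c4.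
have h0 : 0 < h by exact: lt_le_trans h1.
have L1 : (1 < L)%N by rewrite Ll; move: l1; nat_lia.
pose cyc (S : {set {set 'I_n}}) := [exists f : {ffun linear_cycle_vertex L r -> 'I_n},
  injectiveb f && ([set f @: (e : {set linear_cycle_vertex L r}) | e in linear_cycle L r] \subset S)].
have avoid : avoidable_family G L cyc h.
  move=> G' SS G'G half SSd.
  have Gr' e : e \in G' -> #|e| = r by move=> eG; apply: Gr; exact: (subsetP G'G).
  have Gt' : (#|G'| < 2 ^ t.+1)%N by apply: leq_ltn_trans (subset_leq_card G'G) Gt.
  have Gbig' : (2 * P * (4 * (L * r) ^ 2 * (r * n ^ r.-1)) <= #|G'|)%N.
    rewrite -(leq_pmul2l (ltn0Sn 1)); apply: leq_trans half; rewrite !mulnA.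
    by move: Gbig; rewrite !mulnA.
  have H0 : 0 <= 2 ^+ L * h by rewrite mulr_ge0 ?exprn_ge0 // ltW.
  have cH : 2 ^+ L * h * rho * (192 * 2 ^ L * L ^ L.+2)%:R * n%:R * (2 * P)%:R <= #|G'|%:R.
    rewrite -(ler_pM2r (ltr0n R 2)).
    apply: (@le_trans _ _ #|G|%:R); last by rewrite -natrM ler_nat mulnC.
    have e : (2 * P)%:R * 2 = (4 * P)%:R :> R by rewrite !natrM; ring.
    by apply: le_trans c4; rewrite -[leLHS]mulrA e.
  have [S [SG SL Sc SSS]] := unsaturated_cycle r4 l1 Ll n3 Gr' Gt' Gbig' H0 SSd rho1 c1 c2 c3 cH.
  exists S; split=> //.
  have [f finj fS] := Sc; apply/existsP; exists (finfun f); apply/andP; split.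
    by apply/injectiveP => x y; rewrite !ffunE => /finj.
  apply: subset_trans fS; apply/subsetP => _ /imsetP[e eC ->]; apply/imsetP; exists e => //.
  by apply: eq_imset => x; rewrite ffunE.
have [HH [HHc HHd HHbig]] := balanced_family L1 h1 avoid.
pose w (E : {set {set 'I_n}}) : R := (E \in HH)%:R.
have wdegE T : wdeg w T = (cover_deg HH T)%:R.
  rewrite /wdeg /cover_deg -sum1_card natr_sum big_mkcond [RHS]big_mkcond.
  by apply: eq_bigr => E _; rewrite inE /w; case: (E \in HH); case: (T \subset E).
have wtot : \sum_E w E = #|HH|%:R.
  by rewrite -sum1_card natr_sum [RHS]big_mkcond; apply: eq_bigr => E _; rewrite /w; case: (E \in HH).
have D0 : 0 < h ^+ m by exact: exprn_gt0.
have tau0 : 0 < h^-1 by rewrite invr_gt0.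
have mA : h^-1 * #|G|%:R <= M%:R by rewrite ler_pdivrMl // mulrC.
(* With [tau = h^-1] and [D = h ^+ m], the degree bound [2 * h ^+ (L - #|T|)] takes the form
   [B * tau ^+ #|T|.-1 * D] for [B = 2]. *)
have wB : bounded_weight G L 2 h^-1 (h ^+ m) w.
  split=> [E|E|T T0 TL]; first by rewrite /w ler0n.
    by rewrite /w; case: (boolP (E \in HH)) => [/HHc[]//|_]; rewrite eqxx.
  have T_gt0 : (0 < #|T|)%N by rewrite card_gt0.
  rewrite wdegE; apply: le_trans (HHd T _) _; first by rewrite T_gt0.
  have -> : h ^+ m = h ^+ #|T|.-1 * h ^+ (L - #|T|).
    by rewrite -exprD; congr (_ ^+ _); nat_lia.
  by rewrite exprVn -mulrA mulKf // expf_neq0 // lt0r_neq0.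
have wbig : (2 * L)%:R^-1 * #|G|%:R * h ^+ m <= \sum_E w E.
  by rewrite wtot -mulrA ler_pdivrMl ?ltr0n.
have [CC [CCn CCs CCi]] := cont _ G M h^-1 (h ^+ m) w tau0 D0 mA wB wbig.
exists CC; split=> // [C CC1|I IG If].
  have [CG hC] := CCs C CC1; split=> //.
  by move: hC; rewrite cardsD (setIidPr CG) natrB ?subset_leq_card //; lra.
apply: CCi => // E; rewrite /w; case: (boolP (E \in HH)) => [EH _|_]; last by rewrite eqxx.
apply/negP => EI; apply: If.
have [_ _ /existsP[f /andP[/injectiveP finj fE]]] := HHc E EH.
by exists f => //; exact: subset_trans EI.
Qed.

End ContainerStep.

(** * Iteration of the container step *)

Section Iteration.
Variables (R : realFieldType) (V : finType) (free : {set V} -> Prop) (delta Y : R) (N : nat).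
Hypotheses (delta0 : 0 < delta) (delta1 : delta <= 1).
Variable K : {set V}.
Hypothesis step : forall G : {set V}, G \subset K -> Y < #|G|%:R ->
  exists CC : {set {set V}}, [/\ (#|CC| <= N)%N,
    forall C, C \in CC -> C \subset G /\ #|C|%:R <= (1 - delta) * #|G|%:R
  & forall I : {set V}, I \subset G -> free I -> exists2 C, C \in CC & I \subset C].

(** A container of size at most [Y] is kept, any other is replaced by at most [N] smaller ones. *)
Lemma iterate_containers (i : nat) : (0 < N)%N ->
  exists CC : {set {set V}}, [/\ (#|CC| <= N ^ i)%N,
    forall C, C \in CC -> C \subset K /\
      (#|C|%:R <= Y \/ #|C|%:R <= (1 - delta) ^+ i * #|K|%:R)
  & forall I : {set V}, I \subset K -> free I -> exists2 C, C \in CC & I \subset C].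
Proof.
move=> N0; elim: i => [|i [CC [CCn CCs CCi]]].
  exists [set K]; split=> [|C|I IK _]; first by rewrite cards1.
    by rewrite inE => /eqP->; split=> //; right; rewrite expr0 mul1r.
  by exists K; rewrite ?set11.
have ex (C : {set V}) : exists DD : {set {set V}}, C \in CC ->
    [/\ (#|DD| <= N)%N,
      forall D, D \in DD -> D \subset K /\
        (#|D|%:R <= Y \/ #|D|%:R <= (1 - delta) ^+ i.+1 * #|K|%:R)
    & forall I : {set V}, I \subset C -> free I -> exists2 D, D \in DD & I \subset D].
  have [CCC|] := boolP (C \in CC); last by exists set0.
  have [CK Cs] := CCs C CCC.
  have [CY|CY] := leP #|C|%:R Y.
    exists [set C] => _; split=> [|D|I IC _]; first by rewrite cards1.
      by rewrite inE => /eqP->; split=> //; left.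
    by exists C; rewrite ?set11.
  have [DD [DDn DDs DDi]] := step CK CY; exists DD => _; split=> // D /DDs[DC Dle].
  split; first exact: subset_trans DC CK.
  right; apply: le_trans Dle _; rewrite exprS -mulrA ler_wpM2l ?subr_ge0 //.
  by case: Cs => //; rewrite leNgt CY.
have [f Hf] := fin_all_exists ex.
exists (\bigcup_(C in CC) f C); split=> [|D /bigcupP[C CCC Df]|I IK Ifree].
- apply: leq_trans (card_bigcup_le _ _) _.
  apply: leq_trans (_ : \sum_(C in CC) N <= _)%N.
    by apply: leq_sum => C /Hf[].
  by rewrite sum_nat_const expnS mulnC leq_mul2l CCn orbT.
- by have [_ h _] := Hf C CCC; exact: h.
have [C CCC IC] := CCi I IK Ifree.
have [_ _ h] := Hf C CCC; have [D Df ID] := h I IC Ifree.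
by exists D => //; apply/bigcupP; exists C.
Qed.

End Iteration.

(** * Choice of the parameters *)

Lemma card_uniform_le (n' r : nat) :
  (#|[set e : {set 'I_n'.+1} | #|e| == r]| <= n'.+1 ^ r)%N.
Proof.
have inj : {in [set e : {set 'I_n'.+1} | #|e| == r] &, injective
    (fun e => [ffun i : 'I_r => coord i e] : {ffun 'I_r -> 'I_n'.+1})}.
  move=> e e'; rewrite !inE => /eqP er /eqP er' /ffunP h.
  by apply: (coord_det er er') => i; have := h i; rewrite !ffunE.
rewrite -(card_in_imset inj); apply: leq_trans (max_card _) _.
by rewrite card_ffun !card_ord.
Qed.

(** As [B = 2 / zeta], the choice [rho = nu * B] gives [zeta * rho ^+ k >= 2 * nu ^+ k] for positive
    [k]. The second condition then follows from [nu ^+ m = n], the first from [3 (l - 1) >= 2l - 1].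
    The value of [h] makes the last condition an equality, and [h >= 1] because
    [n * nu * Q <= n ^ 3] and [r >= 4]. *)
Lemma step_conditions (R : realFieldType) (r m l n P g : nat) (nu : R) :
  let L := m.+1 in
  let zeta : R := ((4 * P)%:R ^+ L)^-1 in
  let B : R := 2 * (4 * P)%:R ^+ L in
  let C : R := (192 * 2 ^ L * L ^ L.+2)%:R in
  let Q : R := 2 ^+ L * B * C * (4 * P)%:R in
  let h := g%:R / (n%:R * nu * Q) in let rho := nu * B in
  (4 <= r)%N -> (1 < l)%N -> L = (l + l)%N -> (0 < n)%N -> (0 < P)%N ->
  1 <= nu -> nu ^+ m = n%:R -> Q <= n%:R ->
  ((8 * L ^ 2) ^ 3 * 64)%:R * (4 * P)%:R ^+ (L * 3) <= n%:R :> R ->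
  (n ^ r.-1 <= g)%N ->
  [/\ 0 < Q, 1 <= h & 1 <= rho] /\ [/\ g%:R = n%:R * nu * Q * h,
    8 * n%:R <= (zeta * rho ^+ l.-1) ^+ 3, n%:R <= zeta * rho ^+ m,
    (8 * L ^ 2)%:R ^+ 3 * 64 <= zeta ^+ 3 * n%:R
    & 2 ^+ L * h * rho * C * n%:R * (4 * P)%:R <= g%:R].
Proof.
move=> L zeta B C Q h rho r4 l1 Ll n0 P0 nu1 num Qn c3 gn.
have nu0 : 0 < nu by exact: lt_le_trans nu1.
have nR : 0 < n%:R :> R by rewrite ltr0n.
have n1 : 1 <= n%:R :> R by rewrite ler1n.
have P4 : 1 <= (4 * P)%:R :> R by rewrite ler1n muln_gt0.
have P40 : 0 < (4 * P)%:R :> R by exact: lt_le_trans P4.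
have PL : 1 <= (4 * P)%:R ^+ L :> R by rewrite exprn_ege1.
have PL0 : 0 < (4 * P)%:R ^+ L :> R by exact: lt_le_trans PL.
have zeta0 : 0 < zeta by rewrite invr_gt0.
have zB : zeta * B = 2 by rewrite /zeta /B; field; rewrite lt0r_neq0.
have B1 : 1 <= B by rewrite /B; lra.
have B0 : 0 < B by exact: lt_le_trans B1.
have C0 : 0 < C by rewrite ltr0n muln_gt0 muln_gt0 expn_gt0 expn_gt0.
have Q0 : 0 < Q by rewrite !mulr_gt0 ?exprn_gt0.
have nuQ : 0 < n%:R * nu * Q by apply: mulr_gt0 => //; apply: mulr_gt0.
have num_ge : nu <= n%:R.
  rewrite -num -{1}[nu]expr1 ler_weXn2l //; move: l1 Ll; rewrite /L; nat_lia.
have zBk k : (0 < k)%N -> 2 <= zeta * B ^+ k.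
  case: k => // k _; rewrite exprS mulrA zB ler_peMr // exprn_ege1 //.
have gR : n%:R ^+ r.-1 <= g%:R :> R by rewrite -natrX ler_nat.
have h1 : 1 <= h.
  rewrite /h ler_pdivlMr // mul1r; apply: le_trans gR.
  apply: (@le_trans _ _ (n%:R ^+ 3)); last by rewrite ler_weXn2l //; move: r4; nat_lia.
  rewrite !exprS expr0 mulr1 -mulrA ler_wpM2l ?(ltW nR) //.
  by apply: ler_pM => //; exact: ltW.
split; first split=> //.
  by apply: le_trans B1 _; rewrite ler_peMl // ltW.
split.
- by rewrite /h mulrC divfK // lt0r_neq0.
- have hl : 2 * nu ^+ l.-1 <= zeta * rho ^+ l.-1.
    have -> : zeta * rho ^+ l.-1 = zeta * B ^+ l.-1 * nu ^+ l.-1.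
      by rewrite /rho exprMn; ring.
    rewrite ler_wpM2r ?exprn_ge0 ?(ltW nu0) //.
    by apply: zBk; move: l1; nat_lia.
  apply: (@le_trans _ _ ((2 * nu ^+ l.-1) ^+ 3)); last first.
    have h2 : 0 <= 2 * nu ^+ l.-1 by apply: mulr_ge0 => //; rewrite exprn_ge0 // ltW.
    by rewrite lerXn2r ?nnegrE // (le_trans h2 hl).
  rewrite exprMn; have -> : 2 ^+ 3 = 8 :> R by ring.
  rewrite ler_wpM2l // -num -exprM ler_weXn2l //.
  by move: l1 Ll; rewrite /L; nat_lia.
- rewrite /rho exprMn num mulrCA -[leLHS]mulr1 ler_wpM2l ?(ltW nR) //.
  apply: le_trans (zBk m _); first by rewrite ler1n.
  by move: l1 Ll; rewrite /L; nat_lia.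
- rewrite /zeta exprVn -exprM ler_pdivlMl ?exprn_gt0 //.
  have e : ((8 * L ^ 2) ^ 3 * 64)%:R = (8 * L ^ 2)%:R ^+ 3 * 64 :> R by rewrite natrM natrX.
  by rewrite -e mulrC.
have -> : 2 ^+ L * h * rho * C * n%:R * (4 * P)%:R = n%:R * nu * Q * h.
  by rewrite /rho /Q; ring.
by rewrite /h mulrC divfK // lt0r_neq0.
Qed.

From mathcomp Require Import all_classical all_reals all_analysis.
Import numFieldNormedType.Exports.

(** * Estimates for exponentials and logarithms *)

Section Growth.
Variable R : realType.

(** [expR x] is the power [k.+1] of [expR (x / k.+1)], which is at least [x / k.+1]; the surplus
    factor [x] pays for the denominator. *)
Lemma exprn_le_expR (k : nat) (x : R) :
  (k.+1 ^ k.+1)%:R <= x -> x ^+ k <= expR x.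
Proof.
move=> kx.
have k0 : 0 < k.+1%:R :> R by rewrite ltr0n.
have x0 : 0 < x by apply: lt_le_trans kx; rewrite ltr0n expn_gt0.
have e : expR x = expR (x / k.+1%:R) ^+ k.+1.
  by rewrite -expRM_natl mulrC divfK // lt0r_neq0.
rewrite e; apply: (@le_trans _ _ ((x / k.+1%:R) ^+ k.+1)); last first.
  rewrite lerXn2r ?nnegrE ?expR_ge0 ?divr_ge0 ?(ltW x0) //.
  by apply: le_trans (expR_ge1Dx _); rewrite lerDr.
rewrite expr_div_n ler_pdivlMr ?exprn_gt0 // [leRHS]exprS mulrC.
by rewrite ler_wpM2r ?exprn_ge0 ?(ltW x0) // -natrX.
Qed.

Lemma trunc_log2_le (r n : nat) : (0 < n)%N ->
  (trunc_log 2 (n ^ r))%:R <= 2 * r%:R * ln n%:R :> R.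
Proof.
move=> n0; set t := trunc_log _ _.
have ln2 : 1 / 2 <= ln 2 :> R.
  have := @le_ln1Dx R (- (1 / 2)); have -> : 1 + - (1 / 2) = 2^-1 :> R by field.
  rewrite lnV ?posrE // => h; have {}h := h ltac:(lra); lra.
have h : (2 ^ t <= n ^ r)%N by apply: trunc_logP; rewrite // expn_gt0 n0.
have {}h : t%:R * ln 2 <= r%:R * ln n%:R :> R.
  rewrite [leLHS]mulr_natl [leRHS]mulr_natl -!lnXn ?ltr0n // ler_ln ?posrE ?exprn_gt0 ?ltr0n //.
  by rewrite -!natrX ler_nat.
have t0 : 0 <= t%:R :> R by [].
nra.
Qed.

End Growth.

(** * Containers for large [n] *)

Section Eventually.
Variables (R : realType) (r m l : nat).
Local Notation L := m.+1.
Hypotheses (r4 : (4 <= r)%N) (l1 : (1 < l)%N) (Ll : L = (l + l)%N).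

Lemma containers_eventually : exists (K0 c : nat) (c0 : R), forall (n' : nat) (K : R),
  let n := n'.+1 in
  c0 <= ln n%:R -> K0%:R * ln n%:R ^+ (2 * r ^ 2) <= K ->
  exists CC : {set hypergraph 'I_n},
    [/\ #|CC|%:R <= expR ((n%:R : R) * n%:R `^ (2 * l%:R - 1)^-1 * ln n%:R ^+ c),
      forall G, G \in CC -> (forall e, e \in G -> #|e| = r) /\ #|G|%:R <= K * n%:R ^+ r.-1
    & forall I : hypergraph 'I_n, (forall e, e \in I -> #|e| = r) ->
        copy_free (linear_cycle L r) I -> exists2 G, G \in CC & I \subset G].
Proof.
have [delta' delta'0 step] := container_step R r4 l1 Ll.
pose delta := Num.min delta' 1.
have delta0 : 0 < delta by rewrite lt_min delta'0 ltr01.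
have delta1 : delta <= 1 by rewrite ge_min lexx orbT.
have deltad : delta <= delta' by rewrite ge_min lexx.
pose q := (4 * (L * r) ^ 2)%N.
pose e1 := (2 * r ^ 2)%N.
pose cQ := (2 ^ L * 2 * 4 ^ L * (192 * 2 ^ L * L ^ L.+2) * 4)%N.
pose cD := ((8 * L ^ 2) ^ 3 * 64 * 4 ^ (L * 3))%N.
pose k := (e1 * (L * 3)).+1.
pose cE : R := 2 * (r%:R + 1) * m%:R * (r%:R / delta + 1).
have cE0 : 0 <= cE by rewrite !mulr_ge0 ?addr_ge0 ?divr_ge0 ?(ltW delta0).
(* The first constant is that of the lower bound on [#|G|] in the container step. The exponent
   collects [(e1 * L.+1).+1] for [Q], 1 for the number of rounds, 1 for the logarithm of [n ^ r + 2]
   and 1 for [cE]. *)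
exists (4 * q * r)%N, (e1 * L.+1 + 4)%N,
  ((2 * r + 1)%:R + cQ%:R + cD%:R + (k.+1 ^ k.+1)%:R + cE).
move=> n' K n; set N : R := n%:R; set x := ln N => xbig hK.
have q0 : (0 < q)%N by rewrite muln_gt0 expn_gt0 muln_gt0 /= (leq_trans _ r4).
have [x1 [x2 [x3 [x4 x5]]]] : (2 * r + 1)%:R <= x /\ cQ%:R <= x /\ cD%:R <= x /\
    (k.+1 ^ k.+1)%:R <= x /\ cE <= x.
  have := ler0n R (2 * r + 1); have := ler0n R cQ; have := ler0n R cD.
  have := ler0n R (k.+1 ^ k.+1); move: xbig; lra.
have N0 : 0 < N by rewrite ltr0n.
have N1 : 1 <= N by rewrite ler1n.
have xge1 : 1 <= x by apply: le_trans x1; rewrite ler1n addn1.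
have x0 : 0 < x by exact: lt_le_trans xge1.
have Nx : expR x = N by rewrite lnK.
have n3 : (3 <= n)%N.
  rewrite -(ler_nat R) -/N -Nx; apply: le_trans (expR_ge1Dx x).
  have : 9%:R <= x by apply: le_trans x1; rewrite ler_nat; move: r4; nat_lia.
  lra.
have xk : x ^+ k <= N by rewrite -Nx; exact: exprn_le_expR.
pose t := trunc_log 2 (n ^ r).
(* This crude bound absorbs all constants; raised to the power [r * r], it yields the exponent
   [2 * r ^ 2] of the logarithm. *)
have tx : t.+1%:R <= x ^+ 2.
  rewrite -natr1; have := trunc_log2_le R r (ltn0Sn n'); rewrite -/n -/N -/x -/t => tl.
  apply: (@le_trans _ _ ((2 * r + 1)%:R * x)); last by rewrite expr2 ler_wpM2r // ltW.
  by rewrite natrD natrM mulrDl; lra.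
pose P := (t.+1 ^ (r * r))%N.
have P0 : (0 < P)%N by rewrite expn_gt0.
have Px : P%:R <= x ^+ e1.
  have -> : x ^+ e1 = (x ^+ 2) ^+ (r * r) by rewrite -exprM /e1 -mulnn.
  by rewrite natrX lerXn2r ?nnegrE ?exprn_ge0 // ltW.
have Pxj j : P%:R ^+ j <= x ^+ (e1 * j).
  by rewrite exprM lerXn2r ?nnegrE ?exprn_ge0 // ltW.
pose nu : R := N `^ (2 * l%:R - 1)^-1.
have mR : m%:R = 2 * l%:R - 1 :> R.
  by have := congr1 (fun a => a%:R : R) Ll; rewrite -natr1 natrD; lra.
have m0 : (0 < m)%N by move: l1 Ll; nat_lia.
have mR0 : 0 < m%:R :> R by rewrite ltr0n.
have nu_gt0 : 0 < nu by rewrite powR_gt0.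
have num : nu ^+ m = N.
  rewrite -powR_mulrn ?(ltW nu_gt0) // /nu -powRrM -mR mulVf ?lt0r_neq0 // powRr1 //.
have nu1 : 1 <= nu.
  by rewrite -[1](powRr0 N) ler_powR // invr_ge0 -mR ltW.
pose B : R := 2 * (4 * P)%:R ^+ L.
pose C : R := (192 * 2 ^ L * L ^ L.+2)%:R.
pose Q : R := 2 ^+ L * B * C * (4 * P)%:R.
have QE : Q = cQ%:R * P%:R ^+ L.+1.
  have e (p z d : nat) : 2 ^+ d * (2 * (4 * p)%:R ^+ d) * z%:R * (4 * p)%:R =
      (2 ^ d * 2 * 4 ^ d * z * 4)%:R * p%:R ^+ d.+1 :> R.
    by rewrite !natrM !natrX exprMn [p%:R ^+ _.+1]exprS; ring.
  exact: e.
have Q1 : 1 <= Q.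
  have pos (a b c d p : nat) : (0 < a)%N -> (0 < b)%N -> (0 < c)%N -> (0 < p)%N ->
      1 <= (a * 2 * b * (192 * a * c) * 4)%:R * p%:R ^+ d :> R.
    by move=> a0 b0 c0 p0; rewrite -natrX -natrM ler1n !muln_gt0 a0 b0 c0 expn_gt0 p0.
  by rewrite QE; apply: pos; rewrite ?expn_gt0.
have Qx : Q <= x ^+ (e1 * L.+1).+1.
  by rewrite QE [leRHS]exprS; apply: ler_pM; rewrite ?exprn_ge0.
have QN : Q <= N.
  apply: le_trans Qx (le_trans _ xk); rewrite ler_weXn2l // ltnS leq_mul2l.
  by apply/orP; right; nat_lia.
have DN : ((8 * L ^ 2) ^ 3 * 64)%:R * (4 * P)%:R ^+ (L * 3) <= N.
  apply: le_trans xk; rewrite /k [leRHS]exprS.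
  have -> : ((8 * L ^ 2) ^ 3 * 64)%:R * (4 * P)%:R ^+ (L * 3) = cD%:R * P%:R ^+ (L * 3) :> R.
    have e (p z d : nat) : z%:R * (4 * p)%:R ^+ d = (z * 4 ^ d)%:R * p%:R ^+ d :> R.
      by rewrite !natrM !natrX exprMn mulrA.
    exact: e.
  exact: ler_pM.
pose Y := K * N ^+ r.-1.
have K0le : (4 * q * r)%:R * P%:R <= K.
  by apply: le_trans hK; rewrite ler_wpM2l.
have YP : (4 * q * r)%:R * P%:R * N ^+ r.-1 <= Y by rewrite ler_wpM2r // exprn_ge0 // ltW.
have r0 : (0 < r)%N by exact: leq_trans r4.
have Y1 : 1 <= Y.
  apply: le_trans YP; rewrite -natrX -!natrM ler1n.
  by rewrite muln_gt0 expn_gt0 andbT muln_gt0 P0 andbT muln_gt0 r0 andbT muln_gt0 q0.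
pose S : {set {set 'I_n}} := [set e : {set 'I_n} | #|e| == r]%SET.
have SP (G : {set {set 'I_n}}) : G \subset S -> forall e, e \in G -> #|e| = r.
  by move=> GS e eG; have := fintype.subsetP GS e eG; rewrite inE => /eqP.
have Sn : (#|S| <= n ^ r)%N by exact: card_uniform_le.
(* An integer above [#|G| / h]; it is the same for all [G], because [h] is proportional to
   [#|G|]. *)
pose M := (Num.truncn (N * nu * Q)).+1.
have NnuQ0 : 0 <= N * nu * Q.
  by rewrite !mulr_ge0 ?exprn_ge0 // ltW.
have ML : N * nu * Q <= M%:R by have /andP[_ /ltW] := truncn_itv NnuQ0.
have cstep (G : {set {set 'I_n}}) : G \subset S -> Y < #|G|%:R ->
  exists CC : {set {set {set 'I_n}}}, [/\ (#|CC| <= (n ^ r + 2) ^ (m * M))%N,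
    forall D, D \in CC -> D \subset G /\ #|D|%:R <= (1 - delta) * #|G|%:R
  & forall I : {set {set 'I_n}}, I \subset G -> copy_free (linear_cycle L r) I ->
      exists2 D, D \in CC & I \subset D].
  move=> GS YG.
  have Gn : (#|G| <= n ^ r)%N by exact: leq_trans (subset_leq_card GS) Sn.
  have Gt : (#|G| < 2 ^ t.+1)%N by apply: leq_ltn_trans Gn _; exact: trunc_log_ltn.
  have Gbig : (4 * P * (4 * (L * r) ^ 2 * (r * n ^ r.-1)) <= #|G|)%N.
    rewrite -(ler_nat R); apply: le_trans (ltW YG); apply: le_trans YP.
    have e (p a b c d : nat) : (a * p * (b * (c * d)) = a * b * c * p * d)%N by ring.
    by rewrite -natrX -!natrM ler_nat; apply: eq_leq; exact: e.
  have Gr : (n ^ r.-1 <= #|G|)%N.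
    have e (p a b c d : nat) : (a * p * (b * (c * d)) = a * p * (b * c) * d)%N by ring.
    apply: leq_trans Gbig; rewrite e; apply: leq_pmull.
    have pos (a b c : nat) : (0 < a)%N -> (0 < b)%N -> (0 < c)%N -> (0 < 4 * a * (b * c))%N.
      by move=> a0 b0 c0; rewrite !muln_gt0 a0 b0 c0.
    exact: pos P0 q0 r0.
  have [[Q0 h1 rho1] [Gh c1 c2 c3 c4]] :=
    step_conditions r4 l1 Ll (ltn0Sn n') P0 nu1 num QN DN Gr.
  have GM : #|G|%:R <= M%:R * (#|G|%:R / (N * nu * Q)).
    rewrite {1}Gh; rewrite ler_wpM2r //; exact: le_trans h1.
  have [CC [CCn CCs CCi]] := step n' t M G _ _ n3 (SP G GS) Gt Gbig h1 rho1 GM c1 c2 c3 c4.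
  exists CC; split=> // [|D /CCs[DG Dle]].
    by apply: leq_trans CCn _; rewrite leq_exp2r ?leq_add2r // muln_gt0 m0.
  by split=> //; apply: le_trans Dle _; rewrite ler_wpM2r // lerD2l lerN2.
(* Enough rounds for [(1 - delta) ^+ i * n ^ r <= 1]; as [Y >= 1], no container stays above [Y]. *)
pose i := (Num.truncn (r%:R * x / delta)).+1.
have rx0 : 0 <= r%:R * x / delta by rewrite divr_ge0 ?mulr_ge0 // ltW.
have /andP[i_lo i_hi] := truncn_itv rx0.
have cnt0 : (0 < (n ^ r + 2) ^ (m * M))%N by rewrite expn_gt0 addn2.
have [CC [CCn CCs CCi]] := iterate_containers delta1 cstep i cnt0.
exists CC; split.
- have Nr : (n ^ r + 2)%:R <= expR ((r%:R + 1) * x).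
    rewrite mulrDl mul1r expRD expRM_natl Nx -natrX -natrM ler_nat.
    have : (1 <= n ^ r)%N by rewrite expn_gt0.
    have e (z d : nat) : (0 < z)%N -> (3 <= d)%N -> (z + 2 <= z * d)%N.
      by clear=> z0 d3; apply: (@leq_trans (z * 3)); [lia | rewrite leq_mul2l d3 orbT].
    by move=> z0; exact: e z0 n3.
  apply: (@le_trans _ _ (expR ((r%:R + 1) * x) ^+ (m * M * i))).
    apply: le_trans (_ : ((n ^ r + 2) ^ (m * M * i))%:R <= _).
      by rewrite ler_nat expnM.
    by rewrite natrX lerXn2r ?nnegrE ?expR_ge0.
  rewrite -expRM_natl ler_expR !natrM.
  have M2 : M%:R <= 2 * (N * nu * Q).
    have NnuQ1 : 1 <= N * nu * Q.
      by apply: mulr_ege1 => //; apply: mulr_ege1.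
    by rewrite /M -natr1; have /andP[+ _] := truncn_itv NnuQ0; lra.
  have i2 : i%:R <= (r%:R / delta + 1) * x.
    rewrite /i -natr1 mulrDl mul1r; apply: lerD => //.
    by apply: le_trans i_lo _; rewrite mulrAC.
  have r1 : 0 <= (r%:R + 1) * x by rewrite mulr_ge0 ?addr_ge0 // ltW.
  apply: (@le_trans _ _ (m%:R * (2 * (N * nu * Q)) * ((r%:R / delta + 1) * x) * ((r%:R + 1) * x))).
    by rewrite ler_wpM2r //; apply: ler_pM; rewrite ?mulr_ge0 // ler_wpM2l.
  have -> : m%:R * (2 * (N * nu * Q)) * ((r%:R / delta + 1) * x) * ((r%:R + 1) * x) =
     N * nu * (cE * (Q * x ^+ 2)) by rewrite /cE; ring.
  rewrite ler_wpM2l ?mulr_ge0 ?(ltW N0) ?(ltW nu_gt0) //.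
  have -> : x ^+ (e1 * L.+1 + 4) = x * (x ^+ (e1 * L.+1).+1 * x ^+ 2).
    by rewrite -exprD -exprS; congr (_ ^+ _); nat_lia.
  have QQ : 0 <= Q by rewrite !mulr_ge0 ?exprn_ge0.
  have x20 : 0 <= x ^+ 2 by rewrite exprn_ge0 // ltW.
  by apply: (ler_pM cE0 (mulr_ge0 QQ x20) x5); exact: ler_wpM2r x20 _ _ Qx.
- move=> G GCC; have [GS Gle] := CCs G GCC; split; first exact: SP.
  case: Gle => // Gle; apply: le_trans Gle _; apply: le_trans Y1.
  have d1 : 1 - delta <= expR (- delta) by exact: expR_ge1Dx.
  have h1 : (1 - delta) ^+ i <= expR (- (r%:R * x)).
    apply: (@le_trans _ _ (expR (- delta) ^+ i)).
      by rewrite lerXn2r ?nnegrE ?expR_ge0 ?subr_ge0.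
    rewrite -expRM_natl ler_expR mulrN lerN2.
    by rewrite -ler_pdivrMr // ltW.
  apply: (@le_trans _ _ (expR (- (r%:R * x)) * (n ^ r)%:R)).
    by apply: ler_pM => //; rewrite ?exprn_ge0 ?subr_ge0 // ler_nat.
  by rewrite expRN expRM_natl Nx natrX mulVf // expf_neq0 // lt0r_neq0.
move=> I Ir If; apply: CCi => //.
by apply/fintype.subsetP => e eI; rewrite inE; apply/eqP; exact: Ir.
Qed.

End Eventually.

Local Open Scope classical_set_scope.

Theorem theorem5p3 (R : realType) (r l : nat) (hr : (4 <= r)%N) (hl : (2 <= l)%N) :
  exists (K0 : nat) (c : R), 0 < c /\
    \forall n \near \oo, forall K : R,
      K0%:R * ln n%:R ^+ (2 * r ^ 2) <= K ->
      exists C : {set hypergraph 'I_n},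
        [/\ #|C|%:R <= expR (n%:R `^ (1 + (2 * l%:R - 1)^-1) * ln n%:R `^ c),
            forall G : hypergraph 'I_n, G \in C ->
              is_uniform r G /\ #|G|%:R <= K * n%:R ^+ (r - 1)
          & forall H : hypergraph 'I_n,
              is_uniform r H -> copy_free (linear_cycle (2 * l) r) H ->
              exists2 G : hypergraph 'I_n, G \in C & H \subset G].
Proof.
have [m lm] : exists m, (2 * l)%N = m.+1 by exists (2 * l).-1; rewrite prednK // muln_gt0 /= (ltnW hl).
have Ll : m.+1 = (l + l)%N by rewrite -lm mul2n addnn.
have [K0 [c [c0 main]]] := containers_eventually R hr hl Ll.
(* The successor makes the constant positive; the larger exponent is harmless because [ln n >= 1],
   which the threshold on [n] ensures. *)
exists K0, c.+1%:R; split; first by rewrite ltr0n.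
apply: filterS (nbhs_infty_ger (expR (Num.max c0 1))) => -[|n'] hn K hK.
  by move: hn; rewrite leNgt expR_gt0.
set n := n'.+1 in hn hK *.
have N0 : 0 < n%:R :> R by rewrite ltr0n.
have : Num.max c0 1 <= ln n%:R by rewrite -ler_expR lnK.
rewrite ge_max => /andP[c0n x1].
have x0 : 0 < ln n%:R :> R by exact: lt_le_trans x1.
have [CC [CCn CCs CCi]] := main n' K c0n hK.
rewrite lm; exists CC; split=> [|G /CCs[Gr Gle]|H Hr Hf].
- apply: le_trans CCn _; rewrite ler_expR.
  have e : 1 + (2 * l%:R - 1)^-1 != 0 :> R.
    apply: lt0r_neq0; rewrite addr_gt0 // invr_gt0 subr_gt0.
    by have : 2 <= l%:R :> R by [rewrite ler_nat]; lra.
  rewrite powRD ?lt0r_neq0 ?implybT // powRr1 ?(ltW N0) //.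
  rewrite ler_wpM2l ?mulr_ge0 ?powR_ge0 ?(ltW N0) // powR_mulrn ?(ltW x0) //.
  by rewrite ler_weXn2l.
- split; last by rewrite subn1.
  by apply/forall_inP => e eG; apply/eqP; exact: Gr.
by apply: CCi => // e eH; apply/eqP; exact: (forall_inP Hr).
Qed.
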